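(* Let $A$ be a finite dimensional algebra over a field $\mathbf{k}$, let $\mathbf{P}$ be a 2-term silting complex in $K^b(\operatorname{proj}A)$ and let $B=\operatorname{End}_{D^b(A)}(\mathbf{P})$. Let $P_i$ be an indecomposable projective $A$-module with $P_i[1]\notin\operatorname{add}\mathbf{P}$. Then $$\tau^{-1}\operatorname{Hom}_{D^b(A)}(\mathbf{P},\nu P_i)\cong\operatorname{Hom}_{D^b(A)}(\mathbf{P},P_i[1]),$$ where $\tau$ is the Auslander–Reiten translation in $\operatorname{mod}B$. In particular, $\operatorname{Hom}_{D^b(A)}(\mathbf{P},\nu P_i)$ is an injective $B$-module if and only if $P_i\in\operatorname{add}\mathbf{P}$.
   Context: $\operatorname{mod}A$ is the category of finitely generated right $A$-modules, $D^b(A)$ its bounded derived category with shift $[1]$, and $K^b(\operatorname{proj}A)$ the bounded homotopy category of finitely generated projective modules, viewed inside $D^b(A)$. $\operatorname{add}\mathbf{P}$ is the full subcategory (closed under isomorphism) of direct summands of finite direct sums of copies of $\mathbf{P}$. $\nu=D\operatorname{Hom}_A(-,A)$ is the Nakayama functor ($D$ the $\mathbf{k}$-dual). A 2-term silting complex is a complex $\mathbf{P}=\{P^i\}$ in $K^b(\operatorname{proj}A)$ with $P^i=0$ for $i\ne-1,0$, $\operatorname{Hom}_{K^b(\operatorname{proj}A)}(\mathbf{P},\mathbf{P}[1])=0$, and such that the smallest triangulated subcategory closed under direct summands containing $\mathbf{P}$ is $K^b(\operatorname{proj}A)$. $\operatorname{Hom}_{D^b(A)}(\mathbf{P},X)$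 is a right $B$-module by precomposition. *)

(* Defs.v *)
From HB Require Import structures.
From mathcomp Require Import all_boot all_order all_algebra all_field zify.
From mathcomp Require Import boolp.

Set Implicit Arguments.
Unset Strict Implicit.
Unset Printing Implicit Defensive.

Import GRing.Theory.
Local Open Scope ring_scope.

(* Conventions: left modules over R are [lmodType R]; right modules over R are
   [lmodType R^c], so that [(a : R^c) *: x] stands for x.a .  Composition is
   written in the usual order, (g o f)(x) = g (f x). *)

Section Modules.
Variable R : pzRingType.
Implicit Types M N P Q U V : lmodType R.

Definition fingen M : Prop :=
  exists (n : nat) (g : 'I_n -> M),
    forall x, exists c : 'I_n -> R, x = \sum_i c i *: g i.

Definition surj_map (S T : Type) (f : S -> T) : Prop :=
  forall y, exists x, f x = y.

Definition iso_mod M N : Prop :=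
  exists f : {linear M -> N}, bijective f.

Definition is_zero_mod M : Prop := forall x : M, x = 0.

Definition indecomposable_mod M : Prop :=
  ~ is_zero_mod M /\
  forall U V, iso_mod M (U * V)%type -> is_zero_mod U \/ is_zero_mod V.

Definition projective_mod P : Prop :=
  forall U V (g : {linear U -> V}) (f : {linear P -> V}), surj_map g ->
    exists h : {linear P -> U}, forall x, g (h x) = f x.

Definition injective_mod P : Prop :=
  forall U V (i : {linear U -> V}) (f : {linear U -> P}), injective i ->
    exists h : {linear V -> P}, forall x, h (i x) = f x.

Definition submodule M (S : M -> Prop) : Prop :=
  S 0 /\ forall (a : R) x y, S x -> S y -> S (a *: x + y).

Definition superfluous M (S : M -> Prop) : Prop :=
  forall T : M -> Prop, submodule T ->
    (forall x, exists s t, [/\ S s, T t & x = s + t]) -> forall x, T x.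

Definition minimal_proj_pres Q1 Q0 N
    (p1 : {linear Q1 -> Q0}) (p0 : {linear Q0 -> N}) : Prop :=
  [/\ fingen Q1 /\ projective_mod Q1, fingen Q0 /\ projective_mod Q0,
      surj_map p0, (forall x, p0 x = 0 <-> exists y, x = p1 y) &
      superfluous (fun x => p0 x = 0) /\ superfluous (fun x => p1 x = 0)].

End Modules.

Definition mklin (R : pzRingType) (U V : lmodType R) (f : U -> V)
    (fP : linear f) : {linear U -> V} :=
  HB.pack f (GRing.isLinear.Build R U V *:%R f fP).

Section LinearMaps.
Variables (R : pzRingType) (U V : lmodType R).

Definition linmap : Type := {linear U -> V}.

Definition linmap_lin (f : linmap) : {linear U -> V} := f.
Coercion linmap_lin : linmap >-> GRing.Linear.type.

HB.instance Definition _ := gen_eqMixin linmap.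
HB.instance Definition _ := gen_choiceMixin linmap.

Lemma linmapP (f g : linmap) : f =1 g -> f = g.
Proof.
case: f g => [f cf] [g cg] /= /funext E; rewrite /linmap_lin /= in E.
subst g; congr GRing.Linear.Pack.
case: cf cg => [[aN] [aZ]] [[bN] [bZ]].
by rewrite (Prop_irrelevance aN bN) (Prop_irrelevance aZ bZ).
Qed.

Definition linmap0 : linmap := \0 : {linear U -> V}.
Definition linmapD (f g : linmap) : linmap := (f \+ g : {linear U -> V}).
Definition linmapN (f : linmap) : linmap := (\- f : {linear U -> V}).

Lemma linmapDA : associative linmapD.
Proof. by move=> f g h; apply: linmapP => x /=; rewrite addrA. Qed.
Lemma linmapDC : commutative linmapD.
Proof. by move=> f g; apply: linmapP => x /=; rewrite addrC. Qed.
Lemma linmap0D : left_id linmap0 linmapD.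
Proof. by move=> f; apply: linmapP => x /=; rewrite add0r. Qed.
Lemma linmapND : left_inverse linmap0 linmapN linmapD.
Proof. by move=> f; apply: linmapP => x /=; rewrite addNr. Qed.

HB.instance Definition _ :=
  GRing.isZmodule.Build linmap linmapDA linmapDC linmap0D linmapND.

End LinearMaps.

(* Hom_R(M, R) of a left module M, with (f.b)(x) = f(x) b. *)
Section LeftHom.
Variables (R : pzRingType) (M : lmodType R).

Definition lhom : Type := linmap M R^o.
Coercion lhom_linmap (f : lhom) : linmap M R^o := f.
HB.instance Definition _ := GRing.Zmodule.copy lhom (linmap M R^o).

Definition lhom_scale_fun (b : R^c) (f : lhom) (x : M) : R^o := f x * (b : R).

Lemma lhom_scale_linear b f : linear (lhom_scale_fun b f).
Proof.
by move=> a x y; rewrite /lhom_scale_fun linearP mulrDl -mulrA.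
Qed.

Definition lhom_scale (b : R^c) (f : lhom) : lhom :=
  mklin (lhom_scale_linear b f).

Lemma lhom_scaleA b c f : lhom_scale b (lhom_scale c f) = lhom_scale (b * c) f.
Proof. by apply: linmapP => x; rewrite /= /lhom_scale_fun -mulrA. Qed.
Lemma lhom_scale1 : left_id 1 lhom_scale.
Proof. by move=> f; apply: linmapP => x; rewrite /= /lhom_scale_fun mulr1. Qed.
Lemma lhom_scaleDr : right_distributive lhom_scale +%R.
Proof.
by move=> b f g; apply: linmapP => x; rewrite /= /lhom_scale_fun mulrDl.
Qed.
Lemma lhom_scaleDl f : {morph lhom_scale^~ f : b c / b + c}.
Proof.
by move=> b c; apply: linmapP => x; rewrite /= /lhom_scale_fun mulrDr.
Qed.

HB.instance Definition _ := GRing.Zmodule_isLmodule.Build R^c lhom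
  lhom_scaleA lhom_scale1 lhom_scaleDr lhom_scaleDl.
End LeftHom.

(* Hom_R(M, R) of a right module M, with (b.f)(x) = b f(x). *)
Section RightHom.
Variables (R : pzRingType) (M : lmodType R^c).

Definition rhom : Type := linmap M (R^c)^o.
Coercion rhom_linmap (f : rhom) : linmap M (R^c)^o := f.
HB.instance Definition _ := GRing.Zmodule.copy rhom (linmap M (R^c)^o).

Definition rhom_scale_fun (b : R) (f : rhom) (x : M) : (R^c)^o :=
  b * (f x : R).

Lemma rhom_scale_linear b f : linear (rhom_scale_fun b f).
Proof.
move=> a x y; rewrite /rhom_scale_fun linearP [LHS]mulrDr; congr (_ + _).
exact: (@mulrA R).
Qed.

Definition rhom_scale (b : R) (f : rhom) : rhom :=
  mklin (rhom_scale_linear b f).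

Lemma rhom_scaleA b c f : rhom_scale b (rhom_scale c f) = rhom_scale (b * c) f.
Proof. by apply: linmapP => x; rewrite /= /rhom_scale_fun /= mulrA. Qed.
Lemma rhom_scale1 : left_id 1 rhom_scale.
Proof. by move=> f; apply: linmapP => x; rewrite /= /rhom_scale_fun mul1r. Qed.
Lemma rhom_scaleDr : right_distributive rhom_scale +%R.
Proof.
by move=> b f g; apply: linmapP => x; rewrite /= /rhom_scale_fun [LHS]mulrDr.
Qed.
Lemma rhom_scaleDl f : {morph rhom_scale^~ f : b c / b + c}.
Proof.
by move=> b c; apply: linmapP => x; rewrite /= /rhom_scale_fun [LHS]mulrDl.
Qed.

HB.instance Definition _ := GRing.Zmodule_isLmodule.Build R rhom
  rhom_scaleA rhom_scale1 rhom_scaleDr rhom_scaleDl.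
End RightHom.

(* A k-algebra structure on a ring, as a ring morphism to its center; [algType]
   would require the ring to be nonzero. *)
Record kstruct (k : fieldType) (R : pzRingType) := KStruct {
  kinj :> {rmorphism k -> R};
  kinjC : forall c x, kinj c * x = x * kinj c
}.

(* The k-vector space underlying a module over a k-algebra. *)
Definition restr (k : fieldType) (R : pzRingType) (e : kstruct k R)
  (M : lmodType R) : Type := M.

Section Restriction.
Variables (k : fieldType) (R : pzRingType) (e : kstruct k R).
Variable M : lmodType R.

Local Notation restr := (restr e M).

HB.instance Definition _ := GRing.Zmodule.copy restr M.

Definition restr_scale (c : k) (x : restr) : restr := e c *: (x : M).

Lemma restr_scaleA c d x :
  restr_scale c (restr_scale d x) = restr_scale (c * d) x.
Proof. by rewrite /restr_scale scalerA rmorphM. Qed.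
Lemma restr_scale1 : left_id 1 restr_scale.
Proof. by move=> x; rewrite /restr_scale rmorph1 scale1r. Qed.
Lemma restr_scaleDr : right_distributive restr_scale +%R.
Proof. by move=> c x y; rewrite /restr_scale [LHS]scalerDr. Qed.
Lemma restr_scaleDl x : {morph restr_scale^~ x : c d / c + d}.
Proof. by move=> c d; rewrite /restr_scale rmorphD [LHS]scalerDl. Qed.

HB.instance Definition _ := GRing.Zmodule_isLmodule.Build k restr
  restr_scaleA restr_scale1 restr_scaleDr restr_scaleDl.
End Restriction.

(* D M = Hom_k(M, k) of a left module, a right module by (phi.r)(x) = phi(r x). *)
Section LeftDual.
Variables (k : fieldType) (R : pzRingType) (e : kstruct k R) (M : lmodType R).

Definition ldual : Type := linmap (restr e M) k^o.
Coercion ldual_linmap (f : ldual) : linmap (restr e M) k^o := f.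
HB.instance Definition _ := GRing.Zmodule.copy ldual (linmap (restr e M) k^o).

Definition ldual_scale_fun (r : R^c) (f : ldual) (x : restr e M) : k^o :=
  f ((r : R) *: (x : M)).

Lemma ldual_scale_linear r f : linear (ldual_scale_fun r f).
Proof.
move=> c x y; rewrite /ldual_scale_fun -linearP; congr (linmap_lin f _).
rewrite [LHS]scalerDr; congr (_ + _).
by rewrite [LHS](@scalerA R) /= -kinjC -[LHS](@scalerA R).
Qed.

Definition ldual_scale (r : R^c) (f : ldual) : ldual :=
  mklin (ldual_scale_linear r f).

Lemma ldual_scaleA r s f :
  ldual_scale r (ldual_scale s f) = ldual_scale (r * s) f.
Proof.
apply: linmapP => x; congr (linmap_lin f _); exact: (@scalerA R M s r x).
Qed.
Lemma ldual_scale1 : left_id 1 ldual_scale.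
Proof.
move=> f; apply: linmapP => x; congr (linmap_lin f _); exact: (@scale1r R M).
Qed.
Lemma ldual_scaleDr : right_distributive ldual_scale +%R.
Proof. by move=> r f g; apply: linmapP. Qed.
Lemma ldual_scaleDl f : {morph ldual_scale^~ f : r s / r + s}.
Proof.
move=> r s; apply: linmapP => x; rewrite /= /ldual_scale_fun -linearD.
congr (linmap_lin f _); exact: (@scalerDl R M).
Qed.

HB.instance Definition _ := GRing.Zmodule_isLmodule.Build R^c ldual
  ldual_scaleA ldual_scale1 ldual_scaleDr ldual_scaleDl.
End LeftDual.

Section ConverseStructure.
Variables (k : fieldType) (R : pzRingType) (e : kstruct k R).

Definition kinjc (c : k) : R^c := e c.

Lemma kinjc_is_nmod : nmod_morphism kinjc.
Proof. by split=> [|x y]; rewrite /kinjc ?rmorph0 ?rmorphD. Qed.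
Lemma kinjc_is_monoid : monoid_morphism kinjc.
Proof. by split=> [|x y]; rewrite /kinjc ?rmorph1 // rmorphM kinjC. Qed.

HB.instance Definition _ := GRing.isNmodMorphism.Build k R^c kinjc kinjc_is_nmod.
HB.instance Definition _ :=
  GRing.isMonoidMorphism.Build k R^c kinjc kinjc_is_monoid.

Lemma kinjcC (c : k) (x : R^c) : kinjc c * x = x * kinjc c.
Proof. by symmetry; exact: (kinjC e c x). Qed.

Definition kconv : kstruct k R^c :=
  KStruct (kinj := kinjc : {rmorphism k -> R^c}) kinjcC.
End ConverseStructure.

(* D M of a right module, a left module by (r.phi)(x) = phi(x.r). *)
Section RightDual.
Variables (k : fieldType) (R : pzRingType) (e : kstruct k R).
Variable M : lmodType R^c.

Definition rdual : Type := linmap (restr (kconv e) M) k^o.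
Coercion rdual_linmap (f : rdual) : linmap (restr (kconv e) M) k^o := f.
HB.instance Definition _ :=
  GRing.Zmodule.copy rdual (linmap (restr (kconv e) M) k^o).

Definition rdual_scale_fun (r : R) (f : rdual) (x : restr (kconv e) M) : k^o :=
  f ((r : R^c) *: (x : M)).

Lemma rdual_scale_linear r f : linear (rdual_scale_fun r f).
Proof.
move=> c x y; rewrite /rdual_scale_fun -linearP; congr (linmap_lin f _).
rewrite [LHS]scalerDr; congr (_ + _).
transitivity ((r : R^c) *: (kinjc e c *: (x : M))); first by [].
transitivity (kinjc e c *: ((r : R^c) *: (x : M))); last by [].
by rewrite !(@scalerA R^c) kinjcC.
Qed.

HB.instance Definition _ r f :=
  GRing.isLinear.Build k (restr (kconv e) M) k^o *:%R
    (rdual_scale_fun r f) (rdual_scale_linear r f).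

Definition rdual_scale (r : R) (f : rdual) : rdual :=
  mklin (rdual_scale_linear r f).

Lemma rdual_scaleA r s f :
  rdual_scale r (rdual_scale s f) = rdual_scale (r * s) f.
Proof.
apply: linmapP => x; congr (linmap_lin f _); exact: (@scalerA R^c M s r x).
Qed.
Lemma rdual_scale1 : left_id 1 rdual_scale.
Proof.
move=> f; apply: linmapP => x; congr (linmap_lin f _); exact: (@scale1r R^c M).
Qed.
Lemma rdual_scaleDr : right_distributive rdual_scale +%R.
Proof. by move=> r f g; apply: linmapP. Qed.
Lemma rdual_scaleDl f : {morph rdual_scale^~ f : r s / r + s}.
Proof.
move=> r s; apply: linmapP => x; rewrite /= /rdual_scale_fun -linearD.
congr (linmap_lin f _); exact: (@scalerDl R^c M).
Qed.

HB.instance Definition _ := GRing.Zmodule_isLmodule.Build R rdual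
  rdual_scaleA rdual_scale1 rdual_scaleDr rdual_scaleDl.
End RightDual.

(* T is isomorphic to the transpose of the left module N, that is, to the
   cokernel of Hom_R(p1, R) for a minimal projective presentation
   Q1 -p1-> Q0 -p0-> N -> 0 . *)
Definition is_transpose (R : pzRingType) (N : lmodType R) (T : lmodType R^c) :
    Prop :=
  exists (Q1 Q0 : lmodType R) (p1 : {linear Q1 -> Q0}) (p0 : {linear Q0 -> N}),
    minimal_proj_pres p1 p0 /\
    exists q : {linear lhom Q1 -> T},
      surj_map q /\
      forall g : lhom Q1,
        q g = 0 <-> exists h : lhom Q0, forall x, g x = h (p1 x).

(* T is isomorphic to tau^{-1} M = Tr D M. *)
Definition is_tau_inv (k : fieldType) (R : pzRingType) (e : kstruct k R)
    (M T : lmodType R^c) : Prop :=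
  is_transpose (rdual e M) T.

Record fgmod (R : pzRingType) := FgMod {
  fgm :> lmodType R^c;
  fgmP : fingen fgm
}.

Section FinGen.
Variable R : pzRingType.

Lemma fingen_zero : fingen 'rV[R]_0.
Proof.
exists 0, (fun=> 0) => x; exists (fun=> 0).
by rewrite big_ord0; apply/rowP => -[].
Qed.

Lemma fingen_prod (U V : lmodType R) :
  fingen U -> fingen V -> fingen (U * V)%type.
Proof.
move=> [m [g gP]] [n [h hP]].
exists (m + n)%N, (fun i => match split i with
                           | inl j => (g j, 0) | inr j => (0, h j) end).
move=> [u v]; have [c uE] := gP u; have [d vE] := hP v.
exists (fun i => match split i with inl j => c j | inr j => d j end).
have fst_sum p (F : 'I_p -> U * V) : (\sum_i F i).1 = \sum_i (F i).1.
  by apply: (big_morph fst).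
have snd_sum p (F : 'I_p -> U * V) : (\sum_i F i).2 = \sum_i (F i).2.
  by apply: (big_morph snd).
apply: injective_projections; rewrite ?fst_sum ?snd_sum big_split_ord /=.
  rewrite uE [X in _ + X]big1 ?addr0.
    by apply: eq_bigr => i _; rewrite -[lshift n i]/(unsplit (inl i)) unsplitK.
  move=> i _; rewrite -[rshift m i]/(unsplit (inr i)) unsplitK /=.
  exact: scaler0.
rewrite vE [X in X + _]big1 ?add0r.
  by apply: eq_bigr => i _; rewrite -[rshift m i]/(unsplit (inr i)) unsplitK.
move=> i _; rewrite -[lshift n i]/(unsplit (inl i)) unsplitK /=.
exact: scaler0.
Qed.

Lemma fingen_ffun (U : lmodType R) n : fingen U -> fingen {ffun 'I_n -> U}.
Proof.
move=> [m [g gP]].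
have /choice [c cE] := gP.
exists #|{: 'I_n * 'I_m}|,
  (fun i => let p := enum_val i in [ffun j => if j == p.1 then g p.2 else 0]).
move=> f; exists (fun i => let p := enum_val i in c (f p.1) p.2).
apply/ffunP => j; rewrite sum_ffunE.
rewrite (reindex (@enum_rank {: 'I_n * 'I_m})) /=; last first.
  by exists enum_val => x _; rewrite ?enum_rankK ?enum_valK.
under eq_bigr => p _ do rewrite enum_rankK ffunE ffunE.
rewrite -(pair_bigA_idem _ (fun i l => c (f i) l *:
  (if j == i then g l else 0))) /= ?addr0 //.
rewrite (bigD1 j) //= [X in _ + X]big1 ?addr0 => [|i ij].
  by rewrite [LHS]cE; apply: eq_bigr => l _; rewrite eqxx.
by apply: big1 => l _; rewrite eq_sym (negPf ij) scaler0.
Qed.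

End FinGen.

Section Mod.
Variable R : pzRingType.
Implicit Types M N : fgmod R.

Definition zero_fg : fgmod R := FgMod (@fingen_zero R^c).
Definition prod_fg M N : fgmod R := FgMod (fingen_prod (fgmP M) (fgmP N)).
Definition pow_fg (n : nat) M : fgmod R := FgMod (fingen_ffun n (fgmP M)).

End Mod.

Section Nakayama.
Variables (k : fieldType) (A : falgType k).

Lemma in_algC (c : k) (x : A) : GRing.in_alg A c * x = x * GRing.in_alg A c.
Proof. by rewrite /= mulr_algl mulr_algr. Qed.

Definition kfalg : kstruct k A :=
  KStruct (kinj := GRing.in_alg A : {rmorphism k -> A}) in_algC.

(* Hom_A(M, A) embeds into A^n by evaluation at n generators of M, so it has a
   finite k-basis; the coordinate functions generate its dual. *)
Lemma fingen_nu (M : fgmod A) : fingen (ldual kfalg (rhom M)).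
Proof.
have [n [g gP]] := fgmP M.
pose H : lmodType k := restr kfalg (rhom M).
pose ev (f : H) : {ffun 'I_n -> A} := [ffun i => (f : rhom M) (g i) : A].
have evL : linear ev.
  move=> c f h; apply/ffunP => i; rewrite !ffunE.
  transitivity (GRing.in_alg A c * ((f : rhom M) (g i) : A)
                + ((h : rhom M) (g i) : A)); first by [].
  by rewrite /= mulr_algl.
have ev_inj : injective ev.
  move=> f h E; apply: linmapP => x; have [c ->] := gP x.
  rewrite !linear_sum; apply: eq_bigr => i _; rewrite !linearZ.
  by have /ffunP/(_ i) := E; rewrite !ffunE => /= ->.
pose L := mklin evL.
have exf : exists m, `[< exists s : seq H, size s = m /\ free (map L s) >].
  by exists 0; apply/asboolP; exists [::]; split=> //=; rewrite nil_free.
have bdf m : `[< exists s : seq H, size s = m /\ free (map L s) >] ->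
    (m <= \dim {: {ffun 'I_n -> A}})%N.
  move=> /asboolP[s [<- fs]]; move: fs; rewrite /free size_map => /eqP <-.
  exact: dimvS (subvf _).
have [m /asboolP[s [sm fs]] maxm] := ex_maxnP exf bdf.
have spn f : L f \in <<map L s>>%VS.
  apply: contraT => nf; have : (m.+1 <= m)%N; last by rewrite ltnn.
  apply: maxm; apply/asboolP; exists (f :: s); split; first by rewrite /= sm.
  by rewrite /= free_cons nf.
have {}spn f : L f \in <<in_tuple (map L s)>>%VS by apply: spn.
have szs : size (map L s) = m by rewrite size_map.
pose psi_f (j : 'I_m) (f : H) : k^o :=
  coord (in_tuple (map L s)) (cast_ord (esym szs) j) (L f).
have psiL j : linear (psi_f j) by move=> c f h; rewrite /psi_f !linearP.
exists m, (fun j => mklin (psiL j) : ldual kfalg (rhom M)) => phi.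
have phiZ (chi : ldual kfalg (rhom M)) c (f : H) :
    chi (GRing.in_alg A c *: (f : rhom M)) = c * chi f.
  exact: (linearZ_LR (linmap_lin chi) c f).
exists (fun j : 'I_m => GRing.in_alg A ((linmap_lin phi (nth 0 s j : H)) : k)).
apply: linmapP => f.
have ldual_sum (F : 'I_m -> ldual kfalg (rhom M)) :
    linmap_lin (\sum_j F j) f = \sum_j linmap_lin (F j) f :> k^o.
  by apply: (big_morph (fun h : ldual kfalg (rhom M) => linmap_lin h f)).
rewrite ldual_sum.
have fE : f = \sum_(j < m) psi_f j f *: (nth 0 s j : H) :> H.
  apply: ev_inj; rewrite -[LHS]/(L f) -[RHS]/(L _) linear_sum.
  rewrite {1}(coord_span (spn f)) (reindex (cast_ord (esym szs))) /=; last first.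
    by exists (cast_ord szs) => x _; rewrite ?cast_ordK ?cast_ordKV.
  apply: eq_bigr => j _; rewrite [RHS](linearZ_LR L); congr (_ *: _).
  by rewrite (nth_map 0) ?sm.
transitivity (linmap_lin phi (\sum_(j < m) psi_f j f *: (nth 0 s j : H))).
  by rewrite -fE.
rewrite linear_sum; apply: eq_bigr => j _; rewrite [LHS]linearZ_LR [LHS]mulrC.
exact/esym/(phiZ (mklin (psiL j))).
Qed.

Definition nu (M : fgmod A) : fgmod A := FgMod (fingen_nu M).

End Nakayama.

(* Differentials are cohomological, X^i -> X^(i+1). *)
Record cpx (R : pzRingType) := Cpx {
  cob :> int -> fgmod R;
  cdiff : forall i, {linear cob i -> cob (i + 1)};
  cdiffK : forall i x, cdiff (i + 1) (cdiff i x) = 0;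
  cbounded : exists n : nat, forall i : int, (n < `|i|)%N -> is_zero_mod (cob i)
}.

Record chmap (R : pzRingType) (X Y : cpx R) := ChMap {
  cmap :> forall i, {linear X i -> Y i};
  cmapP : forall i x, cmap (i + 1) (cdiff X i x) = cdiff Y i (cmap i x)
}.

Section Complexes.
Variable R : pzRingType.
Implicit Types X Y Z : cpx R.

Definition chid X : chmap X X.
Proof. by exists (fun i => idfun : {linear X i -> X i}). Defined.

Definition chcomp X Y Z (g : chmap Y Z) (f : chmap X Y) : chmap X Z.
Proof.
exists (fun i => g i \o f i : {linear X i -> Z i}).
abstract by move=> i x; rewrite /= !cmapP.
Defined.

Lemma shift_bounded X : exists n : nat, forall i : int,
  (n < `|i|)%N -> is_zero_mod (X (i + 1)).
Proof.
have [n nP] := cbounded X; exists n.+1 => i ni; apply: nP.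
by move: ni; lia.
Qed.

(* The shift X[1]: X[1]^i = X^(i+1), with differential -d. *)
Definition shift X : cpx R.
Proof.
exists (fun i => X (i + 1))
  (fun i => \- cdiff X (i + 1) : {linear X (i + 1) -> X (i + 1 + 1)}).
- abstract by move=> i x; rewrite /= linearN cdiffK !oppr0.
- exact: shift_bounded.
Defined.

Lemma stalk_bounded (M : fgmod R) : exists n : nat, forall i : int,
  (n < `|i|)%N -> is_zero_mod (if i == 0 then M else zero_fg R).
Proof.
exists 0 => i; have [-> //|_ _ x] := eqVneq i 0; by apply/rowP => -[].
Qed.

Definition stalk (M : fgmod R) : cpx R.
Proof.
exists (fun i : int => if i == 0 then M else zero_fg R)
  (fun i => \0 : {linear (if i == 0 then M else zero_fg R) ->
                         (if i + 1 == 0 then M else zero_fg R)}).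
- by [].
- exact: stalk_bounded.
Defined.

Definition zero_cpx : cpx R := stalk (zero_fg R).

Section DirectSum.
Variables X Y : cpx R.

Definition sum_diff_fun i (z : X i * Y i) : X (i + 1) * Y (i + 1) :=
  (cdiff X i z.1, cdiff Y i z.2).

Lemma sum_diff_linear i : linear (@sum_diff_fun i).
Proof. by move=> a x y; rewrite /sum_diff_fun /= !linearP. Qed.

Lemma sum_bounded : exists n : nat, forall i : int,
  (n < `|i|)%N -> is_zero_mod (prod_fg (X i) (Y i)).
Proof.
have [m mP] := cbounded X; have [n nP] := cbounded Y.
exists (maxn m n) => i; rewrite gtn_max => /andP[mi ni] [x y].
by rewrite (mP i mi x) (nP i ni y).
Qed.

Definition sum_cpx : cpx R.
Proof.
exists (fun i => prod_fg (X i) (Y i))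
  (fun i => mklin (@sum_diff_linear i)).
- abstract by move=> i x; rewrite /= /sum_diff_fun /= !cdiffK.
- exact: sum_bounded.
Defined.

End DirectSum.

Section Power.
Variables (n : nat) (X : cpx R).

Definition pow_diff_fun i (z : {ffun 'I_n -> X i}) : {ffun 'I_n -> X (i + 1)} :=
  [ffun j => cdiff X i (z j)].

Lemma pow_diff_linear i : linear (@pow_diff_fun i).
Proof. by move=> a x y; apply/ffunP => j; rewrite !ffunE linearP. Qed.

Lemma pow_bounded : exists m : nat, forall i : int,
  (m < `|i|)%N -> is_zero_mod (pow_fg n (X i)).
Proof.
have [m mP] := cbounded X; exists m => i mi x.
by apply/ffunP => j; rewrite ffunE; apply: mP.
Qed.

Definition pow_cpx : cpx R.
Proof.
exists (fun i => pow_fg n (X i))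
  (fun i => mklin (@pow_diff_linear i)).
- abstract by move=> i x; apply/ffunP => j; rewrite !ffunE cdiffK.
- exact: pow_bounded.
Defined.

End Power.

Section Cone.
Variables (X Y : cpx R) (f : chmap X Y).

Definition cone_diff_fun i (z : X (i + 1) * Y i) : X (i + 1 + 1) * Y (i + 1) :=
  (- cdiff X (i + 1) z.1, f (i + 1) z.1 + cdiff Y i z.2).

Lemma cone_diff_linear i : linear (@cone_diff_fun i).
Proof.
move=> a x y; rewrite /cone_diff_fun /= !linearP; congr pair.
by rewrite /= scalerDr addrACA.
Qed.

Lemma cone_diffK i x : @cone_diff_fun (i + 1) (@cone_diff_fun i x) = 0.
Proof.
rewrite /cone_diff_fun /=; congr pair; first by rewrite linearN cdiffK !oppr0.
by rewrite linearN linearD cmapP cdiffK addr0 addNr.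
Qed.

Lemma cone_bounded : exists n : nat, forall i : int,
  (n < `|i|)%N -> is_zero_mod (prod_fg (X (i + 1)) (Y i)).
Proof.
have [m mP] := shift_bounded X; have [n nP] := cbounded Y.
exists (maxn m n) => i; rewrite gtn_max => /andP[mi ni] [x y].
by rewrite (mP i mi x) (nP i ni y).
Qed.

Definition cone : cpx R.
Proof.
exists (fun i => prod_fg (X (i + 1)) (Y i))
  (fun i => mklin (@cone_diff_linear i)).
- exact: cone_diffK.
- exact: cone_bounded.
Defined.

End Cone.

(* Equality of morphisms in the homotopy category.  The homotopy has components
   s i : X^(i+1) -> Y^i, and every degree is of the form i + 1. *)
Definition homotopic X Y (f g : chmap X Y) : Prop :=
  exists s : forall i, {linear X (i + 1) -> Y i},
    forall i (x : X (i + 1)),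
      f (i + 1) x - g (i + 1) x = cdiff Y i (s i x) + s (i + 1) (cdiff X (i + 1) x).

Definition nullhomotopic X Y (f : chmap X Y) : Prop :=
  exists s : forall i, {linear X (i + 1) -> Y i},
    forall i (x : X (i + 1)),
      f (i + 1) x = cdiff Y i (s i x) + s (i + 1) (cdiff X (i + 1) x).

Definition homotopy_equiv X Y : Prop :=
  exists (f : chmap X Y) (g : chmap Y X),
    homotopic (chcomp g f) (chid X) /\ homotopic (chcomp f g) (chid Y).

(* f induces an isomorphism on the cohomology in every degree. *)
Definition quasi_iso X Y (f : chmap X Y) : Prop :=
  forall i,
    (forall x : X (i + 1), cdiff X (i + 1) x = 0 ->
       (exists y : Y i, f (i + 1) x = cdiff Y i y) ->
       exists x' : X i, x = cdiff X i x') /\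
    (forall y : Y (i + 1), cdiff Y (i + 1) y = 0 ->
       exists (x : X (i + 1)) (y' : Y i),
         cdiff X (i + 1) x = 0 /\ y = f (i + 1) x + cdiff Y i y').

(* The objects of K^b(proj A). *)
Definition proj_cpx X : Prop := forall i, projective_mod (X i).

(* Full triangulated subcategories of K^b(proj A), closed under isomorphisms
   and direct summands. *)
Record thick_subcat (T : cpx R -> Prop) : Prop := ThickSubcat {
  thick_proj : forall X, T X -> proj_cpx X;
  thick_zero : T zero_cpx;
  thick_iso : forall X Y, proj_cpx Y -> homotopy_equiv X Y -> T X -> T Y;
  thick_shift : forall X, T (shift X) <-> T X;
  thick_cone : forall X Y (f : chmap X Y), T X -> T Y -> T (cone f);
  thick_summand : forall X Y, proj_cpx X -> proj_cpx Y -> T (sum_cpx X Y) -> T X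
}.

Definition thick_generator P : Prop :=
  forall T, thick_subcat T -> T P -> forall X, proj_cpx X -> T X.

Definition two_term_silting P : Prop :=
  [/\ proj_cpx P,
      (forall i : int, i != -1 -> i != 0 -> is_zero_mod (P i)),
      (forall f : chmap P (shift P), nullhomotopic f) &
      thick_generator P].

(* X is an object of add P, for P in K^b(proj A). *)
Definition in_add P X : Prop :=
  exists (n : nat) (Y : cpx R),
    proj_cpx Y /\ homotopy_equiv (sum_cpx X Y) (pow_cpx n P).

End Complexes.

Record category (O : Type) := Category {
  hom :> O -> O -> Type;
  cid : forall x, hom x x;
  ccomp : forall x y z, hom y z -> hom x y -> hom x z;
  ccomp1l : forall x y (f : hom x y), ccomp (cid y) f = f;
  ccomp1r : forall x y (f : hom x y), ccomp f (cid x) = f;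
  ccompA : forall x y z t (h : hom z t) (g : hom y z) (f : hom x y),
    ccomp h (ccomp g f) = ccomp (ccomp h g) f
}.

Definition is_iso O (C : category O) x y (f : C x y) : Prop :=
  exists g : C y x, ccomp g f = cid C x /\ ccomp f g = cid C y.

Definition is_functor O O' (C : category O) (C' : category O') (F0 : O -> O')
    (F : forall x y, C x y -> C' (F0 x) (F0 y)) : Prop :=
  (forall x, F x x (cid C x) = cid C' (F0 x)) /\
  (forall x y z (g : C y z) (f : C x y),
     F x z (ccomp g f) = ccomp (F y z g) (F x y f)).

Section ComplexCategory.
Variable R : pzRingType.

Lemma chmapP (X Y : cpx R) (f g : chmap X Y) : (forall i, f i =1 g i) -> f = g.
Proof.
case: f g => [f fP] [g gP] /= E.
have {}E : f = g.
  apply: functional_extensionality_dep => i.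
  exact: (@linmapP _ _ _ (f i) (g i) (E i)).
by subst g; rewrite (Prop_irrelevance fP gP).
Qed.

Definition cpx_category : category (cpx R).
Proof.
exists (@chmap R) (@chid R) (@chcomp R).
- abstract by move=> X Y f; apply: chmapP.
- abstract by move=> X Y f; apply: chmapP.
- abstract by move=> X Y Z T h g f; apply: chmapP.
Defined.

End ComplexCategory.

Record lin_category (k : fieldType) (O : Type) := LinCategory {
  lhomset :> O -> O -> lmodType k;
  lid : forall x, lhomset x x;
  lcomp : forall x y z, lhomset y z -> lhomset x y -> lhomset x z;
  lcomp1l : forall x y (f : lhomset x y), lcomp (lid y) f = f;
  lcomp1r : forall x y (f : lhomset x y), lcomp f (lid x) = f;
  lcompA : forall x y z t (h : lhomset z t) (g : lhomset y z) (f : lhomset x y),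
    lcomp h (lcomp g f) = lcomp (lcomp h g) f;
  lcomp_linl : forall x y z (f : lhomset x y),
    linear (fun g : lhomset y z => lcomp g f);
  lcomp_linr : forall x y z (g : lhomset y z),
    linear (fun f : lhomset x y => lcomp g f)
}.

Definition lin_cat (k : fieldType) (O : Type) (C : lin_category k O) :
    category O :=
  Category (@lcomp1l k O C) (@lcomp1r k O C) (@lcompA k O C).

(* D^b(A), as the localization of the category of bounded complexes over mod A
   at the quasi-isomorphisms: the objects are those complexes, and [dloc] is the
   canonical functor, which is the identity on objects and is universal among
   the functors that invert quasi-isomorphisms.  These data are unique up to a
   unique isomorphism that is the identity on objects. *)
Record derived_category (k : fieldType) (A : falgType k) := DerivedCategory {
  dcat :> lin_category k (cpx A);
  dloc : forall X Y, chmap X Y -> dcat X Y;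
  dloc_functor : is_functor (C := cpx_category A) (C' := lin_cat dcat) dloc;
  dloc_linear : forall X Y (c : k) (f g h : chmap X Y),
    (forall i x, h i x = (kfalg A c : A^c) *: f i x + g i x) ->
    dloc h = c *: dloc f + dloc g;
  dloc_quasi_iso : forall X Y (f : chmap X Y),
    quasi_iso f -> is_iso (C := lin_cat dcat) (dloc f);
  dloc_universal : forall (O : Type) (E : category O) (F0 : cpx A -> O)
      (F : forall X Y, chmap X Y -> E (F0 X) (F0 Y)),
    is_functor (C := cpx_category A) F ->
    (forall X Y (f : chmap X Y), quasi_iso f -> is_iso (F X Y f)) ->
    exists G : forall X Y, dcat X Y -> E (F0 X) (F0 Y),
      [/\ is_functor (C := lin_cat dcat) G,
          (forall X Y (f : chmap X Y), G X Y (dloc f) = F X Y f) &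
          forall G' : forall X Y, dcat X Y -> E (F0 X) (F0 Y),
            is_functor (C := lin_cat dcat) G' ->
            (forall X Y (f : chmap X Y), G' X Y (dloc f) = F X Y f) ->
            forall X Y u, G' X Y u = G X Y u]
}.

Section EndRing.
Variables (k : fieldType) (O : Type) (C : lin_category k O) (P : O).

Definition endo : Type := C P P.
HB.instance Definition _ := GRing.Zmodule.copy endo (C P P).

Definition endo_mul (f g : endo) : endo := lcomp f g.

Lemma endo_mulA : associative endo_mul.
Proof. by move=> f g h; apply: lcompA. Qed.
Lemma endo_mul1l : left_id (lid C P : endo) endo_mul.
Proof. by move=> f; apply: lcomp1l. Qed.
Lemma endo_mul1r : right_id (lid C P : endo) endo_mul.
Proof. by move=> f; apply: lcomp1r. Qed.
Lemma endo_mulDl : left_distributive endo_mul +%R.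
Proof.
by move=> f g h; have := lcomp_linl h 1 f g; rewrite !scale1r.
Qed.
Lemma endo_mulDr : right_distributive endo_mul +%R.
Proof.
by move=> f g h; have := lcomp_linr f 1 g h; rewrite !scale1r.
Qed.

HB.instance Definition _ := GRing.Zmodule_isPzRing.Build endo
  endo_mulA endo_mul1l endo_mul1r endo_mulDl endo_mulDr.

Definition endo_scalar (c : k) : endo := c *: (lid C P : C P P).

Lemma lcompZl x y z (c : k) (g : C y z) (f : C x y) :
  lcomp (c *: g) f = c *: lcomp g f.
Proof.
have g0 : lcomp 0 f = 0 :> C x z.
  have := lcomp_linl f 1 (0 : C y z) 0; rewrite !scale1r addr0 => /esym/eqP.
  by rewrite -subr_eq0 addrK => /eqP.
by have := lcomp_linl f c g 0; rewrite g0 !addr0.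
Qed.

Lemma lcompZr x y z (c : k) (g : C y z) (f : C x y) :
  lcomp g (c *: f) = c *: lcomp g f.
Proof.
have g0 : lcomp g 0 = 0 :> C x z.
  have := lcomp_linr g 1 (0 : C x y) 0; rewrite !scale1r addr0 => /esym/eqP.
  by rewrite -subr_eq0 addrK => /eqP.
by have := lcomp_linr g c f 0; rewrite g0 !addr0.
Qed.

Lemma endo_scalar_nmod : nmod_morphism endo_scalar.
Proof.
by split=> [|c d]; rewrite /endo_scalar ?scale0r // scalerDl.
Qed.

Lemma endo_scalar_monoid : monoid_morphism endo_scalar.
Proof.
split=> [|c d]; first by rewrite /endo_scalar scale1r.
by rewrite [RHS]lcompZl lcomp1l /endo_scalar scalerA.
Qed.

HB.instance Definition _ :=
  GRing.isNmodMorphism.Build k endo endo_scalar endo_scalar_nmod.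
HB.instance Definition _ :=
  GRing.isMonoidMorphism.Build k endo endo_scalar endo_scalar_monoid.

Lemma endo_scalarC c (f : endo) : endo_scalar c * f = f * endo_scalar c.
Proof. by rewrite [LHS]lcompZl [RHS]lcompZr lcomp1l lcomp1r. Qed.

Definition endo_kstruct : kstruct k endo :=
  KStruct (kinj := endo_scalar : {rmorphism k -> endo}) endo_scalarC.

End EndRing.

(* Hom(P, X) as a right module over End(P), by precomposition. *)
Definition rep (k : fieldType) (O : Type) (C : lin_category k O) (P X : O) :
  Type := C P X.

Section Representable.
Variables (k : fieldType) (O : Type) (C : lin_category k O) (P X : O).
Local Notation rep := (rep C P X).
Local Notation B := (endo C P).

HB.instance Definition _ := GRing.Zmodule.copy rep (C P X).

Definition rep_scale (b : B^c) (f : rep) : rep := lcomp (f : C P X) (b : C P P).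

Lemma rep_scaleA b c f : rep_scale b (rep_scale c f) = rep_scale (b * c) f.
Proof. by symmetry; apply: lcompA. Qed.
Lemma rep_scale1 : left_id 1 rep_scale.
Proof. by move=> f; apply: lcomp1r. Qed.
Lemma rep_scaleDr : right_distributive rep_scale +%R.
Proof.
by move=> b f g; have := lcomp_linl (b : C P P) 1 (f : C P X) g; rewrite !scale1r.
Qed.
Lemma rep_scaleDl f : {morph rep_scale^~ f : b c / b + c}.
Proof.
by move=> b c; have := lcomp_linr (f : C P X) 1 (b : C P P) c; rewrite !scale1r.
Qed.

HB.instance Definition _ := GRing.Zmodule_isLmodule.Build B^c rep
  rep_scaleA rep_scale1 rep_scaleDr rep_scaleDl.
End Representable.

(* Main.v *)
From HB Require Import structures.
Require Import Defs.
From mathcomp Require Import all_boot all_order all_algebra all_field.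
From mathcomp Require Import zify ssrAC boolp classical_sets.

Set Implicit Arguments.
Unset Strict Implicit.
Unset Printing Implicit Defensive.

Import GRing.Theory.
Local Open Scope ring_scope.

(** Write Q for the given indecomposable projective module, B for End(P), and
M for Hom(P, nu Q).  Since Q is finitely generated projective, a trace on
Hom(Q, nu Q) makes Hom(P, nu Q) and Hom(Q, P) dual to each other over the base
field, compatibly with the actions of B ([pairing_perfect]).  So the dual of M
is the left B-module Hom(Q, P), and tau^{-1} M is the transpose of Hom(Q, P).

A presentation of Hom(Q, P) comes from a triangle Q -F-> P' -> C -> Q[1] in
which F is a left approximation of Q by add P.  The cone C has two terms and
satisfies Hom(C, P[1]) = 0 = Hom(P, C[1]); because P generates, this forces C
into add P ([silting_maximal]).  Applying Hom(-, P) gives the exact sequence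
Hom(C, P) -> Hom(P', P) -> Hom(Q, P) -> 0 of left B-modules, whose first two
terms are projective.  It is a minimal presentation: the kernel on the right is
superfluous when P' is chosen as small as possible ([minimal_approx]), and the
kernel on the left is superfluous because the maps C -> P that it contains
factor through Q[1], so that a failure would make Q[1] a summand of a power of
P, by Fitting's lemma for the indecomposable module Q.  Finally
Hom_B(Hom(C, P), B) is Hom(P, C) for C in add P, and the cokernel of
Hom(P, P') -> Hom(P, C) is Hom(P, Q[1]), because Hom(P, P'[1]) = 0
([tau_inv]).

For the injectivity statement: if Q is in add P, then Hom(Q, P) is projective
and M, its dual, is injective ([injective_of_in_addD]).  If M is injective, the
embedding of M into the dual of Hom(P', P) splits; dualizing, so does the
surjection Hom(P', P) -> Hom(Q, P).  Minimality then makes F an epimorphism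
against maps to P, so P' -> C vanishes and the identity of P' factors as
F rho.  The endomorphism rho F of Q is invertible or nilpotent.  In the first
case Q is a summand of P'; in the second F = 0, so Q[1] is a summand of C,
which is excluded ([in_addD_of_injective]).

All complexes that occur are concentrated in degrees -1 and 0, so a morphism of
the derived category out of a complex of projectives is a pair of module maps
up to homotopy.  That localization computes these homotopy classes is deduced
from its universal property ([dloc_full], [dloc_faithful]). *)

(** * Quotient modules *)

Section Quotient.
Variables (R : pzRingType) (M : lmodType R) (S : M -> Prop).
Hypothesis S_sub : submodule S.

Lemma submodule0 : S 0. Proof. exact: S_sub.1. Qed.
Lemma submoduleZ a x : S x -> S (a *: x).
Proof. by move=> Sx; rewrite -[_ *: _]addr0; apply: S_sub.2 => //; apply: submodule0. Qed.
Lemma submoduleD x y : S x -> S y -> S (x + y).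
Proof. by move=> Sx Sy; rewrite -[x]scale1r; apply: S_sub.2. Qed.
Lemma submoduleN x : S x -> S (- x).
Proof. by move=> Sx; rewrite -scaleN1r; apply: submoduleZ. Qed.
Lemma submoduleB x y : S x -> S y -> S (x - y).
Proof. by move=> Sx Sy; apply: submoduleD => //; apply: submoduleN. Qed.

(** The choice operator depends only on the extension of the predicate, so all
elements of a coset share this representative. *)
Definition coset_rep (x : M) : M := choose (fun y => `[< S (y - x) >]) x.

Lemma coset_repP x : S (coset_rep x - x).
Proof.
apply/asboolP; apply: (@chooseP _ (fun y => `[< S (y - x) >])).
by apply/asboolP; rewrite subrr; apply: submodule0.
Qed.

Lemma coset_repE x y : coset_rep x = coset_rep y <-> S (x - y).
Proof.
split=> [E|Sxy].
  have -> : x - y = (coset_rep y - y) - (coset_rep x - x).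
    by rewrite E opprB [RHS]addrC subrKA.
  by apply: submoduleB; apply: coset_repP.
rewrite /coset_rep.
have -> : choose (fun z => `[< S (z - x) >]) x = choose (fun z => `[< S (z - y) >]) x.
  apply: eq_choose => z; apply/asbool_equiv_eq; split=> Sz.
    by rewrite -[z](subrK x) -addrA; apply: submoduleD.
  rewrite -[z](subrK y) -addrA; apply: submoduleD => //.
  by rewrite -opprB; apply: submoduleN.
apply: choose_id; apply/asboolP => //.
by rewrite subrr; apply: submodule0.
Qed.

(** The submodule property is an argument so that the module structure below can be
inferred from the type. *)
Definition quotient_mod of submodule S : Type := {x : M | coset_rep x == x}.
Local Notation quo := (quotient_mod S_sub).
HB.instance Definition _ := Choice.copy quo {x : M | coset_rep x == x}.

Lemma coset_rep_idem x : coset_rep (coset_rep x) == coset_rep x.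
Proof. by apply/eqP/coset_repE; apply: coset_repP. Qed.

Definition quo_proj_fun (x : M) : quo := exist (fun y => coset_rep y == y) (coset_rep x)
    (coset_rep_idem x).

Lemma quo_proj_eq x y : quo_proj_fun x = quo_proj_fun y <-> S (x - y).
Proof.
split=> [[/coset_repE] //|/coset_repE E].
by apply: val_inj.
Qed.

Lemma quo_projK (z : quo) : quo_proj_fun (val z) = z.
Proof. by apply: val_inj; case: z => z /= /eqP. Qed.

Definition quo_add (z w : quo) := quo_proj_fun (val z + val w).
Definition quo_opp (z : quo) := quo_proj_fun (- val z).
Definition quo_scale a (z : quo) := quo_proj_fun (a *: val z).

Lemma quo_addE x y : quo_add (quo_proj_fun x) (quo_proj_fun y) = quo_proj_fun (x + y).
Proof.
apply/quo_proj_eq; rewrite /= opprD addrACA.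
by apply: submoduleD; apply: coset_repP.
Qed.
Lemma quo_oppE x : quo_opp (quo_proj_fun x) = quo_proj_fun (- x).
Proof.
apply/quo_proj_eq; rewrite /= -opprD.
by apply: submoduleN; apply: coset_repP.
Qed.
Lemma quo_scaleE a x : quo_scale a (quo_proj_fun x) = quo_proj_fun (a *: x).
Proof.
apply/quo_proj_eq; rewrite /= -scalerBr.
by apply: submoduleZ; apply: coset_repP.
Qed.

Lemma quo_elim (Q : quo -> Prop) : (forall x, Q (quo_proj_fun x)) -> forall z, Q z.
Proof. by move=> QP z; rewrite -(quo_projK z). Qed.

Lemma quo_addA : associative quo_add.
Proof. by do 3![elim/quo_elim=> ?]; rewrite !quo_addE addrA. Qed.
Lemma quo_addC : commutative quo_add.
Proof. by do 2![elim/quo_elim=> ?]; rewrite !quo_addE addrC. Qed.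
Lemma quo_add0 : left_id (quo_proj_fun 0) quo_add.
Proof. by elim/quo_elim=> ?; rewrite !quo_addE add0r. Qed.
Lemma quo_addN : left_inverse (quo_proj_fun 0) quo_opp quo_add.
Proof. by elim/quo_elim=> ?; rewrite quo_oppE !quo_addE addNr. Qed.

HB.instance Definition _ :=
  GRing.isZmodule.Build quo quo_addA quo_addC quo_add0 quo_addN.

Lemma quo_projD x y :
  quo_proj_fun (x + y) = quo_proj_fun x + quo_proj_fun y.
Proof. by rewrite -quo_addE. Qed.

Lemma quo_scaleA a b z : quo_scale a (quo_scale b z) = quo_scale (a * b) z.
Proof. by elim/quo_elim: z => ?; rewrite !quo_scaleE scalerA. Qed.
Lemma quo_scale1 : left_id 1 quo_scale.
Proof. by elim/quo_elim=> ?; rewrite !quo_scaleE scale1r. Qed.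
Lemma quo_scaleDr : right_distributive quo_scale +%R.
Proof.
move=> a; elim/quo_elim=> x; elim/quo_elim=> y.
by rewrite -quo_projD !quo_scaleE scalerDr quo_projD.
Qed.
Lemma quo_scaleDl z : {morph quo_scale^~ z : a b / a + b}.
Proof.
by move=> a b; elim/quo_elim: z => x; rewrite !quo_scaleE scalerDl quo_projD.
Qed.
HB.instance Definition _ := GRing.Zmodule_isLmodule.Build R quo
  quo_scaleA quo_scale1 quo_scaleDr quo_scaleDl.

Lemma quo_proj_linear : linear quo_proj_fun.
Proof. by move=> a x y; rewrite quo_projD -quo_scaleE. Qed.

Definition quo_proj : {linear M -> quo} := mklin quo_proj_linear.

Lemma quo_proj_surj : surj_map quo_proj.
Proof. by elim/quo_elim=> x; exists x. Qed.

Lemma quo_proj0 x : quo_proj x = 0 <-> S x.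
Proof. by rewrite -[x in S x]subr0; apply: quo_proj_eq. Qed.

End Quotient.

Lemma surj_inj_bij (S T : Type) (f : S -> T) :
  surj_map f -> injective f -> bijective f.
Proof.
move=> /choice[g gK] f_inj; exists g => // x; apply: f_inj; exact: gK.
Qed.

Lemma lin_inj0 (R : pzRingType) (U V : lmodType R) (f : {linear U -> V}) :
  (forall x, f x = 0 -> x = 0) -> injective f.
Proof.
move=> f0 x y E; apply/eqP; rewrite -subr_eq0; apply/eqP/f0.
by rewrite linearB E subrr.
Qed.

Lemma fingen_img (R : pzRingType) (M U : lmodType R) (p : {linear M -> U}) : surj_map p
    -> fingen M -> fingen U.
Proof.
move=> p_surj [n [g gP]]; exists n, (p \o g) => w.
have [v <-] := p_surj w; have [c ->] := gP v; exists c.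
by rewrite linear_sum; apply: eq_bigr => i _; rewrite linearZ.
Qed.

Definition lincomb (R : pzRingType) (V : lmodType R) n (g : 'I_n -> V)
    (c : {ffun 'I_n -> R^o}) : V := \sum_i (c i : R) *: g i.

Lemma lincomb_linear (R : pzRingType) (V : lmodType R) n (g : 'I_n -> V) :
  linear (lincomb g).
Proof.
move=> a x y; rewrite /lincomb scaler_sumr -big_split; apply: eq_bigr => i _.
by rewrite !ffunE scalerDl scalerA.
Qed.

(** * Finite-dimensional vector spaces *)

Section FiniteDimension.
Variable k : fieldType.
Implicit Types V W : lmodType k.

Definition kspan n V : Prop :=
  exists g : 'I_n -> V, forall x, exists c : 'I_n -> k, x = \sum_i c i *: g i.

(** A spanning family expresses a nonzero vector of the kernel with some nonzero
coefficient; the image of the generator at that place is redundant. *)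
Lemma kspan_drop n V W (p : {linear V -> W}) v :
  surj_map p -> kspan n V -> v <> 0 -> p v = 0 ->
  exists2 m, (m < n)%N & kspan m W.
Proof.
move=> p_surj [g gP] v0 pv0; have [c vE] := gP v.
have [j cj] : exists j, c j != 0.
  apply: contrapT => Nc; apply: v0; rewrite vE big1 // => i _.
  have [->|ci] := eqVneq (c i) 0; first by rewrite scale0r.
  by case: Nc; exists i.
case: n => [|m] in g gP c vE j cj *; first by case: j cj => -[].
exists m => //; exists (fun i => p (g (lift j i))) => w.
have [x <-] := p_surj w; have [d xE] := gP x.
exists (fun i => d (lift j i) - d j / c j * c (lift j i)).
have -> : p x = p (x - (d j / c j) *: v) by rewrite linearB linearZ pv0 /= scaler0 subr0.
rewrite xE vE scaler_sumr -sumrB (bigD1_ord j) //= scalerA -mulrA mulVf // mulr1.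
rewrite subrr add0r linear_sum; apply: eq_bigr => i _.
by rewrite scalerA -scalerBl linearZ.
Qed.

(** A spanning family of minimal length has no linear relation, by [kspan_drop]. *)
Lemma kbasis V : fingen V ->
  exists (n : nat) (b : {linear 'rV[k]_n -> V}), bijective b.
Proof.
move=> [n0 sp0].
have ex : exists n, `[< kspan n V >] by exists n0; apply/asboolP.
have [n /asboolP[g gP] nmin] := ex_minnP ex.
have lin : linear (fun r : 'rV[k]_n => \sum_i r 0 i *: g i).
  move=> a x y; rewrite scaler_sumr -big_split; apply: eq_bigr => i _.
  by rewrite !mxE scalerDl scalerA.
pose b := mklin lin.
have b_surj : surj_map b.
  move=> x; have [c ->] := gP x; exists (\row_i c i).
  by rewrite /=; apply: eq_bigr => i _; rewrite mxE.
exists n, b; apply: surj_inj_bij => //; apply: lin_inj0 => v bv0.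
apply: contrapT => v0.
have sprV : kspan n 'rV[k]_n.
  exists (fun i => delta_mx 0 i) => x; exists (fun i => x 0 i).
  exact: row_sum_delta.
have [m mn sp] := kspan_drop b_surj sprV v0 bv0.
by have := nmin m (asboolT sp); rewrite leqNgt mn.
Qed.

(** The relation exhibits W as a quotient of a subspace of V.  Free families of W
lift to free families of V, so their lengths are bounded, and a maximal one spans. *)
Lemma fingen_subquotient V W (r : V -> W -> Prop) :
  fingen V ->
  (forall a v w v' w', r v w -> r v' w' -> r (a *: v + v') (a *: w + w')) ->
  (forall w, r 0 w -> w = 0) -> (forall w, exists v, r v w) -> fingen W.
Proof.
move=> Vfg rL r0 rS; have [n [b [bi bK biK]]] := kbasis Vfg.
pose free m := exists h : {linear 'rV[k]_m -> W}, injective h.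
have r00 : r 0 0.
  have [v rv] := rS 0; have := rL (-1) _ _ _ _ rv rv.
  by rewrite !scaleN1r !addNr.
have free_le m : free m -> (m <= n)%N.
  move=> [h h_inj].
  have /choice[v vP] : forall i : 'I_m, exists v, r v (h (delta_mx 0 i)).
    by move=> i; apply: rS.
  pose F : 'M[k]_(m, n) := \matrix_(i, j) bi (v i) 0 j.
  have rF x : r (b (x *m F)) (h x).
    have -> : x *m F = \sum_i x 0 i *: bi (v i).
      apply/rowP => j; rewrite !mxE summxE; apply: eq_bigr => i _.
      by rewrite !mxE.
    rewrite {2}(row_sum_delta x) !linear_sum.
    elim/big_ind2: _ => // [v1 w1 v2 w2 rv1 rv2|i _].
      by have := rL 1 _ _ _ _ rv1 rv2; rewrite !scale1r.
    rewrite !linearZ /= biK.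
    by have := rL (x 0 i) _ _ _ _ (vP i) r00; rewrite !addr0.
  have : row_free F.
    apply: inj_row_free => x xF; apply/h_inj; rewrite linear0; apply: r0.
    by have := rF x; rewrite xF linear0.
  by rewrite -row_leq_rank => /leq_trans-> //; apply: rank_leq_col.
have ex : exists m, `[< free m >].
  exists 0; apply/asboolP; exists (\0 : {linear 'rV[k]_0 -> W}) => x y _.
  by apply/rowP => -[].
have bd m : `[< free m >] -> (m <= n)%N by move=> /asboolP; apply: free_le.
have [m /asboolP[h h_inj] mmax] := ex_maxnP ex bd.
suff h_surj : surj_map h.
  apply: (fingen_img h_surj); exists m, (fun i => delta_mx 0 i) => x; exists (fun i => x
      0 i).
  exact: row_sum_delta.
move=> w; apply: contrapT => Nw.
have lin : linear (fun x : 'rV[k]_(1 + m) => x 0 0 *: w + h (rsubmx x)).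
  move=> a x y; rewrite linearP /= linearP !mxE scalerDl scalerDr scalerA.
  by rewrite addrACA.
suff : free (1 + m)%N by move=> /asboolP/mmax; rewrite ltnn.
exists (mklin lin); apply: lin_inj0 => x /= E.
have x00 : x 0 0 = 0.
  apply: contrapT => /eqP x0; case: Nw; exists (- (x 0 0)^-1 *: rsubmx x).
  rewrite linearZ /= scaleNr; apply/eqP; rewrite eq_sym -subr_eq0 opprK.
  apply/eqP; rewrite -[w in LHS](scale1r w) -(mulVf x0) -scalerA -scalerDr E.
  by rewrite scaler0.
move: E; rewrite x00 scale0r add0r => E.
have rx : rsubmx x = 0 by apply: h_inj; rewrite E linear0.
rewrite -[x](@hsubmxK _ 1 1 m) rx; apply/rowP => i; rewrite !mxE.
case: split => j; rewrite !mxE // ord1.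
by rewrite -[RHS]x00; congr (x _ _); apply: val_inj.
Qed.
(** The rank of the powers of phi is minimal at some N, so it is the same at N and
at 2N; the images and the kernels of these two powers then agree. *)
Lemma fitting V (phi : {linear V -> V}) : fingen V ->
  exists2 N, (0 < N)%N & (forall x, exists y, iter N phi x = iter (N + N) phi y) /\
            (forall x, iter (N + N) phi x = 0 -> iter N phi x = 0).
Proof.
move=> /kbasis[n [b [bi bK biK]]].
have bi_lin : linear bi.
  by move=> a x y; apply: (can_inj bK); rewrite linearP /= !biK.
pose F := lin1_mx (mklin bi_lin \o phi \o b : {linear _ -> _}).
pose G i := iter i (mulmxr F) 1%:M.
have GP i x : iter i phi x = b (bi x *m G i).
  elim: i => [|i IH]; first by rewrite mulmx1 biK.
  by rewrite iterS IH /= mulmxA mul_rV_lin1 /= biK.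
have GD i j : G (i + j)%N = G i *m G j.
  elim: j => [|j IH]; first by rewrite addn0 mulmx1.
  by rewrite addnS /G !iterS -/(G _) IH /= mulmxA.
have ex : exists r, `[< exists2 i, (0 < i)%N & \rank (G i) = r >].
  by exists (\rank (G 1)); apply/asboolP; exists 1.
have [r /asboolP[N N0 rN] rmin] := ex_minnP ex.
have rNN : \rank (G N *m G N) = \rank (G N).
  apply/eqP; rewrite eqn_leq mxrankS ?submxMl //= rN rmin //.
  by apply/asboolP; exists (N + N)%N; rewrite ?GD // addn_gt0 N0.
exists N => //; split=> x.
  have /submxP[E EP] : (G N <= G N *m G N)%MS.
    by rewrite -(mxrank_leqif_sup (submxMl _ _)) rNN.
  exists (b (bi x *m E)); rewrite !GP bK GD -mulmxA -EP.
  by [].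
rewrite !GP GD mulmxA => E0.
have {E0} E0 : bi x *m G N *m G N = 0 by apply: (can_inj bK); rewrite E0 linear0.
have := mxrank_mul_ker (G N) (G N); rewrite rNN => /eqP.
rewrite -[X in _ == X]addn0 eqn_add2l mxrank_eq0 => /eqP cap0.
have : (bi x *m G N <= G N :&: kermx (G N))%MS.
  by rewrite sub_capmx submxMl; apply/sub_kermxP.
by rewrite cap0 submx0 => /eqP->; rewrite linear0.
Qed.

(** A pairing that identifies V with the dual of a finite-dimensional W also
identifies W with the dual of V: coordinates in a basis of W are represented by
vectors of V, which form the dual basis. *)
Lemma dual_pairing V W (beta : V -> W -> k^o) :
  fingen W -> (forall w, linear (beta^~ w)) -> (forall v, linear (beta v)) ->
  (forall v, (forall w, beta v w = 0) -> v = 0) ->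
  (forall lam : {linear W -> k^o}, exists v, forall w, beta v w = lam w) ->
  (forall Lam : {linear V -> k^o}, exists w, forall v, beta v w = Lam v) /\
  (forall w, (forall v, beta v w = 0) -> w = 0).
Proof.
move=> /kbasis[n [b [bi bK biK]]] linl linr beta_inj beta_surj.
have bi_lin : linear bi.
  by move=> a x y; apply: (can_inj bK); rewrite linearP /= !biK.
pose bL := mklin bi_lin.
have /choice[m mP] : forall j : 'I_n, exists v, forall w, beta v w = bi w 0 j.
  move=> j; have lin : linear (fun w => bi w 0 j : k^o).
    by move=> a x y; rewrite bi_lin !mxE.
  exact: (beta_surj (mklin lin)).
have betaE v w : beta v w = \sum_j bi w 0 j * beta v (b (delta_mx 0 j)).
  rewrite -{1}(biK w) {1}(row_sum_delta (bi w)).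
  rewrite -[LHS]/(mklin (linr v) _) !linear_sum; apply: eq_bigr => j _.
  by rewrite !linearZ.
split=> [Lam|w w0].
  exists (b (\row_j Lam (m j))) => v.
  have -> : v = \sum_j beta v (b (delta_mx 0 j)) *: m j.
    apply/eqP; rewrite -subr_eq0; apply/eqP/beta_inj => w.
    rewrite -[LHS]/(mklin (linl w) _) linearB linear_sum.
    apply/eqP; rewrite subr_eq0 [eqbLHS]/= betaE; apply/eqP/eq_bigr => j _.
    by rewrite linearZ /= mP [RHS]mulrC.
  rewrite -[LHS]/(mklin (linl _) _) !linear_sum; apply: eq_bigr => j _.
  by rewrite !linearZ /= mP bK mxE.
have : bi w = 0 by apply/rowP => j; rewrite -mP w0 mxE.
by rewrite -{2}(biK w) => ->; rewrite linear0.
Qed.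

(** The target may be infinite-dimensional, so Zorn's lemma is applied to the
partial functionals that agree with lam, seen as linear subsets of the graph
space W * k.  Agreement at 0 makes them single-valued. *)
Lemma extend_functional V W (i : {linear V -> W}) (lam : {linear V -> k^o}) :
  injective i -> exists mu : {linear W -> k^o}, forall v, mu (i v) = lam v.
Proof.
move=> i_inj.
pose good (A : set (W * k^o)) :=
  (forall a x y, A x -> A y -> A (a *: x + y)) /\
  (forall v c, A (i v, c) -> c = lam v).
have [|A [[A_lin A_lam] A_max]] := @Zorn_bigcup _ good.
  move=> F Fgood Ftot; split=> [a x y [X FX Xx] [Y FY Yy]|v c [X /Fgood[_]]];
    last exact.
  have [XY|YX] := Ftot X Y FX FY.
    by exists Y => //; apply: (Fgood _ FY).1 => //; apply: XY.
  by exists X => //; apply: (Fgood _ FX).1 => //; apply: YX.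
have Aext B : good B -> (forall x, A x -> B x) -> forall x, B x -> A x.
  move=> Bgood AB x Bx; apply: contrapT => NAx; apply: (A_max B) => //.
  by split=> // BA; apply/NAx/BA.
(* The empty set is good too, so that A contains 0 has to be proved. *)
have A0 : A 0.
  have B0 : good (fun x => A x \/ x = 0).
    split=> [a x y [Ax|->] [Ay|->]|v c [/A_lam //|[iv ->]]].
    - by left; apply: A_lin.
    - by left; apply: (A_lin a) => //; rewrite -(addNr x) -scaleN1r; apply: A_lin.
    - by left; rewrite scaler0 add0r.
    - by right; rewrite scaler0 addr0.
    - by have -> : v = 0; [apply: i_inj; rewrite iv linear0 | rewrite linear0].
  by apply: (Aext _ B0) => [x Ax|]; [left | right].
have AZ a x : A x -> A (a *: x) by move=> Ax; rewrite -[_ *: _]addr0; apply: A_lin.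
have AD x y : A x -> A y -> A (x + y).
  by move=> Ax Ay; rewrite -[x]scale1r; apply: A_lin.
have AN x : A x -> A (- x) by move=> Ax; rewrite -scaleN1r; apply: AZ.
(* Enlarge A by the graph of lam. *)
have Agraph v : A (i v, lam v).
  pose B x := exists v', A (x - (i v', lam v')).
  have Bgood : good B.
    split=> [a x y [v1 A1] [v2 A2]|v' c [v1 A1]].
      exists (a *: v1 + v2).
      have := A_lin a _ _ A1 A2; congr (A _).
      have -> : (i (a *: v1 + v2), lam (a *: v1 + v2)) =
          a *: (i v1, lam v1) + (i v2, lam v2) by rewrite !linearP.
      by rewrite scalerBr opprD addrACA.
    have := A_lam (v' - v1) (c - lam v1); rewrite !linearB /=.
    by move=> /(_ A1)/eqP; rewrite subr_eq subrK => /eqP.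
  apply: (Aext _ Bgood) => [x Ax|]; last by exists v; rewrite subrr.
  exists 0; have -> : (i 0, lam 0) = 0 :> W * k^o by rewrite !linear0.
  by rewrite subr0.
(* Enlarge A by a vector outside its domain, with value 0. *)
have Adom w : exists c, A (w, c).
  apply: contrapT => Nw.
  pose B x := exists t, A (x - t *: (w, 0)).
  have Bgood : good B.
    split=> [a x y [t1 A1] [t2 A2]|v c [t]].
      exists (a * t1 + t2).
      have := A_lin a _ _ A1 A2; congr (A _).
      by rewrite scalerDl -scalerA scalerBr opprD addrACA.
    have [->|t0] := eqVneq t 0; first by rewrite scale0r subr0; apply: A_lam.
    move=> /AN/(AD _ _ (Agraph v))/(AZ t^-1) At; case: Nw.
    exists (t^-1 * (lam v - c)); move: At; congr (A _).
    apply: injective_projections => /=.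
      by rewrite opprB addrC subrK scalerA mulVf ?scale1r.
    by rewrite scaler0 subr0.
  case: Nw; exists 0; apply: (Aext _ Bgood) => [x Ax|].
    by exists 0; rewrite scale0r subr0.
  by exists 1; rewrite scale1r subrr.
have /choice[mu muP] := Adom.
have Afun w c c' : A (w, c) -> A (w, c') -> c = c'.
  move=> Ac Ac'; have := A_lam 0 (c - c'); rewrite !linear0.
  move=> H; apply/eqP; rewrite -subr_eq0; apply/eqP/H.
  by have := AD _ _ Ac (AN _ Ac'); congr (A (_, _)); rewrite subrr.
have mu_lin : linear (mu : W -> k^o).
  by move=> a x y; apply: (Afun (a *: x + y)) => //; apply: (A_lin a _ _ (muP x) (muP y)).
by exists (mklin mu_lin) => v; apply: (Afun (i v)).
Qed.

End FiniteDimension.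

(** * Finitely generated projective modules *)

Section Projective.
Variable R : pzRingType.
Implicit Types P Q U V M : lmodType R.

Lemma dual_basis P : projective_mod P -> fingen P ->
  exists (n : nat) (p : 'I_n -> P) (xi : 'I_n -> {linear P -> R^o}),
    forall x, x = \sum_i (xi i x : R) *: p i.
Proof.
move=> P_proj [n [g gP]].
have G_surj : surj_map (mklin (lincomb_linear g)).
  move=> x; have [c ->] := gP x; exists [ffun i => c i].
  by apply: eq_bigr => i _; rewrite ffunE.
have [h hP] := P_proj _ _ (mklin (lincomb_linear g)) idfun G_surj.
have lin i : linear (fun x => h x i : R^o).
  by move=> a x y; rewrite linearP !ffunE.
exists n, g, (fun i => mklin (lin i)) => x.
by rewrite -[LHS]hP.
Qed.

Lemma dual_basis_projective P n (p : 'I_n -> P) (xi : 'I_n -> {linear P -> R^o}) :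
  (forall x, x = \sum_i (xi i x : R) *: p i) -> fingen P /\ projective_mod P.
Proof.
move=> pP; split=> [|U V g f g_surj].
  by exists n, p => x; exists (fun i => xi i x).
have /choice[u uP] : forall i, exists u, g u = f (p i) by move=> i; apply: g_surj.
have lin : linear (fun x => \sum_i (xi i x : R) *: u i).
  move=> a x y; rewrite scaler_sumr -big_split; apply: eq_bigr => i _.
  by rewrite linearP scalerDl scalerA.
exists (mklin lin) => x; rewrite {2}(pP x) !linear_sum; apply: eq_bigr => i _.
by rewrite !linearZ /= uP.
Qed.

(** The lifting property of a projective module with respect to the image of g,
which need not be all of V; a dual basis avoids the passage to the image. *)
Lemma proj_lift P U V (g : {linear U -> V}) (f : {linear P -> V}) :
  projective_mod P -> fingen P -> (forall x, exists u, f x = g u) ->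
  exists h : {linear P -> U}, forall x, f x = g (h x).
Proof.
move=> P_proj P_fg fg; have [n [p [xi pP]]] := dual_basis P_proj P_fg.
have /choice[u uP] : forall i, exists u, f (p i) = g u by move=> i; apply: fg.
have lin : linear (fun x => \sum_i (xi i x : R) *: u i).
  move=> a x y; rewrite scaler_sumr -big_split; apply: eq_bigr => i _.
  by rewrite linearP scalerDl scalerA.
exists (mklin lin) => x; rewrite {1}(pP x) !linear_sum; apply: eq_bigr => i _.
by rewrite !linearZ /= uP.
Qed.

Lemma retract_projective P Q (i : {linear Q -> P}) (p : {linear P -> Q}) :
  projective_mod P -> (forall x, p (i x) = x) -> projective_mod Q.
Proof.
move=> P_proj ip U V g f g_surj.
have [h hP] := P_proj _ _ g (f \o p : {linear _ -> _}) g_surj.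
by exists (h \o i : {linear _ -> _}) => x; rewrite /= hP /= ip.
Qed.

Lemma prod_projective P Q :
  projective_mod P -> projective_mod Q -> projective_mod (P * Q)%type.
Proof.
move=> P_proj Q_proj U V g f g_surj.
have linl : linear (fun x : P => f (x, 0)).
  move=> a x y; rewrite -linearP; congr (f _).
  by apply: injective_projections; rewrite /= ?scaler0 ?addr0.
have linr : linear (fun x : Q => f (0, x)).
  move=> a x y; rewrite -linearP; congr (f _).
  by apply: injective_projections; rewrite /= ?scaler0 ?addr0.
have [h hP] := P_proj _ _ g (mklin linl) g_surj.
have [h' hP'] := Q_proj _ _ g (mklin linr) g_surj.
exists ((h \o fst) \+ (h' \o snd) : {linear _ -> _}) => -[x y].
rewrite /= linearD hP hP' /= -linearD; congr (f _).
by apply: injective_projections; rewrite /= ?addr0 ?add0r.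
Qed.

Lemma ffun_projective n P : projective_mod P -> projective_mod {ffun 'I_n -> P}.
Proof.
move=> P_proj U V g f g_surj.
pose inj i (x : P) : {ffun 'I_n -> P} := [ffun j => if j == i then x else 0].
have lin i : linear (fun x => f (inj i x)).
  move=> a x y; rewrite -linearP; congr (f _); apply/ffunP => j.
  by rewrite !ffunE; case: eqP; rewrite ?scaler0 ?addr0.
have /choice[h hP] : forall i, exists h : {linear P -> U}, forall x, g (h x) = mklin (lin
    i) x.
  by move=> i; apply: P_proj.
have linh : linear (fun z : {ffun 'I_n -> P} => \sum_i h i (z i)).
  move=> a x y; rewrite scaler_sumr -big_split; apply: eq_bigr => i _.
  by rewrite !ffunE linearP.
exists (mklin linh) => z; rewrite linear_sum.
under eq_bigr do rewrite hP.
rewrite -linear_sum; congr (f _); apply/ffunP => j; rewrite sum_ffunE.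
rewrite (bigD1 j) //= ffunE eqxx big1 ?addr0 // => i ij.
by rewrite ffunE eq_sym (negPf ij).
Qed.

Lemma zero_projective P : is_zero_mod P -> projective_mod P.
Proof.
move=> P0 U V g f _; exists (\0 : {linear P -> U}) => x.
by rewrite /= (P0 x) !linear0.
Qed.

Lemma quo_lift M U (S : M -> Prop) (HS : submodule S) (f : {linear M -> U}) :
  (forall x, S x -> f x = 0) ->
  exists g : {linear quotient_mod HS -> U}, forall x, g (quo_proj HS x) = f x.
Proof.
move=> f0.
have fE x y : quo_proj HS x = quo_proj HS y -> f x = f y.
  move=> /quo_proj_eq/f0/eqP; rewrite linearB subr_eq0 => /eqP//.
have fval x : f (val (quo_proj HS x)) = f x by apply: fE; apply: quo_projK.
have lin : linear (fun z : quotient_mod HS => f (val z)).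
  move=> a z w; rewrite -{1}(quo_projK z) -{1}(quo_projK w).
  by rewrite -[X in val X](linearP (quo_proj HS)) fval linearP.
by exists (mklin lin).
Qed.

End Projective.

Section RestrictScalars.
Variables (k : fieldType) (R : pzRingType) (e : kstruct k R).

Lemma restr_linear (M N : lmodType R) (f : {linear M -> N}) :
  linear (f : restr e M -> restr e N).
Proof. by move=> a x y; rewrite [LHS]linearP. Qed.

End RestrictScalars.

Section LinearFamilies.
Variables (R : pzRingType) (n : nat) (U V : lmodType R) (F : 'I_n -> {linear U -> V}).

Lemma lsum_linear : linear (fun x => \sum_i F i x).
Proof.
move=> a x y; rewrite scaler_sumr -big_split; apply: eq_bigr => i _.
by rewrite linearP.
Qed.
Definition lsum : {linear U -> V} := mklin lsum_linear.

Lemma ltuple_linear : linear (fun x => [ffun i => F i x]).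
Proof. by move=> a x y; apply/ffunP => i; rewrite !ffunE linearP. Qed.
Definition ltuple : {linear U -> {ffun 'I_n -> V}} := mklin ltuple_linear.

Lemma lproj_linear (i : 'I_n) : linear (fun z : {ffun 'I_n -> V} => z i).
Proof. by move=> a x y; rewrite !ffunE. Qed.
Definition lproj i : {linear {ffun 'I_n -> V} -> V} := mklin (lproj_linear i).

Lemma lcotuple_linear : linear (fun z : {ffun 'I_n -> U} => \sum_i F i (z i)).
Proof.
move=> a x y; rewrite scaler_sumr -big_split; apply: eq_bigr => i _.
by rewrite !ffunE linearP.
Qed.
Definition lcotuple : {linear {ffun 'I_n -> U} -> V} := mklin lcotuple_linear.
End LinearFamilies.

Section LPair.
Variables (R : pzRingType) (U V W : lmodType R).
Lemma lpair_linear (f : {linear U -> V}) (g : {linear U -> W}) :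
  linear (fun x => (f x, g x)).
Proof. by move=> a x y; rewrite !linearP. Qed.
Definition lpair (f : {linear U -> V}) (g : {linear U -> W}) :
  {linear U -> (V * W)%type} := mklin (lpair_linear f g).
Lemma lcopair_linear (f : {linear U -> W}) (g : {linear V -> W}) :
  linear (fun z : (U * V)%type => f z.1 + g z.2).
Proof. by move=> a x y; rewrite !linearP /= scalerDr addrACA. Qed.
Definition lcopair (f : {linear U -> W}) (g : {linear V -> W}) :
  {linear (U * V)%type -> W} := mklin (lcopair_linear f g).
End LPair.

(** * Fitting decompositions *)

Section FittingModule.
Variable R : pzRingType.
Implicit Types M U V : lmodType R.

Lemma linear_inverse U V (f : {linear U -> V}) : bijective f ->
  exists g : {linear V -> U}, cancel f g /\ cancel g f.
Proof.
move=> [g fK gK]; have lin : linear g.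
  by move=> a x y; apply: (can_inj fK); rewrite linearP /= !gK.
by exists (mklin lin).
Qed.

Lemma iter_linear M (phi : {linear M -> M}) N : linear (iter N phi).
Proof. by move=> a x y; elim: N => //= N ->; rewrite linearP. Qed.

Definition liter M (phi : {linear M -> M}) N : {linear M -> M} :=
  mklin (iter_linear phi N).

Lemma liter0 M (phi : {linear M -> M}) N : iter N phi 0 = 0.
Proof. exact: (linear0 (liter phi N)). Qed.

Definition stable_at M (phi : M -> M) (N : nat) : Prop :=
  (forall x, exists y, iter N phi x = iter (N + N) phi y) /\
  (forall x, iter (N + N) phi x = 0 -> iter N phi x = 0).

(** Here p is the projection of M onto the quotient by the kernel of phi^N, and i
identifies this quotient with the image of phi^N, normalized to a section of p. *)
Lemma fitting_split M (phi : {linear M -> M}) N : stable_at phi N ->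
  exists (I : lmodType R) (p : {linear M -> I}) (i : {linear I -> M}),
  [/\ forall z, p (i z) = z, forall x, p x = 0 <-> iter N phi x = 0,
      forall z, exists y, i z = iter N phi y &
      forall y, i (p (iter N phi y)) = iter N phi y].
Proof.
move=> [st1 st2]; pose phiN := liter phi N.
have phiNN x : iter (N + N) phi x = phiN (phiN x) by rewrite iterD.
pose S x := phiN x = 0.
have S_sub : submodule S.
  by split=> [|a x y Sx Sy]; rewrite /S ?linear0 // linearP Sx Sy scaler0 addr0.
pose p := quo_proj S_sub.
have p0 x : p x = 0 <-> iter N phi x = 0 := quo_proj0 S_sub x.
have p_surj : surj_map p by apply: quo_proj_surj.
have [|j jp] := @quo_lift _ _ _ _ S_sub phiN; first by [].
have t_bij : bijective (p \o j).
  apply: surj_inj_bij => [z|].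
    have [x <-] := p_surj z; have [y xy] := st1 x; exists (p y).
    change (p (j (p y)) = p x); rewrite jp; apply/(quo_proj_eq S_sub).
    by rewrite /S linearB -phiNN -xy; apply: subrr.
  apply: (@lin_inj0 _ _ _ (p \o j : {linear _ -> _})) => z /=.
  have [x <-] := p_surj z; rewrite jp => /p0.
  by rewrite -[iter _ _ _]/(phiN _) -phiNN => /st2 x0; apply/p0.
have [t [tK Kt]] := @linear_inverse _ _ (p \o j : {linear _ -> _}) t_bij.
have i_im z : exists y, j (t z) = iter N phi y.
  by have [y yE] := p_surj (t z); exists y; rewrite -yE jp.
exists _, p, (j \o t : {linear _ -> _}); split=> //.
move=> y; have [y' y'E] := i_im (p (iter N phi y)).
have E : phiN y' - phiN y = 0.
  rewrite -linearB; apply: st2; rewrite phiNN [X in phiN X]linearB.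
  apply/p0; rewrite linearB -[phiN y']y'E.
  by rewrite [p (j _)](Kt (p (iter N phi y))); apply: subrr.
by apply/eqP; rewrite -subr_eq0 [X in X - _]y'E; apply/eqP.
Qed.

(** M is the direct sum of the image and the kernel of phi^N, so one of them
vanishes. *)
Lemma indec_fitting M (phi : {linear M -> M}) N :
  indecomposable_mod M -> (0 < N)%N -> stable_at phi N ->
  bijective phi \/ (forall x, iter N phi x = 0).
Proof.
move=> [_ M_indec] N0 /fitting_split[I [p [i [ip p0 i_im im_i]]]].
pose S x := exists z, x = i z.
have S_sub : submodule S.
  split=> [|a x y [z ->] [w ->]]; first by exists 0; rewrite linear0.
  by exists (a *: z + w); rewrite linearP.
pose q := quo_proj S_sub.
have q_surj : surj_map q by apply: quo_proj_surj.
have [|I0|K0] := M_indec I (quotient_mod S_sub).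
- exists (lpair p q); apply: surj_inj_bij => [[a b]|].
    have [x <-] := q_surj b; exists (x + i (a - p x)).
    have q0 : q (i (a - p x)) = 0 by apply/quo_proj0; exists (a - p x).
    apply: injective_projections.
      by change (p (x + i (a - p x)) = a); rewrite linearD ip addrC subrK.
    by change (q (x + i (a - p x)) = q x); rewrite linearD q0 addr0.
  apply: lin_inj0 => x E; have px : p x = 0 := congr1 fst E.
  have qx : q x = 0 := congr1 snd E; have [z xz] := (quo_proj0 S_sub x).1 qx.
  by rewrite xz -[z]ip -xz px linear0.
- by right=> x; apply/p0; apply: I0.
left.
have i_surj x : exists z, x = i z by apply/(quo_proj0 S_sub); apply: K0.
case: N N0 p0 i_im im_i => // N _ p0 i_im im_i.
apply: surj_inj_bij => [x|].
  have [z ->] := i_surj x; have [y ->] := i_im z.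
  by exists (iter N phi y).
apply: lin_inj0 => x x0; have [z xz] := i_surj x.
have : p x = 0 by apply/p0; rewrite iterSr x0; apply: liter0.
by rewrite xz ip => ->; rewrite linear0.
Qed.

Lemma stable_bijective M (phi : {linear M -> M}) N : (0 < N)%N -> stable_at phi N ->
  (forall x, iter N phi x = 0 -> x = 0) -> bijective phi.
Proof.
case: N => // N _ [st1 _] inj0.
have phiN_inj : injective (liter phi N.+1) by apply: lin_inj0.
apply: surj_inj_bij => [x|].
  have [y xy] := st1 x; exists (iter N phi y).
  by apply: phiN_inj; rewrite [LHS]/= [RHS]xy iterD.
apply: lin_inj0 => x x0; apply: inj0; rewrite iterSr x0.
exact: liter0.
Qed.
End FittingModule.

(** * Two-term complexes *)

Section TwoTerm.
Variable R : pzRingType.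
Implicit Types X Y Z : cpx R.

Definition two_term X : Prop :=
  forall i : int, i != -1 -> i != 0 -> is_zero_mod (X i).

(** At literal indices -1 + 1 reduces to 0, which spares casts between terms. *)
Definition dm1 X : {linear X (Negz 0) -> X (Posz 0)} := cdiff X (Negz 0).

Definition two_term_map_fun X Y (f1 : {linear X (Negz 0) -> Y (Negz 0)})
    (f0 : {linear X (Posz 0) -> Y (Posz 0)}) (i : int) : {linear X i -> Y i} :=
  match i return {linear X i -> Y i} with
  | Posz 0 => f0
  | Negz 0 => f1
  | j => \0
  end.

Lemma two_term_map_chain X Y (f1 : {linear X (Negz 0) -> Y (Negz 0)})
    (f0 : {linear X (Posz 0) -> Y (Posz 0)}) : two_term X ->
  (forall x, cdiff Y 0 (f0 x) = 0) -> (forall x, f0 (dm1 X x) = dm1 Y (f1 x)) ->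
  forall i x, two_term_map_fun f1 f0 (i + 1) (cdiff X i x) = cdiff Y i (two_term_map_fun
      f1 f0 i x).
Proof.
move=> X2 H0 H1 [[|n]|[|n]] x.
- by rewrite [RHS]H0.
- by rewrite (X2 _ _ _ x) // !linear0.
- exact: H1.
- by rewrite (X2 _ _ _ x) // !linear0.
Qed.

(** The target may have a term in degree 1, hence the condition on f0. *)
Definition two_term_map X Y (f1 : {linear X (Negz 0) -> Y (Negz 0)})
    (f0 : {linear X (Posz 0) -> Y (Posz 0)}) (X2 : two_term X)
    (H0 : forall x, cdiff Y 0 (f0 x) = 0)
    (H1 : forall x, f0 (dm1 X x) = dm1 Y (f1 x)) : chmap X Y :=
  ChMap (two_term_map_chain X2 H0 H1).

Lemma two_term_d0 X : two_term X -> forall x, cdiff X (Posz 0) x = 0.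
Proof. by move=> X2 x; apply: (X2 1). Qed.

Lemma chmap_dm1 X Y (f : chmap X Y) x :
  f (Posz 0) (dm1 X x) = dm1 Y (f (Negz 0) x).
Proof. exact: (@cmapP _ _ _ f (Negz 0) x). Qed.

Lemma two_term_map_ext X Y (f g : chmap X Y) : two_term X ->
  f (Negz 0) =1 g (Negz 0) -> f (Posz 0) =1 g (Posz 0) -> f = g.
Proof.
move=> X2 E1 E0; apply: chmapP => -[[|n]|[|n]] x //;
  by rewrite (X2 _ _ _ x) // !linear0.
Qed.

Lemma nullhomotopic_two_termP X Y (f : chmap X Y) : two_term X -> two_term Y ->
  nullhomotopic f <-> exists h : {linear X (Posz 0) -> Y (Negz 0)},
    (forall x, f (Negz 0) x = h (dm1 X x)) /\ (forall x, f (Posz 0) x = dm1 Y (h x)).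
Proof.
move=> X2 Y2; split=> [[s sP]|[h [h1 h0]]].
  exists (s (Negz 0)); split=> x.
    rewrite [LHS](sP (Negz 1) x) (Y2 (Negz 1) _ _ (s (Negz 1) x)) // linear0 add0r.
    by [].
  rewrite [LHS](sP (Negz 0) x) [cdiff X _ x](two_term_d0 X2) linear0 addr0.
  by [].
pose s (i : int) : {linear X (i + 1) -> Y i} :=
  match i return {linear X (i + 1) -> Y i} with
  | Negz 0 => h | j => \0 end.
exists s => -[[|n]|[|[|n]]] x.
- by rewrite (X2 _ _ _ x) // !linear0 addr0.
- by rewrite (X2 _ _ _ x) // !linear0 addr0.
- by rewrite [LHS]h0 [cdiff X _ x](two_term_d0 X2) linear0 addr0.
- by rewrite [LHS]h1 linear0 add0r.
- by rewrite (X2 _ _ _ x) // !linear0 addr0.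
Qed.

Section Build.
Variables (U V : fgmod R) (d : {linear U -> V}).

Definition two_term_ob (i : int) : fgmod R :=
  match i with Negz 0 => U | Posz 0 => V | _ => zero_fg R end.

Definition two_term_diff (i : int) : {linear two_term_ob i -> two_term_ob (i + 1)} :=
  match i return {linear two_term_ob i -> two_term_ob (i + 1)} with
  | Negz 0 => d | j => \0 end.

Lemma two_term_diffK i x : two_term_diff (i + 1) (two_term_diff i x) = 0.
Proof. by case: i x => [[|n]|[|[|n]]] x //=; rewrite linear0. Qed.

Lemma two_term_bounded : exists n : nat, forall i : int,
  (n < `|i|)%N -> is_zero_mod (two_term_ob i).
Proof. by exists 1 => -[[|n]|[|n]] // _ x; apply/rowP => -[]. Qed.

Definition two_term_cpx : cpx R := Cpx two_term_diffK two_term_bounded.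

Lemma two_term_cpxP : two_term two_term_cpx.
Proof. by move=> [[|n]|[|n]] // _ _ x; apply/rowP => -[]. Qed.

Lemma two_term_cpx_proj : projective_mod U -> projective_mod V -> proj_cpx two_term_cpx.
Proof.
move=> Up Vp [[|n]|[|n]] //; apply: zero_projective => x; by apply/rowP => -[].
Qed.
End Build.

Lemma stalk_two_term (M : fgmod R) : two_term (stalk M).
Proof. by move=> [[|n]|[|n]] // _ _ x; apply/rowP => -[]. Qed.

Lemma shift_stalk_two_term (M : fgmod R) : two_term (shift (stalk M)).
Proof.
move=> i i1 i0 x; rewrite /= in x *.
have : (i + 1 == 0) = false by apply/negP; lia.
by move: (i + 1) x => j x E; move: x; rewrite E => x; apply/rowP => -[].
Qed.

End TwoTerm.

(** * Homotopies and quasi-isomorphisms *)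

Local Notation "g ** f" := (lcomp g f) (at level 40, left associativity).

Section LinCat.
Variables (k : fieldType) (O : Type) (C : lin_category k O).
Implicit Types x y z : O.

Lemma lcompDl x y z (g h : C y z) (f : C x y) : (g + h) ** f = g ** f + h ** f.
Proof. by have := lcomp_linl f 1 g h; rewrite !scale1r. Qed.
Lemma lcompDr x y z (g : C y z) (f h : C x y) : g ** (f + h) = g ** f + g ** h.
Proof. by have := lcomp_linr g 1 f h; rewrite !scale1r. Qed.
Lemma lcomp0l x y z (f : C x y) : (0 : C y z) ** f = 0.
Proof. by rewrite -(scale0r (0 : C y z)) lcompZl scale0r. Qed.
Lemma lcomp0r x y z (g : C y z) : g ** (0 : C x y) = 0.
Proof. by rewrite -(scale0r (0 : C x y)) lcompZr scale0r. Qed.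
Lemma lcompNl x y z (g : C y z) (f : C x y) : (- g) ** f = - (g ** f).
Proof. by rewrite -scaleN1r lcompZl scaleN1r. Qed.
Lemma lcompNr x y z (g : C y z) (f : C x y) : g ** (- f) = - (g ** f).
Proof. by rewrite -scaleN1r lcompZr scaleN1r. Qed.
Lemma lcompBl x y z (g h : C y z) (f : C x y) : (g - h) ** f = g ** f - h ** f.
Proof. by rewrite lcompDl lcompNl. Qed.
Lemma lcompBr x y z (g : C y z) (f h : C x y) : g ** (f - h) = g ** f - g ** h.
Proof. by rewrite lcompDr lcompNr. Qed.
Lemma lcomp_suml x y z n (g : 'I_n -> C y z) (f : C x y) :
  (\sum_i g i) ** f = \sum_i (g i ** f).
Proof. by apply: (big_morph (fun g => g ** f)) => [? ?|]; rewrite ?lcompDl ?lcomp0l. Qed.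
Lemma lcomp_sumr x y z n (g : C y z) (f : 'I_n -> C x y) :
  g ** (\sum_i f i) = \sum_i (g ** f i).
Proof. by apply: (big_morph (fun f => g ** f)) => [? ?|]; rewrite ?lcompDr ?lcomp0r. Qed.
End LinCat.

Section Homotopy.
Variable R : pzRingType.
Implicit Types X Y Z : cpx R.

Lemma homotopic_refl X Y (f : chmap X Y) : homotopic f f.
Proof. by exists (fun i => \0) => i x; rewrite subrr /= linear0 addr0. Qed.

Lemma homotopic_sym X Y (f g : chmap X Y) : homotopic f g -> homotopic g f.
Proof.
move=> [s sP]; exists (fun i => \- s i : {linear _ -> _}) => i x.
by rewrite -opprB sP /= linearN opprD.
Qed.

Lemma homotopic_trans X Y (f g h : chmap X Y) :
  homotopic f g -> homotopic g h -> homotopic f h.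
Proof.
move=> [s sP] [t tP]; exists (fun i => s i \+ t i : {linear _ -> _}) => i x.
by rewrite -(subrKA (g (i + 1) x)) sP tP /= linearD addrACA.
Qed.

Lemma homotopic_compl X Y Z (h : chmap Y Z) (f g : chmap X Y) :
  homotopic f g -> homotopic (chcomp h f) (chcomp h g).
Proof.
move=> [s sP]; exists (fun i => h i \o s i : {linear _ -> _}) => i x.
by rewrite /= -linearB sP linearD cmapP.
Qed.

(** For a source with two terms only two components of a homotopy can be nonzero;
the one in degree -1 matters when the target has a term in degree -2. *)
Lemma two_term_homotopy X Z (f g : chmap X Z) (h0 : {linear X (Posz 0) -> Z (Negz 0)})
    (h1 : {linear X (Negz 0) -> Z (Negz 1)}) : two_term X ->
  (forall x, f (Posz 0) x - g (Posz 0) x = cdiff Z (Negz 0) (h0 x)) ->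
  (forall x, f (Negz 0) x - g (Negz 0) x = cdiff Z (Negz 1) (h1 x) + h0 (dm1 X x)) ->
  homotopic f g.
Proof.
move=> X2 E0 E1.
pose s (i : int) : {linear X (i + 1) -> Z i} :=
  match i return {linear X (i + 1) -> Z i} with
  | Negz 0 => h0 | Negz 1 => h1 | j => \0 end.
exists s => -[[|n]|[|[|n]]] x.
- by rewrite (X2 _ _ _ x) // !linear0 addr0.
- by rewrite (X2 _ _ _ x) // !linear0 addr0.
- by rewrite [LHS]E0 [cdiff X _ x](two_term_d0 X2) linear0 addr0.
- by rewrite [LHS]E1.
- by rewrite (X2 _ _ _ x) // !linear0 addr0.
Qed.

Lemma homotopic_two_termE X Z (f g : chmap X Z) : two_term X -> homotopic f g ->
  exists (h0 : {linear X (Posz 0) -> Z (Negz 0)})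
    (h1 : {linear X (Negz 0) -> Z (Negz 1)}),
  (forall x, f (Posz 0) x - g (Posz 0) x = cdiff Z (Negz 0) (h0 x)) /\
  (forall x, f (Negz 0) x - g (Negz 0) x = cdiff Z (Negz 1) (h1 x) + h0 (dm1 X x)).
Proof.
move=> X2 [s sP]; exists (s (Negz 0)), (s (Negz 1)); split=> x.
  by rewrite [LHS](sP (Negz 0) x) [cdiff X _ x](two_term_d0 X2) linear0 addr0.
exact: (sP (Negz 1) x).
Qed.

Section QuasiIso.
Variables (Y Z : cpx R) (f : chmap Y Z).
Hypothesis f_qi : quasi_iso f.

(** This is the exactness of the mapping cone of f, in element form. *)
Lemma quasi_iso_rel (i : int) (y0 : Y (i + 1 + 1)) (w : Z (i + 1)) :
  cdiff Y (i + 1 + 1) y0 = 0 -> f (i + 1 + 1) y0 = cdiff Z (i + 1) w ->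
  exists (y : Y (i + 1)) (z : Z i),
    cdiff Y (i + 1) y = y0 /\ w = f (i + 1) y + cdiff Z i z.
Proof.
move=> dy0 fy0.
have [|x' x'P] := (f_qi (i + 1)).1 y0 dy0; first by exists w.
have [|x [z [dx xz]]] := (f_qi i).2 (f (i + 1) x' - w).
  by rewrite linearB -cmapP -x'P fy0 subrr.
exists (x' - x), (- z); split; first by rewrite linearB dx subr0.
by rewrite linearB linearN -addrA -opprD -xz opprB addrC subrK.
Qed.

(** The differential of the mapping cone of f, up to sign. *)
Definition qi_fun (i : int) (u : Y (i + 1) * Z i) : Y (i + 1 + 1) * Z (i + 1) :=
  (cdiff Y (i + 1) u.1, f (i + 1) u.1 + cdiff Z i u.2).

Lemma qi_fun_linear i : linear (@qi_fun i).
Proof.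
move=> a x y; rewrite /qi_fun /= !linearP; congr pair.
by rewrite /= scalerDr addrACA.
Qed.

Lemma quasi_iso_lift (i : int) (Q : lmodType R^c)
    (a : {linear Q -> Y (i + 1 + 1)}) (w : {linear Q -> Z (i + 1)}) :
  projective_mod Q -> fingen Q ->
  (forall q, cdiff Y (i + 1 + 1) (a q) = 0) ->
  (forall q, f (i + 1 + 1) (a q) = cdiff Z (i + 1) (w q)) ->
  exists (g : {linear Q -> Y (i + 1)}) (h : {linear Q -> Z i}), forall q,
    cdiff Y (i + 1) (g q) = a q /\ w q = f (i + 1) (g q) + cdiff Z i (h q).
Proof.
move=> Q_proj Q_fg da fa.
have lin : linear (fun q => (a q, w q)) by move=> c x y; rewrite !linearP.
have [|h hP] := @proj_lift _ Q _ _ (mklin (@qi_fun_linear i)) (mklin lin) Q_proj Q_fg.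
  move=> q; have [y [z [dy wE]]] := quasi_iso_rel (da q) (fa q).
  by exists (y, z); rewrite /= /qi_fun /= dy -wE.
exists (fst \o h : {linear _ -> _}), (snd \o h : {linear _ -> _}) => q.
by have [] := hP q.
Qed.

Variable X : cpx R.
Hypotheses (X_proj : proj_cpx X) (X2 : two_term X).

(** The lift and the homotopy are built together, first in degree 0 and then in
degree -1; at each step a cocycle of the mapping cone has to be bounded, which is
possible linearly because the source is projective. *)
Lemma lift_quasi_iso (g : chmap X Z) :
  exists g' : chmap X Y, homotopic (chcomp f g') g.
Proof.
have [||g0 [h0 gh0]] := @quasi_iso_lift (Negz 0) _ \0 (g (Posz 0)) (@X_proj (Posz 0))
    (fgmP _).
- by move=> q; rewrite linear0.
- move=> q; rewrite linear0 -[RHS](@cmapP _ _ _ g (Posz 0) q).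
  by rewrite [cdiff X _ q](two_term_d0 X2) linear0.
have [||g1 [h1 gh1]] := @quasi_iso_lift (Negz 1) _ (g0 \o dm1 X : {linear _ -> _})
    (g (Negz 0) \- (h0 \o dm1 X) : {linear _ -> _}) (@X_proj (Negz 0)) (fgmP _).
- by move=> q; rewrite [LHS](gh0 _).1.
- move=> q; rewrite linearB /= -[cdiff Z _ (g _ q)](@cmapP _ _ _ g (Negz 0) q).
  rewrite [g _ (cdiff _ _ _)](gh0 _).2.
  by rewrite [X in _ = _ - X]/= addrK.
have H0 x : cdiff Y 0 (g0 x) = 0 by rewrite [LHS](gh0 x).1.
have H1 x : g0 (dm1 X x) = dm1 Y (g1 x) by rewrite [RHS](gh1 x).1.
exists (two_term_map X2 H0 H1); apply: homotopic_sym.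
apply: (two_term_homotopy (h0 := h0) (h1 := h1)) => // x /=.
  by rewrite [g _ x](gh0 x).2 addrAC subrr add0r.
apply/eqP; rewrite subr_eq -addrA [_ + f _ _]addrC addrA -subr_eq.
by apply/eqP; rewrite [LHS](gh1 x).2 addrC.
Qed.

(** The given nullhomotopy of f (g - g') is lifted, in the same two steps, to one
of g - g'. *)
Lemma reflect_quasi_iso (g g' : chmap X Y) :
  homotopic (chcomp f g) (chcomp f g') -> homotopic g g'.
Proof.
move=> /homotopic_two_termE-/(_ X2)[s0 [s1 [sP0 sP1]]].
have dX (h : chmap X Y) q : cdiff Y (Posz 0) (h (Posz 0) q) = 0.
  rewrite -[LHS](@cmapP _ _ _ h (Posz 0) q).
  by rewrite [cdiff X _ q](two_term_d0 X2) linear0.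
have [||h0 [r0 hr0]] := @quasi_iso_lift (Negz 1) _
    (g (Posz 0) \- g' (Posz 0) : {linear _ -> _}) s0 (@X_proj (Posz 0)) (fgmP _).
- by move=> q; rewrite linearB [X in X - _]dX [X in _ - X]dX; apply: subrr.
- by move=> q; rewrite linearB [LHS]sP0.
have h0E q : dm1 Y (h0 q) = g (Posz 0) q - g' (Posz 0) q := (hr0 q).1.
have s0E q : s0 q = f (Negz 0) (h0 q) + cdiff Z (Negz 1) (r0 q) := (hr0 q).2.
have [||h1 [r1 hr1]] := @quasi_iso_lift (Negz 2) _
    ((g (Negz 0) \- g' (Negz 0)) \- (h0 \o dm1 X) : {linear _ -> _})
    (s1 \+ (r0 \o dm1 X) : {linear _ -> _}) (@X_proj (Negz 0)) (fgmP _).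
- move=> q; change (dm1 Y ((g (Negz 0) q - g' (Negz 0) q) - h0 (dm1 X q)) = 0).
  by rewrite !linearB -!chmap_dm1 h0E; apply: subrr.
- move=> q; change (f (Negz 0) ((g (Negz 0) q - g' (Negz 0) q) - h0 (dm1 X q)) =
    cdiff Z (Negz 1) (s1 q + r0 (dm1 X q))).
  rewrite !linearB linearD [X in X - _]sP1 s0E -addrA; congr (_ + _).
  by rewrite addrC addrA addNr add0r.
apply: (two_term_homotopy (h0 := h0) (h1 := h1)) => // x.
by have [-> _] := hr1 x; rewrite /= subrK.
Qed.
End QuasiIso.

Section ContractibleCone.
Variable X : cpx R.

(** (x, y) |-> (y, 0) is a contraction of the cone of an identity. *)
Lemma cone_id_acyclic : quasi_iso (ChMap (X := cone (chid X)) (Y := cone (chid X))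
  (cmap := fun i => \0) (fun i x => esym (linear0 _))).
Proof.
have exact i (u : cone (chid X) (i + 1)) :
    cdiff (cone (chid X)) (i + 1) u = 0 -> exists v, u = cdiff (cone (chid X)) i v.
  case: u => x y /= [_ /= /eqP]; rewrite addr_eq0 => /eqP xE.
  exists (y, 0); rewrite /= /cone_diff_fun /= linear0 addr0.
  by rewrite xE.
split=> [x dx _|y dy]; first exact: exact.
have [y' yE] := exact i y dy; exists 0, y'.
by rewrite linear0 /= add0r.
Qed.

Lemma cone_incl_chain i y :
  ((0, cdiff X i y) : cone (chid X) (i + 1)) = cdiff (cone (chid X)) i (0, y).
Proof. by rewrite /= /cone_diff_fun /= !linear0 add0r. Qed.

Lemma cone_incl_linear i : linear (fun y : X i => (0, y) : cone (chid X) i).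
Proof. by move=> a x y; apply: injective_projections; rewrite /= ?scaler0 ?addr0. Qed.

Definition cone_incl : chmap X (cone (chid X)).
Proof.
by exists (fun i => mklin (@cone_incl_linear i)) => i x; apply: cone_incl_chain.
Defined.

(** A nullhomotopy s of f is the same as the extension (x, y) |-> s x + f y of f to
the cone of the identity. *)
Lemma nullhomotopic_factor Y (f : chmap X Y) : nullhomotopic f ->
  exists g : chmap (cone (chid X)) Y, f = chcomp g cone_incl.
Proof.
move=> [s sP].
have lin i : linear (fun z : cone (chid X) i => s i z.1 + f i z.2).
  by move=> a x y; rewrite !linearP /= scalerDr addrACA.
have chain i z : mklin (lin (i + 1)) (cdiff (cone (chid X)) i z) =
    cdiff Y i (mklin (lin i) z).
  rewrite /= linearN !linearD cmapP sP /=.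
  by rewrite [X in _ + (X + _)]addrC addrA addKr.
exists (ChMap chain); apply: chmapP => i x.
by rewrite /= linear0 add0r.
Qed.
End ContractibleCone.
End Homotopy.

(** * Morphisms in the derived category *)

Section Derived.
Variables (k : fieldType) (A : falgType k) (D : derived_category A).
Implicit Types X Y Z : cpx A.

Local Notation loc := (dloc D).

Lemma dloc_comp X Y Z (g : chmap Y Z) (f : chmap X Y) :
  loc (chcomp g f) = loc g ** loc f.
Proof. exact: ((dloc_functor D).2 X Y Z g f). Qed.

Lemma dloc_id X : loc (chid X) = lid D X.
Proof. exact: ((dloc_functor D).1 X). Qed.

Section Combination.
Variables (X Y : cpx A) (c : k) (f g : chmap X Y).

Lemma kcentral (M : lmodType A^c) (a : A^c) (x : M) :
  (kfalg A c : A^c) *: (a *: x) = a *: ((kfalg A c : A^c) *: x).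
Proof. by rewrite !scalerA; congr (_ *: _); rewrite [RHS](kinjC (kfalg A) c a). Qed.

Lemma chlin_linear i :
  linear (fun x : X i => (kfalg A c : A^c) *: f i x + g i x).
Proof.
move=> a x y; rewrite !linearP scalerDr kcentral.
by rewrite [in RHS]scalerDr addrACA.
Qed.

Lemma chlin_chain i x :
  mklin (@chlin_linear (i + 1)) (cdiff X i x) = cdiff Y i (mklin (@chlin_linear i) x).
Proof. by rewrite /= !cmapP linearD linearZ. Qed.

(** The chain map c f + g; c acts through the center of A. *)
Definition chlin : chmap X Y := ChMap chlin_chain.

Lemma dloc_lin : loc chlin = c *: loc f + loc g.
Proof. exact: dloc_linear. Qed.
End Combination.

Definition chzero X Y : chmap X Y :=
  ChMap (X := X) (Y := Y) (cmap := fun i => \0) (fun i x => esym (linear0 _)).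

Lemma dloc0 X Y : loc (chzero X Y) = 0.
Proof.
have /eqP := @dloc_linear _ _ D X Y 1 (chzero X Y) (chzero X Y) (chzero X Y)
  (fun i x => esym (etrans (addr0 _) (scaler0 _ _))).
by rewrite scale1r -subr_eq0 opprD addNKr oppr_eq0 => /eqP.
Qed.

Lemma dlocD X Y (f g : chmap X Y) : loc f + loc g = loc (chlin 1 f g).
Proof. by rewrite dloc_lin scale1r. Qed.

Lemma kact1 (M : lmodType A^c) (x : M) : (kfalg A 1 : A^c) *: x = x.
Proof. by rewrite [kfalg A 1]rmorph1 scale1r. Qed.
Lemma kactN1 (M : lmodType A^c) (x : M) : (kfalg A (-1) : A^c) *: x = - x.
Proof. by rewrite [kfalg A (-1)]rmorphN1 -[RHS]scaleN1r. Qed.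

Lemma chlin1E X Y (f g : chmap X Y) i x : chlin 1 f g i x = f i x + g i x.
Proof. by rewrite [LHS]/= kact1. Qed.

Definition chsub X Y (f g : chmap X Y) := chlin (-1) g f.
Lemma chsubE X Y (f g : chmap X Y) i x : chsub f g i x = f i x - g i x.
Proof. by rewrite [LHS]/= kactN1 addrC. Qed.
Lemma dlocB X Y (f g : chmap X Y) : loc f - loc g = loc (chsub f g).
Proof. by rewrite dloc_lin scaleN1r addrC. Qed.

Definition chsum X Y n (F : 'I_n -> chmap X Y) : chmap X Y :=
  foldr (fun i g => chlin 1 (F i) g) (chzero X Y) (enum 'I_n).
Lemma chsumE X Y n (F : 'I_n -> chmap X Y) i x : chsum F i x = \sum_j F j i x.
Proof.
rewrite /chsum -big_enum /=; elim: (enum 'I_n) => [|j s IH]; first by rewrite big_nil.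
by rewrite big_cons chlin1E IH.
Qed.
Lemma dloc_sum X Y n (F : 'I_n -> chmap X Y) : \sum_j loc (F j) = loc (chsum F).
Proof.
rewrite /chsum -big_enum /=; elim: (enum 'I_n) => [|j s IH]; first by rewrite big_nil dloc0.
by rewrite big_cons IH dlocD.
Qed.

(** The map factors through an acyclic complex, whose identity the localization
identifies with 0. *)
Lemma dloc_nullhomotopic X Y (f : chmap X Y) : nullhomotopic f -> loc f = 0.
Proof.
move=> /nullhomotopic_factor[g ->].
have [u [/= uL _]] := dloc_quasi_iso D (@cone_id_acyclic _ X).
have z0 : loc (chzero (cone (chid X)) (cone (chid X))) = 0 by apply: dloc0.
have id0 : lid D (cone (chid X)) = 0 by rewrite -[LHS]uL z0 lcomp0r.
by rewrite dloc_comp -(lcomp1l (loc (cone_incl X))) id0 lcomp0l lcomp0r.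
Qed.

Lemma homotopicB X Y (f g : chmap X Y) : homotopic f g <-> nullhomotopic (chsub f g).
Proof. by split=> -[s sP]; exists s => i x; rewrite -sP -chsubE. Qed.

Lemma dloc_homotopic X Y (f g : chmap X Y) : homotopic f g -> loc f = loc g.
Proof.
by move=> /homotopicB/dloc_nullhomotopic/eqP; rewrite -dlocB subr_eq0 => /eqP.
Qed.

Section Full.
Variable X : cpx A.
Hypotheses (X_proj : proj_cpx X) (X2 : two_term X).

Let fromX Y (u : D X Y) : Prop := exists f : chmap X Y, u = loc f.

Let preserving Y Z := {phi : D X Y -> D X Z | forall u, fromX u -> fromX (phi u)}.

(** Maps between the sets Hom(X, Y) of the derived category that preserve the
subsets of morphisms represented by a chain map. *)
Let preserving_cat : category (cpx A).
Proof.
unshelve eexists (fun Y Z => preserving Y Z) (fun Y => exist _ id _)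
  (fun Y Z T g f => exist _ (sval g \o sval f) _).
- by [].
- by move=> u fu; apply: (svalP g); apply: (svalP f).
- by move=> Y Z [f fP]; apply: eq_exist.
- by move=> Y Z [f fP]; apply: eq_exist.
- by move=> Y Z T W f g h; apply: eq_exist.
Defined.

Let postcomp_cat : category (cpx A).
Proof.
by unshelve eexists (fun Y Z => D X Y -> D X Z) (fun Y => id) (fun Y Z T g f => g \o f).
Defined.

(** Sending a chain map to its postcomposition inverts quasi-isomorphisms, with
values in [preserving_cat] by [lift_quasi_iso].  By universality it extends to
the derived category, and uniqueness of extensions shows that an arbitrary
morphism u still acts by postcomposition.  So u preserves the represented
morphisms, and u itself is the image of the identity. *)
Lemma dloc_full Y (u : D X Y) : exists f : chmap X Y, u = loc f.
Proof.
have pres Y' Z (f : chmap Y' Z) v : fromX v -> fromX (loc f ** v).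
  by move=> [g ->]; exists (chcomp f g); rewrite dloc_comp.
pose F Y Z (f : chmap Y Z) : preserving_cat Y Z := exist _ (fun v => loc f ** v) (@pres Y
    Z f).
have FF : is_functor (C := cpx_category A) (C' := preserving_cat) F.
  split=> [Z|Z T W g f]; apply: eq_exist; apply: funext => v /=.
    by rewrite dloc_id lcomp1l.
  by rewrite dloc_comp lcompA.
have Fq Y' Z (f : chmap Y' Z) : quasi_iso f -> is_iso (C := preserving_cat) (F Y' Z f).
  move=> fq; have [g [/= gf fg]] := dloc_quasi_iso D fq.
  have gpres v : fromX v -> fromX (g ** v).
    move=> [h ->]; have [h' hP] := lift_quasi_iso fq X_proj X2 h.
    exists h'; rewrite -(dloc_homotopic hP) dloc_comp lcompA.
    by rewrite [g ** _]gf lcomp1l.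
  exists (exist _ (fun v => g ** v) gpres); split; apply: eq_exist; apply: funext => v /=.
    by rewrite lcompA [g ** _]gf lcomp1l.
  by rewrite lcompA [_ ** g]fg lcomp1l.
have [G [GF GP _]] := dloc_universal D FF Fq.
pose F' Y Z (f : chmap Y Z) : postcomp_cat Y Z := fun v => loc f ** v.
have FF' : is_functor (C := cpx_category A) (C' := postcomp_cat) F'.
  split=> [Z|Z T W g f]; apply: funext => v; first by rewrite /F' dloc_id lcomp1l.
  by rewrite /F' /= dloc_comp lcompA.
have Fq' Y' Z (f : chmap Y' Z) : quasi_iso f -> is_iso (C := postcomp_cat) (F' Y' Z f).
  move=> fq; have [g [/= gf fg]] := dloc_quasi_iso D fq.
  exists (fun v => g ** v); split; apply: funext => v /=; rewrite /F' lcompA.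
    by rewrite [g ** _]gf lcomp1l.
  by rewrite [_ ** g]fg lcomp1l.
have [G' [_ _ Guniq]] := dloc_universal D FF' Fq'.
have E1 := Guniq (fun Y Z v => sval (G Y Z v)).
have E2 := Guniq (fun Y Z v => (fun w => v ** w)).
have GE : sval (G X Y u) = (fun w => u ** w).
  rewrite E1 ?E2 //.
  - by split=> [Z|Z T W g f]; apply: funext => v /=; rewrite ?lcomp1l ?lcompA.
  - split=> [Z|Z T W g f]; first by rewrite GF.1.
    by rewrite GF.2.
  - by move=> Y' Z f; rewrite GP.
have : fromX (sval (G X Y u) (lid D X)).
  by apply: (svalP (G X Y u)); exists (chid X); rewrite dloc_id.
by rewrite GE lcomp1r.
Qed.

Let inv Y (p : chmap X Y -> Prop) := forall f g, homotopic f g -> p f -> p g.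

(** Contravariant maps between the homotopy-invariant predicates on chain maps out
of X; predicates spare the construction of homotopy classes. *)
Let invariant_cat : category (cpx A).
Proof.
by unshelve eexists (fun Y Z => {p | @inv Z p} -> {p | @inv Y p}) (fun Y => id)
  (fun Y Z T g f => f \o g).
Defined.

(** Pulling back homotopy-invariant predicates along a quasi-isomorphism is
bijective, so this operation only depends on the morphism of the derived
category.  The predicate of being homotopic to f then separates f from the maps
that are not homotopic to it. *)
Lemma dloc_faithful Y (f g : chmap X Y) : loc f = loc g -> homotopic f g.
Proof.
have invF Y' Z (h : chmap Y' Z) (p : {p | @inv Z p}) :
    inv (fun f : chmap X Y' => sval p (chcomp h f)).
  by move=> f1 f2 f12; apply: (svalP p); apply: homotopic_compl.
pose F Y Z (h : chmap Y Z) : invariant_cat Y Z := fun p => exist _ _ (@invF Y Z h p).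
have FF : is_functor (C := cpx_category A) (C' := invariant_cat) F.
  split=> [Z|Z T W h1 h2]; apply: funext => -[p pinv]; apply: eq_exist => /=;
  apply: funext => h /=; by congr (p _); apply: chmapP.
have Fq Y' Z (h : chmap Y' Z) : quasi_iso h -> is_iso (C := invariant_cat) (F Y' Z h).
  move=> hq.
  have invG (q : {q | @inv Y' q}) : inv (fun f : chmap X Z =>
      exists2 f', homotopic (chcomp h f') f & sval q f').
    move=> f1 f2 f12 [f' ff' qf']; exists f' => //.
    exact: homotopic_trans ff' f12.
  exists (fun q => exist _ _ (invG q)); split; apply: funext => -[p pinv];
    apply: eq_exist; apply: funext => f1 /=; apply: propext; split.
  - by move=> [f' /(reflect_quasi_iso hq X_proj X2) ff']; apply: pinv.
  - by move=> pf1; exists f1 => //; apply: homotopic_refl.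
  - by move=> [f' ff' /=]; apply: pinv.
  - move=> pf1; have [f' ff'] := lift_quasi_iso hq X_proj X2 f1.
    by exists f' => //=; apply: pinv pf1; apply: homotopic_sym.
have [G [_ GP _]] := dloc_universal D FF Fq.
move=> E; have FE : F X Y f = F X Y g by rewrite -!GP E.
have pinv : @inv Y (homotopic f).
  by move=> h1 h2 h12 fh1; apply: homotopic_trans fh1 h12.
pose p : {p | @inv Y p} := exist _ _ pinv.
have /(congr1 sval)/= := congr1 (fun H => H p) FE.
move=> /(congr1 (fun H => H (chid X)))/= H.
have cidE (h : chmap X Y) : chcomp h (chid X) = h by apply: chmapP.
by rewrite !cidE in H; rewrite -H; apply: homotopic_refl.
Qed.

Lemma dloc_eq0 Y (f : chmap X Y) : loc f = 0 <-> nullhomotopic f.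
Proof.
split=> [f0|]; last exact: dloc_nullhomotopic.
have [s sP] : homotopic f (chzero X Y) by apply: dloc_faithful; rewrite dloc0.
by exists s => i x; rewrite -sP subr0.
Qed.

End Full.

(** Products of generators with a basis of A. *)
Lemma fingen_restr (M : lmodType A^c) :
  fingen M -> fingen (restr (kconv (kfalg A)) M).
Proof.
move=> [n [g gP]].
pose e := vbasis {: A}%VS.
exists #|{: 'I_n * 'I_(\dim {: A}%VS)}|, 
  (fun l => let p : 'I_n * 'I_(\dim {: A}%VS) := enum_val l in (e`_(p.2) : A^c) *: g p.1).
move=> x; have [c ->] := gP x.
exists (fun l => let p : 'I_n * 'I_(\dim {: A}%VS) := enum_val l in coord e p.2 (c p.1)).
rewrite (reindex (@enum_rank {: 'I_n * 'I_(\dim {: A}%VS)})) /=; last first.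
  by exists enum_val => y _; rewrite ?enum_rankK ?enum_valK.
under [RHS]eq_bigr do rewrite enum_rankK.
rewrite -(pair_bigA _ (fun i l => coord e l (c i) *:
  ((e`_l : A^c) *: g i : restr (kconv (kfalg A)) M))) /=.
apply: eq_bigr => i _.
rewrite {1}(coord_vbasis (memvf (c i : A))) -/e.
rewrite (@scaler_suml A^c M (g i)).
apply: eq_bigr => l _.
transitivity ((kinjc (kfalg A) (coord e l (c i)) : A^c) *: ((e`_l : A^c) *: g i)); last
    by [].
rewrite scalerA.
have -> // : (kinjc (kfalg A) (coord e l (c i)) : A^c) * (e`_l : A^c) =
  (coord e l (c i) *: (e`_l : A)) :> A^c.
by rewrite -[LHS]/((e`_l : A) * (coord e l (c i))%:A) mulr_algr.
Qed.

(** A chain map is determined by its values on generators of the two terms of X, so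
the morphisms form a subquotient of a finite-dimensional space of values. *)
Lemma fingen_hom X Y : proj_cpx X -> two_term X -> fingen (D X Y).
Proof.
move=> X_proj X2.
have [n1 [g1 gP1]] := fgmP (X (Negz 0)); have [n0 [g0 gP0]] := fgmP (X (Posz 0)).
pose V1 : lmodType k := restr (kconv (kfalg A)) (Y (Negz 0)).
pose V0 : lmodType k := restr (kconv (kfalg A)) (Y (Posz 0)).
pose V : lmodType k := ({ffun 'I_n1 -> V1} * {ffun 'I_n0 -> V0})%type.
pose r (v : V) (w : D X Y) := exists f : chmap X Y,
  [/\ loc f = w, forall i, v.1 i = f (Negz 0) (g1 i) & forall i, v.2 i = f (Posz 0) (g0 i)].
apply: (@fingen_subquotient k V (D X Y) r).
- by apply: fingen_prod; apply: fingen_ffun; apply: fingen_restr; apply: fgmP.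
- move=> a v w v' w' [f [<- f1 f0]] [f' [<- f1' f0']].
  exists (chlin a f f'); split=> [|i|i]; first by rewrite dloc_lin.
    by rewrite !ffunE f1 f1'.
  by rewrite !ffunE f0 f0'.
- move=> w [f [<- f1 f0]]; rewrite -(dloc0 X Y); congr (loc _).
  apply: two_term_map_ext => // x.
    have [c ->] := gP1 x; rewrite !linear_sum; apply: eq_bigr => i _.
    by rewrite !linearZ /= -f1 ffunE.
  have [c ->] := gP0 x; rewrite !linear_sum; apply: eq_bigr => i _.
  by rewrite !linearZ /= -f0 ffunE.
move=> w; have [f ->] := dloc_full X_proj X2 w.
by exists ([ffun i => f (Negz 0) (g1 i)], [ffun i => f (Posz 0) (g0 i)]); exists f;
  split=> // i; rewrite ffunE.
Qed.

End Derived.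

(** * Consequences of generation *)

Section Generation.
Variables (R : pzRingType) (N : lmodType R^c).
Implicit Types X Y : cpx R.

(** Exactness, at X^(i+1), of the complex of maps from X to the module N. *)
Definition hom_exact_at X (i : int) : Prop :=
  forall phi : {linear X (i + 1) -> N}, (forall x : X i, phi (cdiff X i x) = 0) ->
  exists h : {linear X (i + 1 + 1) -> N}, forall x, phi x = h (cdiff X (i + 1) x).

Definition hom_exact X : Prop := proj_cpx X /\ forall i, hom_exact_at X i.

Lemma hom_exact_iso X Y : proj_cpx Y -> homotopy_equiv X Y ->
  hom_exact X -> hom_exact Y.
Proof.
move=> Y_proj [f [g [_ [s sP]]]] [X_proj HX]; split=> // i phi phi0.
have [|h hP] := HX i (phi \o f (i + 1) : {linear _ -> _}).
  by move=> x; rewrite /= cmapP phi0.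
exists ((h \o g (i + 1 + 1)) \- (phi \o s (i + 1)) : {linear _ -> _}) => y.
rewrite /= cmapP -hP /=.
have := sP i y; rewrite /= => /(congr1 phi).
rewrite linearB linearD phi0 add0r => <-.
by rewrite opprB [RHS]addrC subrK.
Qed.

Lemma hom_exact_at_succ X : (forall i, hom_exact_at X (i + 1)) -> forall i, hom_exact_at
    X i.
Proof. by move=> HX i; rewrite -[i](subrK 1). Qed.

Lemma hom_exact_shift X : hom_exact (shift X) <-> hom_exact X.
Proof.
have shiftE i : hom_exact_at (shift X) i <-> hom_exact_at X (i + 1).
  split=> HX phi phi0.
    have [|h hP] := HX phi; first by move=> x; rewrite /= linearN phi0 oppr0.
    exists (\- h : {linear _ -> _}) => x; rewrite hP /= linearN //.
  have [|h hP] := HX phi.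
    by move=> x; apply: oppr_inj; rewrite -linearN oppr0; apply: phi0.
  by exists (\- h : {linear _ -> _}) => x; rewrite hP /= linearN opprK.
split=> -[X_proj HX]; split.
- move=> i; rewrite -[i](subrK 1); exact: X_proj.
- by apply: hom_exact_at_succ => i; apply/shiftE.
- by move=> i; apply: X_proj.
- by move=> i; apply/shiftE.
Qed.

(** Extend along Y first, correct the restriction to X by f, then extend along X. *)
Lemma hom_exact_cone X Y (f : chmap X Y) :
  hom_exact X -> hom_exact Y -> hom_exact (cone f).
Proof.
move=> [X_proj HX] [Y_proj HY]; split=> [i|i phi phi0].
  exact: prod_projective.
have lin1 : linear (fun x : X (i + 1 + 1) => phi (x, 0)).
  move=> a x y; rewrite -linearP; congr (phi _).
  by apply: injective_projections; rewrite /= ?scaler0 ?addr0.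
have lin2 : linear (fun y : Y (i + 1) => phi (0, y)).
  move=> a x y; rewrite -linearP; congr (phi _).
  by apply: injective_projections; rewrite /= ?scaler0 ?addr0.
have phiE x y : phi (x, y) = phi (x, 0) + phi (0, y).
  by rewrite -linearD; congr (phi _); apply: injective_projections;
    rewrite /= ?addr0 ?add0r.
have [|h2 h2P] := HY i (mklin lin2).
  move=> y; rewrite -(phi0 (0, y)) /= /cone_diff_fun /=.
  by rewrite !linear0 add0r.
have [|h1 h1P] := HX (i + 1) (mklin lin1 \- (h2 \o f (i + 1 + 1)) : {linear _ -> _}).
  move=> x; rewrite /= cmapP -h2P /=.
  have := phi0 (x, 0); rewrite /= /cone_diff_fun /= linear0 addr0 phiE.
  rewrite -[phi (- _, 0)]/(mklin lin1 _) linearN => /eqP.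
  by rewrite [X in X == 0]addrC subr_eq0 => /eqP->; apply: subrr.
exists (\- (h1 \o fst) \+ (h2 \o snd) : {linear _ -> _}) => -[x y].
rewrite /= /cone_diff_fun /= phiE linearN opprK linearD.
by rewrite addrA -h1P /= subrK -h2P.
Qed.

Lemma hom_exact_summand X Y : proj_cpx X -> hom_exact (sum_cpx X Y) -> hom_exact X.
Proof.
move=> X_proj [_ H]; split=> // i phi phi0.
have [|h hP] := H i (phi \o fst : {linear _ -> _}); first by move=> x; apply: phi0.
have lin : linear (fun x : X (i + 1 + 1) => h (x, 0)).
  move=> a x y; rewrite -linearP; congr (h _).
  by apply: injective_projections; rewrite /= ?scaler0 ?addr0.
exists (mklin lin) => x; have := hP (x, 0).
by rewrite /= /sum_diff_fun /= linear0.
Qed.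

Lemma hom_exact_thick : thick_subcat hom_exact.
Proof.
split.
- by move=> X [].
- split=> [i|i phi _].
    by rewrite /=; apply: zero_projective; case: ifP => _ x; apply/rowP => -[].
  exists (\0 : {linear _ -> _}) => x; have -> : x = 0; last by rewrite !linear0.
  by move: x; rewrite /=; case: ifP => _ x; apply/rowP => -[].
- exact: hom_exact_iso.
- exact: hom_exact_shift.
- exact: hom_exact_cone.
- by move=> X Y X_proj _; apply: hom_exact_summand.
Qed.
End Generation.

Section RegularModule.
Variable R : pzRingType.
Lemma fingen_regular : fingen (R^c)^o.
Proof.
exists 1%N, (fun=> 1) => x; exists (fun=> x).
by rewrite big_ord1; rewrite [RHS]mulr1.
Qed.
Definition regular : fgmod R := FgMod fingen_regular.

Lemma regular_proj : projective_mod regular.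
Proof.
move=> U V g f g_surj; have [u uP] := g_surj (f (1 : R^c)).
have lin : linear (fun a : (R^c)^o => (a : R^c) *: u).
  by move=> a x y; rewrite scalerDl scalerA.
exists (mklin lin) => x; rewrite /= linearZ uP -linearZ; congr (f _).
exact: (mulr1 (x : R^c)).
Qed.
End RegularModule.

(** The complexes of projectives X for which Hom(X, N[i]) = 0 for all i form a
thick subcategory.  It contains P by hypothesis, hence also A, and Hom(A, N) is N. *)
Lemma generator_faithful (R : pzRingType) (P : cpx R) (N : lmodType R^c) :
  two_term_silting P ->
  (forall phi : {linear P (Negz 0) -> N},
     exists h : {linear P (Posz 0) -> N}, forall x, phi x = h (dm1 P x)) ->
  (forall psi : {linear P (Posz 0) -> N}, (forall x, psi (dm1 P x) = 0) ->
     forall x, psi x = 0) ->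
  is_zero_mod N.
Proof.
move=> [P_proj P2 _ P_gen] H1 H0 z.
have TP : hom_exact N P.
  split=> // -[[|n]|[|[|n]]] phi phi0.
  - exists (\0 : {linear _ -> _}) => x.
    by rewrite (P2 _ _ _ x) // !linear0.
  - exists (\0 : {linear _ -> _}) => x.
    by rewrite (P2 _ _ _ x) // !linear0.
  - by exists (\0 : {linear _ -> _}) => x; apply: (H0 phi).
  - exact: (H1 phi).
  - exists (\0 : {linear _ -> _}) => x.
    by rewrite (P2 _ _ _ x) // !linear0.
have AP : proj_cpx (stalk (regular R)).
  move=> i; rewrite /=; case: ifP => _; first exact: regular_proj.
  by apply: zero_projective => x; apply/rowP => -[].
have [_ /(_ (Negz 0)) HA] := P_gen _ (hom_exact_thick N) TP _ AP.
have lin : linear (fun a : (R^c)^o => (a : R^c) *: z).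
  by move=> a x y; rewrite scalerDl scalerA.
have [|h hP] := HA (mklin lin).
  by move=> x; rewrite linear0.
by have := hP (1 : R^c); rewrite linear0 /= scale1r.
Qed.

(** * Maximality of silting complexes *)

Section Ext.
Variables (R : pzRingType).
(** Hom(X, Y[1]) = 0 in the homotopy category, for complexes with two terms. *)
Definition ext_vanish (X Y : cpx R) : Prop :=
  forall a : {linear X (Negz 0) -> Y (Posz 0)},
  exists (c : {linear X (Posz 0) -> Y (Posz 0)}) (b : {linear X (Negz 0) -> Y (Negz 0)}),
  forall x, a x = c (dm1 X x) + dm1 Y (b x).

Definition two_term_proj (X : cpx R) : Prop := proj_cpx X /\ two_term X.

Lemma silting_two_term_proj (P : cpx R) : two_term_silting P -> two_term_proj P.
Proof. by move=> [P_proj P2 _ _]. Qed.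

Lemma silting_ext_vanish (P : cpx R) : two_term_silting P -> ext_vanish P P.
Proof.
move=> [P_proj P2 P_rigid _] a.
have H0 x : cdiff (shift P) 0 ((\0 : {linear P (Posz 0) -> P (Posz 1)}) x) = 0.
  by rewrite linear0.
have H1 x : (\0 : {linear P (Posz 0) -> P (Posz 1)}) (dm1 P x) = dm1 (shift P) (a x).
  by rewrite (P2 (Posz 1) _ _ (dm1 (shift P) _)).
have [s sP] := P_rigid (two_term_map P2 H0 H1).
exists (s (Negz 0)), (\- s (Negz 1) : {linear _ -> _}) => x.
rewrite [LHS](sP (Negz 1) x) [RHS]addrC; congr (_ + _).
by rewrite [RHS]linearN.
Qed.
End Ext.

Section Silting.
Variables (k : fieldType) (A : falgType k) (D : derived_category A).
Implicit Types X Y Z C : cpx A.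

Lemma dloc_eq_two_termP X Y (f g : chmap X Y) : two_term_proj X -> two_term Y ->
  dloc D f = dloc D g <->
  exists h : {linear X (Posz 0) -> Y (Negz 0)},
    (forall x, f (Negz 0) x - g (Negz 0) x = h (dm1 X x)) /\
    (forall x, f (Posz 0) x - g (Posz 0) x = dm1 Y (h x)).
Proof.
move=> [X_proj X2] Y2; split=> [E|[h [h1 h0]]].
  have /nullhomotopic_two_termP-/(_ X2 Y2)[h [h1 h0]] : nullhomotopic (chsub f g).
    by apply/(dloc_eq0 D) => //; rewrite -dlocB E subrr.
  by exists h; split=> x; rewrite -?h1 -?h0 chsubE.
apply/eqP; rewrite -subr_eq0 dlocB; apply/eqP/dloc_nullhomotopic.
by apply/nullhomotopic_two_termP => //; exists h; split=> x; rewrite chsubE.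
Qed.

Variable P : cpx A.
Hypothesis P_silting : two_term_silting P.
Let P_tt : two_term_proj P := silting_two_term_proj P_silting.
Let P2 : two_term P := P_tt.2.
Let P_proj : proj_cpx P := P_tt.1.

(** The morphisms g i generate Hom(P, Y) as a module over End(P), in terms of
chain maps and homotopies. *)
Definition generates Y n (g : 'I_n -> chmap P Y) : Prop :=
  forall u : chmap P Y, exists (w : 'I_n -> chmap P P)
    (h : {linear P (Posz 0) -> Y (Negz 0)}),
    (forall x, u (Negz 0) x - \sum_i g i (Negz 0) (w i (Negz 0) x) = h (dm1 P x)) /\
    (forall x, u (Posz 0) x - \sum_i g i (Posz 0) (w i (Posz 0) x) = dm1 Y (h x)).

Lemma generators_exist Y : two_term Y -> exists n (g : 'I_n -> chmap P Y), generates g.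
Proof.
move=> Y2; have [n [g0 gP]] := fingen_hom D Y P_proj P2.
have /choice[g gE] : forall i, exists f, g0 i = dloc D f.
  by move=> i; apply: dloc_full.
exists n, g => u; have [c cP] := gP (dloc D u).
pose w i := chlin (c i) (chid P) (chzero P P).
have E : dloc D u = dloc D (chsum (fun i => chcomp (g i) (w i))).
  rewrite cP -dloc_sum; apply: eq_bigr => i _.
  by rewrite dloc_comp dloc_lin dloc0 addr0 lcompZr dloc_id lcomp1r gE.
have /(dloc_eq_two_termP _ _ P_tt Y2)[h [h1 h0]] := E.
by exists w, h; split=> x; rewrite -?h1 -?h0 chsumE.
Qed.

(** Let N be the cokernel.  Hom(P, N[1]) is a quotient of Hom(P, Y[1]) = 0.  A map
P -> N lifts, modulo the image of the generators, to a chain map P -> Y because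
Hom(P, P[1]) = 0; such a lift is a combination of generators, so the map is 0.
Hence N = 0 by [generator_faithful]. *)
Lemma generates_surj Y n (g : 'I_n -> chmap P Y) : two_term Y -> ext_vanish P Y ->
  generates g ->
  forall y : Y (Posz 0), exists u : {ffun 'I_n -> P (Posz 0)} * Y (Negz 0),
    y = lcopair (lcotuple (fun i => g i (Posz 0))) (dm1 Y) u.
Proof.
move=> Y2 extPY g_gen.
pose G := lcopair (lcotuple (fun i => g i (Posz 0))) (dm1 Y).
pose S y := exists u, y = G u.
have S_sub : submodule S.
  split=> [|a x y [u ->] [v ->]]; first by exists 0; rewrite linear0.
  by exists (a *: u + v); rewrite linearP.
pose q := quo_proj S_sub.
suff N0 : is_zero_mod (quotient_mod S_sub) by move=> y; apply/(quo_proj0 S_sub).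
apply: (generator_faithful P_silting) => [phi|psi psi0].
  have [phi' phiP] := @P_proj _ _ _ q phi (@quo_proj_surj _ _ _ S_sub).
  have [c [b cb]] := extPY phi'.
  exists (q \o c : {linear _ -> _}) => x.
  rewrite -phiP cb linearD /= [X in _ + X](_ : _ = 0) ?addr0 //.
  apply/quo_proj0; exists (0, b x); rewrite /= big1 ?add0r // => i _.
  by rewrite ffunE linear0.
have [psi' psiP] := @P_proj _ _ _ q psi (@quo_proj_surj _ _ _ S_sub).
have [|a aP] := @proj_lift _ _ _ _ G (psi' \o dm1 P : {linear _ -> _})
    (@P_proj (Negz 0)) (fgmP _).
  by move=> x; apply/(quo_proj0 S_sub); rewrite [LHS]psiP psi0.
have /choice[c] : forall i, exists c : {linear P (Posz 0) -> P (Posz 0)},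
    exists b : {linear P (Negz 0) -> P (Negz 0)},
    forall x, (a x).1 i = c (dm1 P x) + dm1 P (b x).
  by move=> i; apply: (silting_ext_vanish P_silting (lproj _ i \o (fst \o a) : {linear _
      -> _})).
move=> /choice[b cb].
pose u1 := lsum (fun i => g i (Negz 0) \o b i : {linear _ -> _}) \+ (snd \o a) : {linear
    _ -> _}.
pose u0 := psi' \- lsum (fun i => g i (Posz 0) \o c i : {linear _ -> _}) : {linear _ -> _}.
have H1 x : u0 (dm1 P x) = dm1 Y (u1 x).
  rewrite /= [psi' _]aP /= linearD addrAC; congr (_ + _).
  rewrite [RHS]linear_sum -sumrB.
  apply: eq_bigr => i _; rewrite -linearB cb [_ + dm1 _ _]addrC addrK.
  by rewrite -chmap_dm1.
have H0 x : cdiff Y 0 (u0 x) = 0 by apply: two_term_d0.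
have [w [h [_ h0]]] := g_gen (two_term_map P2 H0 H1).
move=> x; rewrite -psiP; apply/quo_proj0.
exists ([ffun i => c i x + w i (Posz 0) x], h x).
have /eqP := h0 x; rewrite /= subr_eq => /eqP/eqP; rewrite subr_eq => /eqP->.
rewrite -addrA [LHS]addrC; congr (_ + _); rewrite -big_split.
by apply: eq_bigr => i _; rewrite ffunE linearD [RHS]addrC.
Qed.

(** Hom(X, M[1]) = 0, for a module M in degree 0. *)
Definition torsion (X : cpx A) (M : lmodType A^c) : Prop :=
  forall phi : {linear X (Negz 0) -> M},
  exists h : {linear X (Posz 0) -> M}, forall x, phi x = h (dm1 X x).

(** By [generates_surj], M is a quotient of a power of H^0(P), so a map C -> M[1]
lifts to a map from C to a power of P[1]. *)
Lemma torsion_of_ext_vanish C (M : fgmod A) : two_term_proj C -> ext_vanish C P ->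
  torsion P M -> torsion C M.
Proof.
move=> [C_proj C2] extCP M_tors phi.
have [n [g g_gen]] := generators_exist (@stalk_two_term _ M).
have extM : ext_vanish P (stalk M).
  move=> a; have [h hP] := M_tors a; exists h, (\0 : {linear _ -> _}) => x.
  by rewrite linear0 addr0.
have M_gen := generates_surj (@stalk_two_term _ M) extM g_gen.
have [|a aP] := @proj_lift _ _ _ _ (lcotuple (fun i => g i (Posz 0))) phi (@C_proj (Negz
    0)) (fgmP _).
  by move=> x; have [u ->] := M_gen (phi x); exists u.1; rewrite /= addr0.
have /choice[c] : forall i, exists c : {linear C (Posz 0) -> P (Posz 0)},
    exists b : {linear C (Negz 0) -> P (Negz 0)},
    forall x, (a x) i = c (dm1 C x) + dm1 P (b x).
  by move=> i; apply: (extCP (lproj _ i \o a : {linear _ -> _})).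
move=> /choice[b cb].
exists (lsum (fun i => g i (Posz 0) \o c i : {linear _ -> _})) => x.
rewrite aP; apply: eq_bigr => i _.
by rewrite cb linearD chmap_dm1 addr0.
Qed.

(** Membership in add P expressed in the derived category: the identity of X
factors through a power of P. *)
Definition in_addD X : Prop :=
  exists (n : nat) (g : 'I_n -> D P X) (s : 'I_n -> D X P), \sum_i g i ** s i = lid D X.

(** Let g : P^n -> C be a right approximation.  It suffices that the map from C to
the cone K of g vanishes.  The terms of K in degrees -1 and 0 are P0^n * C1 and C0
(0 and 1 marking the terms in degrees 0 and -1), and p : P0^n * C1 -> C0 is onto by
[generates_surj], with a section s0.  So K only has cohomology M in degree -1 (and
below), and M is the quotient of P0^n * C1 by the elements x whose component
x - s0 (p x) in ker p is a boundary.  As Hom(P, K) = 0, M satisfies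
Hom(P, M[1]) = 0, hence Hom(C, M[1]) = 0, and the map C -> K can be contracted. *)
Lemma silting_maximal C : two_term_proj C -> ext_vanish C P -> ext_vanish P C -> in_addD C.
Proof.
move=> C_tt extCP extPC; have [C_proj C2] := C_tt.
have [n [g g_gen]] := generators_exist C2.
pose G0 := lcotuple (fun i => g i (Posz 0)).
pose G1 := lcotuple (fun i => g i (Negz 0)).
pose p := lcopair G0 (dm1 C).
have p_surj : surj_map p.
  by move=> y; have [u ->] := generates_surj C2 extPC g_gen y; exists u.
have [s0 ps] := C_proj (Posz 0) _ _ p idfun p_surj.
pose dP := ltuple (fun i : 'I_n => dm1 P \o lproj _ i : {linear _ -> _}).
pose j := lpair (\- dP : {linear _ -> _}) G1.
have pj z : p (j z) = 0.
  rewrite /= linear_sum -big_split big1 // => i _.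
  by rewrite /= !ffunE -chmap_dm1 linearN; apply: addNr.
pose S x := exists z, x - s0 (p x) = j z.
have S_sub : submodule S.
  split=> [|a x y [u xu] [v yv]]; first by exists 0; rewrite !linear0 addr0.
  exists (a *: u + v); rewrite [j _]linearP -xu -yv scalerBr.
  by rewrite [p _]linearP [s0 _]linearP opprD addrACA.
pose q := quo_proj S_sub.
have q_surj : surj_map q := @quo_proj_surj _ _ _ S_sub.
have M_fg : fingen (quotient_mod S_sub).
  apply: fingen_img q_surj _.
  by apply: fingen_prod; [apply: fingen_ffun|]; apply: fgmP.
pose M := FgMod M_fg.
have qj z : q (j z) = 0 by apply/quo_proj0; exists z; rewrite pj linear0 subr0.
have qs y : q (s0 y) = 0.
  by apply/quo_proj0; exists 0; rewrite ps linear0 subrr.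
(* Hom(P, M[1]) = 0: subtract the part of phi along the section, write the
   components in P0 by rigidity of P, and correct by the generators of Hom(P, C). *)
have M_tors : torsion P M.
  move=> phi; have [phi1 phiP] := @P_proj _ _ _ q phi q_surj.
  pose phi' := phi1 \- (s0 \o (p \o phi1)) : {linear _ -> _}.
  have pphi x : p (phi' x) = 0 by rewrite linearB [X in _ - X]ps; apply: subrr.
  have qphi x : phi x = q (phi' x) by rewrite linearB [X in _ - X]qs subr0 phiP.
  move: phi' pphi qphi => phi' pphi qphi.
  have /choice[a'] : forall i, exists c : {linear P (Posz 0) -> P (Posz 0)},
      exists b : {linear P (Negz 0) -> P (Negz 0)},
      forall x, (phi' x).1 i = c (dm1 P x) + dm1 P (b x).
    by move=> i; apply: (silting_ext_vanish P_silting (lproj _ i \o (fst \o phi') :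
        {linear _ -> _})).
  move=> /choice[a'' aP].
  pose u1 := (snd \o phi') \+ lsum (fun i => g i (Negz 0) \o a'' i : {linear _ -> _}) :
      {linear _ -> _}.
  pose u0 := \- lsum (fun i => g i (Posz 0) \o a' i : {linear _ -> _}) : {linear _ -> _}.
  have H1 x : u0 (dm1 P x) = dm1 C (u1 x).
    have := pphi x.
    rewrite -[p _]/(\sum_i g i (Posz 0) ((phi' x).1 i) + dm1 C (phi' x).2).
    under eq_bigr do rewrite aP linearD chmap_dm1.
    rewrite big_split -addrA => /eqP; rewrite addr_eq0 => /eqP E.
    rewrite -[u0 _]/(- \sum_i g i (Posz 0) (a' i (dm1 P x))) E opprK.
    rewrite -[u1 x]/((phi' x).2 + \sum_i g i (Negz 0) (a'' i x)) linearD linear_sum.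
    by rewrite [RHS]addrC.
  have H0 x : cdiff C 0 (u0 x) = 0 by apply: two_term_d0.
  have [w [h [h1 h0]]] := g_gen (two_term_map P2 H0 H1).
  pose u := lpair (ltuple (fun i => a' i \+ w i (Posz 0) : {linear _ -> _})) h.
  exists (q \o u : {linear _ -> _}) => x.
  pose z := [ffun i => a'' i x - w i (Negz 0) x].
  have E : phi' x = u (dm1 P x) - j z.
    apply: injective_projections.
      apply/ffunP => i; rewrite aP !ffunE /= opprK ffunE linearB.
      by rewrite chmap_dm1 addrACA subrr addr0.
    change ((phi' x).2 = h (dm1 P x) - \sum_i g i (Negz 0) (z i)).
    have Ez : \sum_i g i (Negz 0) (w i (Negz 0) x) + \sum_i g i (Negz 0) (z i) =
        \sum_i g i (Negz 0) (a'' i x).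
      rewrite -big_split; apply: eq_bigr => i _.
      by rewrite ffunE linearB [LHS]addrC subrK.
    by rewrite -h1 -addrA -opprD Ez [RHS]addrK.
  by rewrite qphi E linearB qj subr0.
have Cin : linear (fun x : C (Negz 0) => (0, x) : {ffun 'I_n -> P (Posz 0)} * C (Negz 0)).
  by move=> a x y; apply: injective_projections; rewrite /= ?scaler0 ?addr0.
have [hC hCP] := torsion_of_ext_vanish C_tt extCP M_tors (q \o mklin Cin : {linear _ -> _}).
have [h' h'P] := C_proj (Posz 0) _ _ q hC q_surj.
(* H is a section of p whose second component is the homotopy from the identity of
   C to the composite C -> P^n -> C; s1 and the first component of H are the two
   components of C -> P^n. *)
pose H := h' \- (s0 \o (p \o h')) \+ s0 : {linear _ -> _}.
have pH y : p (H y) = y.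
  have -> : H y = h' y - s0 (p (h' y)) + s0 y by [].
  by rewrite linearD linearB !ps subrr add0r.
have qH y : q (H y) = hC y.
  have -> : H y = h' y - s0 (p (h' y)) + s0 y by [].
  by rewrite linearD linearB !qs subr0 addr0 h'P.
move: H pH qH => H pH qH.
pose i1 := mklin Cin.
have pi1 x : p (i1 x) = dm1 C x.
  change (lcotuple (fun i => g i (Posz 0)) 0 + dm1 C x = dm1 C x).
  by rewrite linear0 add0r.
have qi1 x : q (i1 x) = hC (dm1 C x) := hCP x.
have [|s1 s1P] := @proj_lift _ _ _ _ j (i1 \- (H \o dm1 C) : {linear _ -> _})
    (C_proj (Negz 0)) (fgmP _).
  move=> x.
  have : q (i1 x - H (dm1 C x)) = 0 by rewrite linearB qi1 qH; apply: subrr.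
  move=> /(quo_proj0 S_sub)[z vE]; exists z; rewrite -vE.
  by rewrite linearB pi1 pH subrr linear0 subr0.
have sE x : (H (dm1 C x)).1 = dP (s1 x).
  have /(congr1 fst)/= := s1P x; rewrite add0r => /oppr_inj; apply.
have H1 i x : (lproj _ i \o (fst \o H) : {linear _ -> _}) (dm1 C x) =
    dm1 P ((lproj _ i \o s1 : {linear _ -> _}) x).
  by rewrite -[LHS]/((H (dm1 C x)).1 i) sE ffunE.
have H0 i x : cdiff P 0 ((lproj _ i \o (fst \o H) : {linear _ -> _}) x) = 0.
  by apply: two_term_d0.
pose s i := two_term_map C2 (H0 i) (H1 i).
exists n, (fun i => dloc D (g i)), (fun i => dloc D (s i)).
under eq_bigr do rewrite -dloc_comp.
rewrite dloc_sum -dloc_id; apply/esym/dloc_eq_two_termP => //.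
exists (snd \o H : {linear _ -> _}); split=> x; rewrite chsumE.
  have E : x - (H (dm1 C x)).2 = \sum_i g i (Negz 0) (s1 x i) := congr1 snd (s1P x).
  change (x - \sum_i g i (Negz 0) (s1 x i) = (H (dm1 C x)).2).
  by rewrite -E opprB [LHS]addrC subrK.
have E : \sum_i g i (Posz 0) ((H x).1 i) + dm1 C (H x).2 = x := pH x.
change (x - \sum_i g i (Posz 0) ((H x).1 i) = dm1 C (H x).2).
by rewrite -{1}E [LHS]addrC addKr.
Qed.
End Silting.

Section AddP.
Variables (k : fieldType) (A : falgType k) (D : derived_category A).
Implicit Types X Y Z C : cpx A.
Variable P : cpx A.
Hypothesis P_tt : two_term_proj P.

Lemma dloc_eq0_two_termP X Y (f : chmap X Y) : two_term_proj X -> two_term Y ->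
  dloc D f = 0 <->
  exists h : {linear X (Posz 0) -> Y (Negz 0)},
    (forall x, f (Negz 0) x = h (dm1 X x)) /\
    (forall x, f (Posz 0) x = dm1 Y (h x)).
Proof. by move=> [X_proj X2] Y2; rewrite dloc_eq0 // nullhomotopic_two_termP. Qed.

(** The equation between morphisms, read off on chain maps. *)
Lemma in_addD_chain X : two_term_proj X -> in_addD D P X ->
  exists (n : nat) (g : 'I_n -> chmap P X) (s : 'I_n -> chmap X P)
    (h : {linear X (Posz 0) -> X (Negz 0)}),
    (forall x, x = \sum_i g i (Negz 0) (s i (Negz 0) x) + h (dm1 X x)) /\
    (forall x, x = \sum_i g i (Posz 0) (s i (Posz 0) x) + dm1 X (h x)).
Proof.
move=> X_tt [n [g0 [s0 gs]]]; have [X_proj X2] := X_tt; have [P_proj P2] := P_tt.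
have /choice[g gE] : forall i, exists f, g0 i = dloc D f.
  by move=> i; apply: dloc_full.
have /choice[s sE] : forall i, exists f, s0 i = dloc D f.
  by move=> i; apply: dloc_full.
have /dloc_eq_two_termP[//|//|h [h1 h0]] : dloc D (chid X) = dloc D (chsum (fun i =>
    chcomp (g i) (s i))).
  rewrite dloc_id -gs -dloc_sum; apply: eq_bigr => i _.
  by rewrite dloc_comp gE sE.
exists n, g, s, h; split=> x; rewrite -?h1 -?h0 chsumE.
  by rewrite [RHS]addrC subrK.
by rewrite [RHS]addrC subrK.
Qed.

Lemma ext_vanish_addr X Y : two_term_proj Y -> in_addD D P Y -> ext_vanish X P ->
    ext_vanish X Y.
Proof.
move=> Y_tt /(in_addD_chain Y_tt)[n [g [s [h [h1 h0]]]]] ext a.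
have /choice[c] : forall i, exists c : {linear X (Posz 0) -> P (Posz 0)},
    exists b : {linear X (Negz 0) -> P (Negz 0)},
    forall x, s i (Posz 0) (a x) = c (dm1 X x) + dm1 P (b x).
  by move=> i; apply: (ext (s i (Posz 0) \o a : {linear _ -> _})).
move=> /choice[b cb].
exists (lsum (fun i => g i (Posz 0) \o c i : {linear _ -> _})),
  (lsum (fun i => g i (Negz 0) \o b i : {linear _ -> _}) \+ (h \o a) : {linear _ -> _})
      => x.
rewrite [LHS]h0 /= linearD addrA; congr (_ + _).
rewrite linear_sum -big_split; apply: eq_bigr => i _.
by rewrite cb linearD chmap_dm1.
Qed.

Lemma ext_vanish_addl X Y : two_term_proj X -> in_addD D P X -> ext_vanish P Y ->
    ext_vanish X Y.
Proof.
move=> X_tt /(in_addD_chain X_tt)[n [g [s [h [h1 h0]]]]] ext a.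
have /choice[c] : forall i, exists c : {linear P (Posz 0) -> Y (Posz 0)},
    exists b : {linear P (Negz 0) -> Y (Negz 0)},
    forall x, a (g i (Negz 0) x) = c (dm1 P x) + dm1 Y (b x).
  by move=> i; apply: (ext (a \o g i (Negz 0) : {linear _ -> _})).
move=> /choice[b cb].
exists (lsum (fun i => c i \o s i (Posz 0) : {linear _ -> _}) \+ (a \o h) : {linear _ ->
    _}),
  (lsum (fun i => b i \o s i (Negz 0) : {linear _ -> _})) => x.
rewrite {1}(h1 x) linearD linear_sum /= addrAC; congr (_ + _).
rewrite linear_sum -big_split; apply: eq_bigr => i _.
by rewrite cb chmap_dm1.
Qed.
End AddP.

(** * The triangle of an approximation *)

Section Triangle.
Variables (k : fieldType) (A : falgType k) (D : derived_category A).
Variables (Q : fgmod A) (P' : cpx A).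
Hypotheses (Q_proj : projective_mod Q) (P'_tt : two_term_proj P').
Variable f : {linear Q -> P' (Posz 0)}.
Let P'2 : two_term P' := P'_tt.2.

Lemma stalk_two_term_proj : two_term_proj (stalk Q).
Proof.
split; last exact: stalk_two_term.
move=> i; rewrite /=; case: ifP => _ //.
by apply: zero_projective => x; apply/rowP => -[].
Qed.

Lemma shift_stalk_two_term_proj : two_term_proj (shift (stalk Q)).
Proof.
split; last exact: shift_stalk_two_term.
by move=> i; apply: stalk_two_term_proj.1.
Qed.

Definition approx_cone_diff : {linear prod_fg Q (P' (Negz 0)) -> P' (Posz 0)} :=
  lcopair f (dm1 P').

(** The cone of F; its terms outside degrees -1 and 0 vanish. *)
Definition approx_cone : cpx A := two_term_cpx approx_cone_diff.

Lemma approx_cone_two_term_proj : two_term_proj approx_cone.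
Proof.
split; last exact: two_term_cpxP.
apply: two_term_cpx_proj; last exact: P'_tt.1.
by apply: prod_projective => //; apply: P'_tt.1.
Qed.
Let C2 : two_term approx_cone := approx_cone_two_term_proj.2.

Lemma approx_map_chain0 (x : stalk Q (Posz 0)) : cdiff P' 0 (f x) = 0.
Proof. exact: two_term_d0. Qed.
Lemma approx_map_chain1 (x : stalk Q (Negz 0)) :
  f (dm1 (stalk Q) x) = dm1 P' ((\0 : {linear stalk Q (Negz 0) -> P' (Negz 0)}) x).
Proof. by rewrite !linear0. Qed.

Definition approx_map : chmap (stalk Q) P' := two_term_map (@stalk_two_term _ Q)
    approx_map_chain0 approx_map_chain1.

Definition inr_lin (U V : lmodType A^c) : {linear V -> (U * V)%type} :=
  lpair \0 idfun.
Definition inl_lin (U V : lmodType A^c) : {linear U -> (U * V)%type} :=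
  lpair idfun \0.

Lemma approx_cone_in_chain0 (x : P' (Posz 0)) : cdiff approx_cone 0 ((idfun : {linear P'
    (Posz 0) -> P' (Posz 0)}) x) = 0.
Proof. exact: two_term_d0. Qed.
Lemma approx_cone_in_chain1 (x : P' (Negz 0)) :
  (idfun : {linear P' (Posz 0) -> P' (Posz 0)}) (dm1 P' x) = dm1 approx_cone (inr_lin Q
      (P' (Negz 0)) x).
Proof. by rewrite /= linear0 add0r. Qed.
Definition approx_cone_in : chmap P' approx_cone := two_term_map P'2
    approx_cone_in_chain0 approx_cone_in_chain1.

Lemma approx_cone_out_chain0 (x : approx_cone (Posz 0)) :
  cdiff (shift (stalk Q)) 0 ((\0 : {linear approx_cone (Posz 0) -> shift (stalk Q) (Posz
      0)}) x) = 0.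
Proof. by rewrite linear0. Qed.
Lemma approx_cone_out_chain1 (x : approx_cone (Negz 0)) :
  (\0 : {linear approx_cone (Posz 0) -> shift (stalk Q) (Posz 0)}) (dm1 approx_cone x) =
  dm1 (shift (stalk Q)) ((fst : {linear (Q * P' (Negz 0))%type -> Q}) x).
Proof. by apply/rowP => -[]. Qed.
Definition approx_cone_out : chmap approx_cone (shift (stalk Q)) := two_term_map C2
    approx_cone_out_chain0 approx_cone_out_chain1.

Local Notation F := (dloc D approx_map).
Local Notation Io := (dloc D approx_cone_in).
Local Notation Del := (dloc D approx_cone_out).

Lemma cone_out_in : Del ** Io = 0.
Proof.
rewrite -dloc_comp -(dloc0 D); congr (dloc D _).
by apply: two_term_map_ext.
Qed.

Lemma cone_in_map : Io ** F = 0.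
Proof.
rewrite -dloc_comp; apply/(dloc_eq0_two_termP D _ stalk_two_term_proj C2).
exists (inl_lin Q (P' (Negz 0))); split=> x.
  have -> : x = 0 by apply/rowP => -[].
  by rewrite !linear0.
by rewrite /= linear0 addr0.
Qed.

(** Together with the next four lemmas: exactness of the long Hom sequences of the
triangle Q -> P' -> C -> Q[1].  In each case the homotopy given by a vanishing
composite is the missing component of the map to be constructed. *)
Lemma factor_cone_in Y (u : D P' Y) : two_term Y -> u ** F = 0 ->
  exists y : D approx_cone Y, u = y ** Io.
Proof.
move=> Y2; have [U ->] := dloc_full P'_tt.1 P'2 u.
rewrite -dloc_comp => /(dloc_eq0_two_termP D _ stalk_two_term_proj Y2)[h [_ h0]].
have H0 x : cdiff Y 0 (U (Posz 0) x) = 0 by apply: two_term_d0.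
have H1 (x : approx_cone (Negz 0)) : U (Posz 0) (dm1 approx_cone x) =
    dm1 Y ((lcopair h (U (Negz 0)) : {linear approx_cone (Negz 0) -> Y (Negz 0)}) x).
  by rewrite /= !linearD chmap_dm1 -h0.
exists (dloc D (two_term_map (X := approx_cone) C2 H0 H1)); rewrite -dloc_comp; congr
    (dloc D _).
by apply: two_term_map_ext => // x /=; rewrite linear0 add0r.
Qed.

Lemma factor_cone_out Y (y : D approx_cone Y) : two_term Y -> y ** Io = 0 ->
  exists m : D (shift (stalk Q)) Y, y = m ** Del.
Proof.
move=> Y2; have [U ->] := dloc_full approx_cone_two_term_proj.1 C2 y.
rewrite -dloc_comp => /(dloc_eq0_two_termP D _ P'_tt Y2)[h [h1 h0]].
pose m1 : {linear shift (stalk Q) (Negz 0) -> Y (Negz 0)} :=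
  (U (Negz 0) \o inl_lin Q (P' (Negz 0))) \- (h \o f).
have H0 x : cdiff Y 0 ((\0 : {linear shift (stalk Q) (Posz 0) -> Y (Posz 0)}) x) = 0.
  by rewrite linear0.
have H1 x : (\0 : {linear shift (stalk Q) (Posz 0) -> Y (Posz 0)}) (dm1 _ x) = dm1 Y (m1 x).
  change (0 = dm1 Y (U (Negz 0) (x, 0) - h (f x))).
  rewrite linearB -(chmap_dm1 U (x, 0)) -h0 /= linear0 addr0.
  by apply/esym/subrr.
exists (dloc D (two_term_map (@shift_stalk_two_term _ Q) H0 H1)); rewrite -dloc_comp.
apply/(dloc_eq_two_termP D _ _ approx_cone_two_term_proj Y2); exists h; split=> x.
  case: x => x z.
  change (U (Negz 0) (x, z) - (U (Negz 0) (x, 0) - h (f x)) = h (f x + dm1 P' z)).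
  have -> : U (Negz 0) (x, z) = U (Negz 0) (x, 0) + U (Negz 0) (0, z).
    rewrite -linearD; congr (U (Negz 0) _).
    by apply: injective_projections; rewrite /= ?addr0 ?add0r.
  have -> : U (Negz 0) (0, z) = h (dm1 P' z) := h1 z.
  by rewrite [RHS]linearD opprB addrC addrA subrK.
by rewrite [X in _ - X]/= subr0 -h0.
Qed.

Lemma lift_cone_in X (w : D X approx_cone) : two_term_proj X -> Del ** w = 0 ->
  exists v : D X P', w = Io ** v.
Proof.
move=> X_tt; have [X_proj X2] := X_tt; have [W ->] := dloc_full X_proj X2 w.
rewrite -dloc_comp => /(dloc_eq0_two_termP D _ X_tt (@shift_stalk_two_term _ Q))[h [h1 h0]].
pose W1 : {linear X (Negz 0) -> (Q * P' (Negz 0))%type} := W (Negz 0).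
pose v1 : {linear X (Negz 0) -> P' (Negz 0)} := snd \o W1.
pose v0 : {linear X (Posz 0) -> P' (Posz 0)} := W (Posz 0) \- (f \o h).
have H0 x : cdiff P' 0 (v0 x) = 0 by apply: two_term_d0.
have H1 x : v0 (dm1 X x) = dm1 P' (v1 x).
  rewrite /= [W _ _]chmap_dm1 -[h _]h1 /= addrC addKr //.
exists (dloc D (two_term_map X2 H0 H1)); rewrite -dloc_comp.
apply/(dloc_eq_two_termP D _ _ X_tt C2).
exists (inl_lin Q (P' (Negz 0)) \o h : {linear _ -> _}); split=> x.
  rewrite /= -h1 /=; apply: injective_projections => /=; first by rewrite subr0.
  by rewrite subrr.
by rewrite /= opprB addrC subrK linear0 addr0.
Qed.

Lemma lift_approx_map X (v : D X P') : two_term_proj X -> Io ** v = 0 ->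
  exists r : D X (stalk Q), v = F ** r.
Proof.
move=> X_tt; have [X_proj X2] := X_tt; have [V ->] := dloc_full X_proj X2 v.
rewrite -dloc_comp => /(dloc_eq0_two_termP D _ X_tt C2)[h [h1 h0]].
pose r0 : {linear X (Posz 0) -> stalk Q (Posz 0)} := fst \o (h : {linear _ -> (Q * P'
    (Negz 0))%type}).
have H0 x : cdiff (stalk Q) 0 (r0 x) = 0 by [].
have H1 x : r0 (dm1 X x) = dm1 (stalk Q) ((\0 : {linear X (Negz 0) -> stalk Q (Negz 0)}) x).
  by rewrite /= -h1.
exists (dloc D (two_term_map X2 H0 H1)); rewrite -dloc_comp.
apply/(dloc_eq_two_termP D _ _ X_tt P'2).
exists (snd \o (h : {linear _ -> (Q * P' (Negz 0))%type}) : {linear _ -> _}); split=> x.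
  by rewrite /= -h1 /= subr0.
by rewrite /= [V _ x]h0 /= addrC addKr.
Qed.

Lemma lift_cone_out X (a : D X (shift (stalk Q))) : two_term_proj X -> ext_vanish X P' ->
  exists w : D X approx_cone, a = Del ** w.
Proof.
move=> [X_proj X2] ext; have [a' ->] := dloc_full X_proj X2 a.
pose a1 : {linear X (Negz 0) -> Q} := a' (Negz 0).
have [c [b cb]] := ext (f \o a1 : {linear _ -> _}).
pose w1 : {linear X (Negz 0) -> approx_cone (Negz 0)} := lpair a1 (\- b : {linear _ -> _}).
have H0 x : cdiff approx_cone 0 (c x) = 0 by apply: two_term_d0.
have H1 x : c (dm1 X x) = dm1 approx_cone (w1 x).
  by rewrite /= linearN [f _]cb addrK.
exists (dloc D (two_term_map X2 (Y := approx_cone) H0 H1)); rewrite -dloc_comp; congr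
    (dloc D _).
by apply: two_term_map_ext => // x; apply/rowP => -[].
Qed.

(** If F vanishes, the triangle splits. *)
Lemma split_cone_out : F = 0 -> exists t : D (shift (stalk Q)) approx_cone, Del ** t =
    lid D _.
Proof.
move=> /(dloc_eq0_two_termP D _ stalk_two_term_proj P'2)[h [_ h0]].
pose t1 : {linear shift (stalk Q) (Negz 0) -> approx_cone (Negz 0)} :=
  lpair (idfun : {linear Q -> Q}) (\- h : {linear _ -> _}).
have H0 x : cdiff approx_cone 0 ((\0 : {linear shift (stalk Q) (Posz 0) -> approx_cone
    (Posz 0)}) x) = 0.
  by rewrite linear0.
have H1 x : (\0 : {linear shift (stalk Q) (Posz 0) -> approx_cone (Posz 0)}) (dm1 _ x) =
   dm1 approx_cone (t1 x).
  by rewrite /= linearN -h0 /= subrr.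
exists (dloc D (two_term_map (@shift_stalk_two_term _ Q) H0 H1)); rewrite -dloc_comp
    -dloc_id.
congr (dloc D _); apply: two_term_map_ext => [|x|x] //; first exact: shift_stalk_two_term.
by apply/rowP => -[].
Qed.

Section Approximation.
Variable P : cpx A.
Hypothesis P_tt : two_term_proj P.

Lemma ext_vanish_cone_r : ext_vanish P P' -> ext_vanish P approx_cone.
Proof.
move=> ext a; have [c [b cb]] := ext a.
exists c, (inr_lin Q (P' (Negz 0)) \o b : {linear _ -> _}) => x.
by rewrite /= linear0 add0r [LHS]cb.
Qed.

(** The sequence Hom(P', P) -> Hom(Q, P) -> Hom(C, P[1]) -> Hom(P', P[1]) = 0, whose
first map is onto. *)
Lemma ext_vanish_cone_l : ext_vanish P' P ->
  (forall g : D (stalk Q) P, exists u : D P' P, g = u ** F) -> ext_vanish approx_cone P.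
Proof.
move=> ext approx a; have [P_proj P2] := P_tt.
pose a1 : {linear Q -> P (Posz 0)} := a \o inl_lin Q (P' (Negz 0)).
pose a2 : {linear P' (Negz 0) -> P (Posz 0)} := a \o inr_lin Q (P' (Negz 0)).
have aE x z : a (x, z) = a1 x + a2 z.
  rewrite /= -linearD; congr (a _).
  by apply: injective_projections; rewrite /= ?addr0 ?add0r.
have [c [b cb]] := ext a2.
pose g0 : {linear stalk Q (Posz 0) -> P (Posz 0)} := a1 \- (c \o f).
have H0 x : cdiff P 0 (g0 x) = 0 by apply: two_term_d0.
have H1 (x : stalk Q (Negz 0)) :
    g0 (dm1 (stalk Q) x) = dm1 P ((\0 : {linear stalk Q (Negz 0) -> P (Negz 0)}) x).
  by rewrite !linear0.
have [u0] := approx (dloc D (two_term_map (@stalk_two_term _ Q) H0 H1)).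
have [u ->] := dloc_full P'_tt.1 P'2 u0.
rewrite -dloc_comp => /(dloc_eq_two_termP D _ _ stalk_two_term_proj P2)[h [_ h0]].
exists (c \+ u (Posz 0) : {linear _ -> _}), (lcopair h (b \- u (Negz 0) : {linear _ ->
    _})) => -[x z].
have h0x : a1 x - c (f x) - u (Posz 0) (f x) = dm1 P (h x) := h0 x.
rewrite aE cb.
have -> : a1 x = dm1 P (h x) + u (Posz 0) (f x) + c (f x).
  by rewrite -h0x !subrK.
change (dm1 P (h x) + u (Posz 0) (f x) + c (f x) + (c (dm1 P' z) + dm1 P (b z)) =
  (c (f x + dm1 P' z) + u (Posz 0) (f x + dm1 P' z)) +
  dm1 P (h x + (b z - u (Negz 0) z))).
rewrite (linearD c) (linearD (u (Posz 0))) (linearD (dm1 P)) (linearB (dm1 P)) -chmap_dm1.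
by rewrite [RHS](AC ((2*2)*(1*2)) ((5*3*1*(2*6))*(4*7))) /= subrr addr0.
Qed.
End Approximation.
End Triangle.

(** * Minimal approximations *)

Section Power.
Variables (k : fieldType) (A : falgType k) (D : derived_category A).
Variables (P : cpx A) (n : nat).

Lemma pow_two_term_proj : two_term_proj P -> two_term_proj (pow_cpx n P).
Proof.
move=> [P_proj P2]; split=> [i|i i1 i0 x]; first exact: ffun_projective.
by apply/ffunP => j; rewrite ffunE; apply: (P2 i).
Qed.

Definition pow_proj (j : 'I_n) : chmap (pow_cpx n P) P.
Proof.
exists (fun i => lproj (P i) j) => i x.
by rewrite /= /pow_diff_fun ffunE.
Defined.

Lemma linj_linear (V : lmodType A^c) (j : 'I_n) :
  linear (fun x : V => [ffun l => if l == j then x else 0] : {ffun 'I_n -> V}).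
Proof.
by move=> a x y; apply/ffunP => l; rewrite !ffunE; case: eqP; rewrite ?scaler0 ?addr0.
Qed.

Definition pow_inj (j : 'I_n) : chmap P (pow_cpx n P).
Proof.
exists (fun i => mklin (@linj_linear (P i) j)) => i x.
apply/ffunP => l; rewrite /= /pow_diff_fun !ffunE.
by case: eqP; rewrite ?linear0.
Defined.

Lemma pow_sum_id :
  \sum_j dloc D (pow_inj j) ** dloc D (pow_proj j) = lid D (pow_cpx n P).
Proof.
under eq_bigr do rewrite -dloc_comp.
rewrite dloc_sum -dloc_id; congr (dloc D _).
apply: chmapP => i x; rewrite chsumE; apply/ffunP => l; rewrite sum_ffunE.
rewrite (bigD1 l) //= ffunE eqxx big1 ?addr0 // => j jl.
by rewrite ffunE eq_sym (negPf jl).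
Qed.

Lemma pow_in_addD : in_addD D P (pow_cpx n P).
Proof.
by exists n, (fun j => dloc D (pow_inj j)), (fun j => dloc D (pow_proj j)); apply:
    pow_sum_id.
Qed.
End Power.

Section Minimal.
Variables (k : fieldType) (A : falgType k) (D : derived_category A).
Variables (P : cpx A) (Q : fgmod A).
Hypotheses (P_tt : two_term_proj P) (Q_proj : projective_mod Q).

(** A left approximation of Q by add P. *)
Record approx (P' : cpx A) (P'_tt : two_term_proj P') (f : {linear Q -> P' (Posz 0)}) :
    Prop := {
  approx_in_addD : in_addD D P P';
  approx_factor : forall g : D (stalk Q) P,
    exists u : D P' P, g = u ** dloc D (approx_map P'_tt f)
}.

(** The components of F are a spanning family of Hom(Q, P). *)
Lemma approx_ex : exists P' (P'_tt : two_term_proj P') (f : {linear Q -> P' (Posz 0)}),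
  approx P'_tt f.
Proof.
have [Qs_proj Q2] := stalk_two_term_proj Q_proj.
have [n [g0 gP]] := fingen_hom D P Qs_proj Q2.
have /choice[g gE] : forall i, exists f, g0 i = dloc D f.
  by move=> i; apply: dloc_full.
pose f : {linear Q -> pow_cpx n P (Posz 0)} := ltuple (fun i => g i (Posz 0)).
exists (pow_cpx n P), (pow_two_term_proj n P_tt), f; split; first exact: pow_in_addD.
move=> u; have [c ->] := gP u; exists (\sum_i c i *: dloc D (pow_proj P i)).
rewrite lcomp_suml; apply: eq_bigr => i _; rewrite lcompZl -dloc_comp gE.
congr (_ *: dloc D _); apply: two_term_map_ext => // x.
  have -> : x = 0 by apply/rowP => -[].
  by rewrite !linear0.
by rewrite /= ffunE.
Qed.

(** Its dimension over k measures the size of a two-term complex. *)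
Definition total (X : cpx A) : lmodType k :=
  (restr (kconv (kfalg A)) (X (Negz 0)) * restr (kconv (kfalg A)) (X (Posz 0)))%type.

Lemma total_fingen X : fingen (total X).
Proof. by apply: fingen_prod; apply: fingen_restr; apply: fgmP. Qed.

Section Shrink.
Variables (P' : cpx A) (P'_tt : two_term_proj P') (f : {linear Q -> P' (Posz 0)}).
Hypothesis f_approx : approx P'_tt f.
Variables (e : chmap P' P') (N : nat).
Hypotheses (e_f : dloc D e ** dloc D (approx_map P'_tt f) = dloc D (approx_map P'_tt f)).
Hypotheses (st1 : stable_at (e (Negz 0)) N) (st0 : stable_at (e (Posz 0)) N).

Definition chiter : chmap P' P' := iter N (chcomp e) (chid P').

Lemma chiterE i x : chiter i x = iter N (e i) x.
Proof. by rewrite /chiter; elim: N => //= n ->. Qed.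

Lemma chiter_f : dloc D chiter ** dloc D (approx_map P'_tt f) = dloc D (approx_map P'_tt f).
Proof.
rewrite /chiter; elim: N => /= [|n IH]; first by rewrite dloc_id lcomp1l.
by rewrite dloc_comp -lcompA IH e_f.
Qed.

(** The image of e^N is a direct summand of P', and F factors through it since e
fixes F; this gives a smaller approximation. *)
Lemma shrink : exists (I : cpx A) (I_tt : two_term_proj I) (fI : {linear Q -> I (Posz 0)})
    (p : chmap P' I),
  [/\ approx I_tt fI, surj_map (p (Negz 0)) /\ surj_map (p (Posz 0)),
     forall x, p (Negz 0) x = 0 <-> iter N (e (Negz 0)) x = 0 &
     forall x, p (Posz 0) x = 0 <-> iter N (e (Posz 0)) x = 0].
Proof.
have [P'_proj P'2] := P'_tt.
have [M1 [p1 [i1 [ip1 p1_0 i1_im im_i1]]]] := fitting_split st1.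
have [M0 [p0 [i0 [ip0 p0_0 i0_im im_i0]]]] := fitting_split st0.
have p1_surj : surj_map p1 by move=> z; exists (i1 z).
have p0_surj : surj_map p0 by move=> z; exists (i0 z).
pose I1 := FgMod (fingen_img p1_surj (fgmP _)).
pose I0 := FgMod (fingen_img p0_surj (fgmP _)).
pose dI : {linear I1 -> I0} := p0 \o (dm1 P' \o i1).
pose I := two_term_cpx dI.
have I_tt : two_term_proj I.
  split; last exact: two_term_cpxP.
  apply: two_term_cpx_proj; first exact: (@retract_projective _ _ _ i1 p1 (P'_proj (Negz
      0))).
  exact: (@retract_projective _ _ _ i0 p0 (P'_proj (Posz 0))).
have dN x : dm1 P' (iter N (e (Negz 0)) x) = iter N (e (Posz 0)) (dm1 P' x).
  by rewrite -!chiterE chmap_dm1.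
have pd x : p0 (dm1 P' x) = dI (p1 x).
  apply/eqP; rewrite -subr_eq0 -linearB -linearB; apply/eqP/p0_0.
  rewrite -dN; have -> : iter N (e (Negz 0)) (x - i1 (p1 x)) = 0; last by rewrite linear0.
  by apply/p1_0; rewrite linearB ip1; apply: subrr.
have id_ z : i0 (dI z) = dm1 P' (i1 z).
  by rewrite /dI /=; have [y ->] := i1_im z; rewrite dN im_i0.
have p_0 x : cdiff I 0 (p0 x) = 0 by apply: two_term_d0; exact: I_tt.2.
have i_0 (x : I (Posz 0)) : cdiff P' 0 (i0 x) = 0 by apply: two_term_d0.
pose p : chmap P' I := two_term_map P'2 p_0 pd.
pose i : chmap I P' := two_term_map (X := I) I_tt.2 i_0 id_.
have ip : chcomp i (chcomp p chiter) = chiter.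
  apply: two_term_map_ext => // x; rewrite [RHS]chiterE.
    by rewrite -[RHS]im_i1 -chiterE.
  by rewrite -[RHS]im_i0 -chiterE.
have pi : chcomp p i = chid I.
  by apply: two_term_map_ext => [|z|z]; [exact: I_tt.2 | exact: ip1 | exact: ip0].
exists I, I_tt, (p0 \o f : {linear _ -> _}), p; split=> //.
have fE : dloc D (approx_map I_tt (p0 \o f : {linear _ -> _})) = dloc D p ** dloc D
    (approx_map P'_tt f).
  rewrite -dloc_comp; congr (dloc D _); apply: two_term_map_ext => // [|x].
    exact: stalk_two_term.
  have -> : x = 0 by apply/rowP => -[].
  by rewrite !linear0.
split=> [|u].
  have [n [g [s gs]]] := approx_in_addD f_approx.
  exists n, (fun j => dloc D p ** g j), (fun j => s j ** dloc D i).
  rewrite -dloc_id -pi dloc_comp -[X in _ = _ ** X]lcomp1l -gs lcomp_suml lcomp_sumr.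
  by apply: eq_bigr => j _; rewrite !lcompA.
have [v ->] := approx_factor f_approx u.
exists (v ** dloc D i); rewrite fE.
by rewrite -{1}chiter_f -ip !dloc_comp !lcompA -!(lcompA _ (dloc D chiter)) chiter_f.
Qed.
End Shrink.

(** Take P' of minimal dimension.  A map that fixes F cannot have a nontrivial
Fitting kernel, by [shrink]. *)
Lemma minimal_approx : exists P' (P'_tt : two_term_proj P') (f : {linear Q -> P' (Posz 0)}),
  approx P'_tt f /\
  forall eps : D P' P', eps ** dloc D (approx_map P'_tt f) = dloc D (approx_map P'_tt f) ->
    exists eps', eps' ** eps = lid D P' /\ eps ** eps' = lid D P'.
Proof.
have ex : exists m, `[< exists P' (P'_tt : two_term_proj P') (f : {linear Q -> P' (Posz
    0)}),
    approx P'_tt f /\ kspan m (total P') >].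
  have [P' [P'_tt [f f_approx]]] := approx_ex.
  have [m mP] := total_fingen P'.
  by exists m; apply/asboolP; exists P', P'_tt, f.
have [m /asboolP[P' [P'_tt [f [f_approx P'_span]]]] m_min] := ex_minnP ex.
exists P', P'_tt, f; split=> // eps eps_f; have [P'_proj P'2] := P'_tt.
have [e eE] := dloc_full P'_proj P'2 eps.
have lin : linear (fun x : total P' => (e (Negz 0) x.1, e (Posz 0) x.2) : total P').
  by move=> a x y; apply: injective_projections; apply: restr_linear.
have iterE N x : iter N (mklin lin) x =
    (iter N (e (Negz 0)) x.1, iter N (e (Posz 0)) x.2).
  by elim: N => [|N IH]; [case: x | rewrite iterS IH].
have [N N0 [stN1 stN2]] := fitting (mklin lin) (total_fingen P').
(* A single N serves both degrees. *)
have st1 : stable_at (e (Negz 0)) N.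
  split=> x.
    have [y] := stN1 (x, 0); rewrite !iterE => /(congr1 fst) E.
    by exists y.1.
  move=> x0; have /(congr1 fst) : iter N (mklin lin) (x, 0) = 0; last by rewrite iterE.
  by apply: stN2; rewrite iterE /= x0 liter0.
have st0 : stable_at (e (Posz 0)) N.
  split=> x.
    have [y] := stN1 (0, x); rewrite !iterE => /(congr1 snd) E.
    by exists y.2.
  move=> x0; have /(congr1 snd) : iter N (mklin lin) (0, x) = 0; last by rewrite iterE.
  by apply: stN2; rewrite iterE /= x0 liter0.
rewrite eE in eps_f.
have [I [I_tt [fI [p [I_approx [p1_surj p0_surj] p1_0 p0_0]]]]] := shrink f_approx eps_f
    st1 st0.
have linp : linear (fun x : total P' => (p (Negz 0) x.1, p (Posz 0) x.2) : total I).
  by move=> a x y; apply: injective_projections; apply: restr_linear.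
have pp_surj : surj_map (mklin linp).
  move=> [z1 z0]; have [x1 <-] := p1_surj z1; have [x0 <-] := p0_surj z0.
  by exists (x1, x0).
have inj_pp (x : total P') : mklin linp x = 0 -> x = 0.
  move=> x0; apply: contrapT => xN0.
  have [m' m'm m'P] := kspan_drop pp_surj P'_span xN0 x0.
  have /m_min : `[< exists P' (P'_tt : two_term_proj P') (f : {linear Q -> P' (Posz 0)}),
      approx P'_tt f /\ kspan m' (total P') >] by apply/asboolP; exists I, I_tt, fI.
  by rewrite leqNgt m'm.
have e1_bij : bijective (e (Negz 0)).
  apply: (stable_bijective N0 st1) => x /p1_0 px.
  have /(congr1 fst) : (x, 0) = 0 :> total P'; last by [].
  by apply: inj_pp; rewrite /= px linear0.
have e0_bij : bijective (e (Posz 0)).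
  apply: (stable_bijective N0 st0) => x /p0_0 px.
  have /(congr1 snd) : (0, x) = 0 :> total P'; last by [].
  by apply: inj_pp; rewrite /= px linear0.
have [e1' [e1K Ke1]] := linear_inverse e1_bij.
have [e0' [e0K Ke0]] := linear_inverse e0_bij.
have H0 x : cdiff P' 0 (e0' x) = 0 by apply: two_term_d0.
have H1 x : e0' (dm1 P' x) = dm1 P' (e1' x).
  by apply: (can_inj e0K); rewrite Ke0 chmap_dm1 Ke1.
exists (dloc D (two_term_map P'2 H0 H1)); rewrite eE -!dloc_comp -!dloc_id.
by split; congr (dloc D _); apply: two_term_map_ext => // x /=; rewrite ?e1K ?e0K ?Ke1 ?Ke0.
Qed.
End Minimal.

(** * Summands of powers *)

Section SumMaps.
Variables (R : pzRingType) (X Y : cpx R).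

Lemma sum_inl_linear i : linear (fun x : X i => (x, 0) : sum_cpx X Y i).
Proof. by move=> a x y; apply: injective_projections; rewrite /= ?scaler0 ?addr0. Qed.

Lemma sum_inl_chain i x : mklin (@sum_inl_linear (i + 1)) (cdiff X i x) =
  cdiff (sum_cpx X Y) i (mklin (@sum_inl_linear i) x).
Proof. by rewrite /= /sum_diff_fun /= linear0. Qed.
Definition sum_inl : chmap X (sum_cpx X Y) := ChMap sum_inl_chain.

Lemma sum_fst_chain i x : (fst : {linear sum_cpx X Y (i + 1) -> X (i + 1)})
  (cdiff (sum_cpx X Y) i x) = cdiff X i ((fst : {linear sum_cpx X Y i -> X i}) x).
Proof. by []. Qed.
Definition sum_fst : chmap (sum_cpx X Y) X := ChMap sum_fst_chain.
End SumMaps.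

Section InAdd.
Variables (k : fieldType) (A : falgType k) (D : derived_category A).
Variables (P : cpx A).

(** The identity of a power of P is the sum of its injections after projections. *)
Lemma in_add_in_addD X : in_add P X -> in_addD D P X.
Proof.
move=> [n [Y [_ [a [b [ba _]]]]]].
exists n, (fun j => dloc D (chcomp (sum_fst X Y) (chcomp b (pow_inj P j)))),
  (fun j => dloc D (chcomp (chcomp (pow_proj P j) a) (sum_inl X Y))).
transitivity (\sum_j (dloc D (sum_fst X Y) ** dloc D b) **
    (dloc D (pow_inj P j) ** dloc D (pow_proj P j)) **
    (dloc D a ** dloc D (sum_inl X Y))).
  by apply: eq_bigr => j _; rewrite !dloc_comp !lcompA.
rewrite -lcomp_suml -lcomp_sumr pow_sum_id lcomp1r lcompA -(lcompA _ (dloc D b)).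
rewrite -dloc_comp (dloc_homotopic D ba) dloc_id lcomp1r -dloc_comp -dloc_id.
by congr (dloc D _); apply: chmapP.
Qed.

Section Retract.
Variables (X Z : cpx A) (s : chmap X Z) (r : chmap Z X).
Hypothesis rs : forall i x, r i (s i x) = x.

Lemma im_submodule i : submodule (fun z : Z i => exists x, z = s i x).
Proof.
split=> [|a x y [u ->] [v ->]]; first by exists 0; rewrite linear0.
by exists (a *: u + v); rewrite linearP.
Qed.

Definition coker_ob i : fgmod A :=
  FgMod (fingen_img (@quo_proj_surj _ _ _ (im_submodule i)) (fgmP (Z i))).

Definition coker_proj i : {linear Z i -> coker_ob i} := quo_proj (im_submodule i).

Lemma coker_projP i z : coker_proj i z = 0 <-> exists x, z = s i x.
Proof. exact: quo_proj0. Qed.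

Lemma coker_diff_ex i : exists d : {linear coker_ob i -> coker_ob (i + 1)},
  forall z, d (coker_proj i z) = coker_proj (i + 1) (cdiff Z i z).
Proof.
have [|d dP] := @quo_lift _ _ _ _ (im_submodule i) (coker_proj (i + 1) \o cdiff Z i).
  by move=> z [x ->]; apply/coker_projP; exists (cdiff X i x); rewrite cmapP.
by exists d.
Qed.
Definition coker_diff i := sval (cid (coker_diff_ex i)).
Lemma coker_diffE i z : coker_diff i (coker_proj i z) = coker_proj (i + 1) (cdiff Z i z).
Proof. exact: (svalP (cid (coker_diff_ex i))). Qed.

Lemma coker_surj i (z : coker_ob i) : exists y, coker_proj i y = z.
Proof. exact: quo_proj_surj. Qed.

Lemma coker_diffK i z : coker_diff (i + 1) (coker_diff i z) = 0.
Proof.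
by have [y <-] := coker_surj z; rewrite !coker_diffE cdiffK linear0.
Qed.

Lemma coker_bounded : exists n : nat, forall i : int,
  (n < `|i|)%N -> is_zero_mod (coker_ob i).
Proof.
have [n nP] := cbounded Z; exists n => i ni z; have [y <-] := coker_surj z.
by rewrite (nP i ni y) linear0.
Qed.

(** The complement of X in Z, realized as the cokernel of s rather than the kernel
of r. *)
Definition coker : cpx A := Cpx coker_diffK coker_bounded.

Lemma coker_sec_ex i : exists t : {linear coker_ob i -> Z i},
  forall z, t (coker_proj i z) = z - s i (r i z).
Proof.
have [|t tP] := @quo_lift _ _ _ _ (im_submodule i)
    (idfun \- (s i \o r i) : {linear Z i -> Z i}).
  by move=> z [x ->]; rewrite /= rs; apply: subrr.
by exists t.
Qed.
Definition coker_sec i := sval (cid (coker_sec_ex i)).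
Lemma coker_secE i z : coker_sec i (coker_proj i z) = z - s i (r i z).
Proof. exact: (svalP (cid (coker_sec_ex i))). Qed.

Lemma coker_secK i z : coker_proj i (coker_sec i z) = z.
Proof.
have [y <-] := coker_surj z; rewrite coker_secE linearB.
have -> : coker_proj i (s i (r i y)) = 0 by apply/coker_projP; exists (r i y).
by rewrite subr0.
Qed.

Lemma r_sec i z : r i (coker_sec i z) = 0.
Proof.
by have [y <-] := coker_surj z; rewrite coker_secE linearB rs; apply: subrr.
Qed.

Lemma coker_proj_cpx : proj_cpx Z -> proj_cpx coker.
Proof.
move=> Z_proj i; apply: (@retract_projective _ _ _ (coker_sec i) (coker_proj i)) => //.
exact: coker_secK.
Qed.

Lemma retract_split : homotopy_equiv (sum_cpx X coker) Z.
Proof.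
have fP i z : lcopair (s (i + 1)) (coker_sec (i + 1)) (cdiff (sum_cpx X coker) i z) =
    cdiff Z i (lcopair (s i) (coker_sec i) z).
  case: z => x z; have [y <-] := coker_surj z.
  rewrite -[LHS]/(s (i + 1) (cdiff X i x) + coker_sec (i + 1) (coker_diff i (coker_proj i
      y))).
  rewrite -[lcopair _ _ _]/(s i x + coker_sec i (coker_proj i y)).
  by rewrite coker_diffE !coker_secE [in RHS]linearD linearB !cmapP.
have gP i z : lpair (r (i + 1)) (coker_proj (i + 1)) (cdiff Z i z) =
    cdiff (sum_cpx X coker) i (lpair (r i) (coker_proj i) z).
  apply: injective_projections; first by rewrite /= cmapP.
  by rewrite -[RHS]/(coker_diff i (coker_proj i z)) coker_diffE.
pose f : chmap (sum_cpx X coker) Z := ChMap (X := sum_cpx X coker) fP.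
pose g : chmap Z (sum_cpx X coker) := ChMap (Y := sum_cpx X coker) gP.
exists f, g; split.
  have -> : chcomp g f = chid _; last exact: homotopic_refl.
  apply: chmapP => i [x z]; apply: injective_projections.
    by rewrite -[LHS]/(r i (s i x + coker_sec i z)) linearD rs r_sec addr0.
  rewrite -[LHS]/(coker_proj i (s i x + coker_sec i z)) linearD coker_secK.
  have -> : coker_proj i (s i x) = 0 by apply/coker_projP; exists x.
  by rewrite add0r.
have -> : chcomp f g = chid _; last exact: homotopic_refl.
apply: chmapP => i z.
rewrite -[LHS]/(s i (r i z) + coker_sec i (coker_proj i z)) coker_secE.
by rewrite addrC subrK.
Qed.
End Retract.

Hypothesis P_tt : two_term_proj P.

(** A complex in a single degree has no nonzero homotopies to itself, so a retract
up to homotopy of a power of P is a strict retract, and its complement is the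
cokernel. *)
Lemma in_addD_in_add X : two_term_proj X ->
  is_zero_mod (X (Negz 0)) \/ is_zero_mod (X (Posz 0)) ->
  in_addD D P X -> in_add P X.
Proof.
move=> X_tt X0 /(in_addD_chain P_tt X_tt)[n [g [s [h [h1 h0]]]]].
have sP i x : ltuple (fun j => s j (i + 1)) (cdiff X i x) =
    cdiff (pow_cpx n P) i (ltuple (fun j => s j i) x).
  by apply/ffunP => j; rewrite !ffunE cmapP.
have gP i x : lcotuple (fun j => g j (i + 1)) (cdiff (pow_cpx n P) i x) =
    cdiff X i (lcotuple (fun j => g j i) x).
  rewrite [RHS]linear_sum; apply: eq_bigr => j _.
  by rewrite -cmapP ffunE.
pose S : chmap X (pow_cpx n P) := ChMap (Y := pow_cpx n P) sP.
pose G : chmap (pow_cpx n P) X := ChMap (X := pow_cpx n P) gP.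
have hz x : h x = 0.
  by case: X0 => X0; [rewrite (X0 (h x)) | rewrite (X0 x) linear0].
have rs i x : G i (S i x) = x.
  have GS : G i (S i x) = \sum_j g j i (s j i x).
    by apply: eq_bigr => j _; rewrite ffunE.
  rewrite GS; case: i x {GS} => [[|i]|[|i]] x.
  - by rewrite {2}(h0 x) hz linear0 addr0.
  - by rewrite (X_tt.2 _ _ _ x) // big1 // => j _; rewrite !linear0.
  - by rewrite {2}(h1 x) hz addr0.
  - by rewrite (X_tt.2 _ _ _ x) // big1 // => j _; rewrite !linear0.
exists n, (coker S); split; last exact: (retract_split rs).
by apply: (coker_proj_cpx rs); apply: (pow_two_term_proj n P_tt).1.
Qed.

End InAdd.

(** * The duality between Hom(P, nu Q) and Hom(Q, P) *)

Section Serre.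
Variables (k : fieldType) (A : falgType k) (D : derived_category A).
Variables (P : cpx A) (Q : fgmod A).
Hypotheses (P_tt : two_term_proj P) (Q_proj : projective_mod Q).
Variables (m : nat) (p : 'I_m -> Q) (xi : 'I_m -> {linear Q -> (A^c)^o}).
Hypothesis pxi : forall x, x = \sum_i (xi i x : A^c) *: p i.

Let Q_tt := stalk_two_term_proj Q_proj.

Definition rhom_of (f : {linear Q -> (A^c)^o}) : rhom Q := f.

(** The functionals of a dual basis of Q generate Hom_A(Q, A). *)
Lemma rhom_basis (f : rhom Q) :
  f = \sum_i (linmap_lin f (p i) : A) *: rhom_of (xi i) :> rhom Q.
Proof.
apply: linmapP => x.
have sumE (F : 'I_m -> rhom Q) :
    linmap_lin (\sum_i F i) x = \sum_i linmap_lin (F i) x :> (A^c)^o.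
  by apply: (big_morph (fun h : rhom Q => linmap_lin h x)).
rewrite sumE {1}(pxi x) linear_sum; apply: eq_bigr => i _.
by rewrite linearZ.
Qed.

(** The evaluation of Hom_A(Q, nu Q) = D End_A(Q) at the identity of Q, the sum of the
rank-one endomorphisms p i (xi i). *)
Definition chain_trace (t : chmap (stalk Q) (stalk (nu Q))) : k :=
  \sum_i linmap_lin (t (Posz 0) (p i) : nu Q) (rhom_of (xi i)).

Lemma dloc_stalk_inj (t t' : chmap (stalk Q) (stalk (nu Q))) :
  dloc D t = dloc D t' -> forall x : Q, t (Posz 0) x = t' (Posz 0) x.
Proof.
move=> /(dloc_eq_two_termP D _ _ Q_tt (@stalk_two_term _ _))[h [_ h0]] x.
by apply/eqP; rewrite -subr_eq0; apply/eqP; rewrite [LHS]h0.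
Qed.

Definition hom_trace (u : D (stalk Q) (stalk (nu Q))) : k^o :=
  chain_trace (sval (cid (dloc_full Q_tt.1 Q_tt.2 u))).

Lemma hom_traceE t : hom_trace (dloc D t) = chain_trace t.
Proof.
rewrite /hom_trace; case: cid => t' /= E; apply: eq_bigr => i _.
by rewrite (dloc_stalk_inj E).
Qed.

Lemma hom_trace_linear : linear hom_trace.
Proof.
move=> c u v; have [t ->] := dloc_full Q_tt.1 Q_tt.2 u.
have [t' ->] := dloc_full Q_tt.1 Q_tt.2 v.
rewrite -dloc_lin !hom_traceE /chain_trace scaler_sumr -big_split; apply: eq_bigr => i _.
transitivity (linmap_lin (t (Posz 0) (p i) : nu Q) (c *: (rhom_of (xi i) : restr (kfalg
    A) (rhom Q)))
  + linmap_lin (t' (Posz 0) (p i) : nu Q) (rhom_of (xi i))); first by [].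
by rewrite linearZ.
Qed.

Lemma hom_traceD u v : hom_trace (u + v) = hom_trace u + hom_trace v.
Proof. by have := hom_trace_linear 1 u v; rewrite !scale1r. Qed.

Definition pairing (phi : D P (stalk (nu Q))) (g : D (stalk Q) P) : k^o :=
  hom_trace (phi ** g).

Lemma pairing_linl g : linear (pairing^~ g).
Proof. by move=> a x y; rewrite /pairing lcomp_linl hom_trace_linear. Qed.
Lemma pairing_linr phi : linear (pairing phi).
Proof. by move=> a x y; rewrite /pairing lcomp_linr hom_trace_linear. Qed.

Lemma pairing0 phi : pairing phi 0 = 0.
Proof. exact: (linear0 (mklin (pairing_linr phi))). Qed.

Lemma rank1_linear (M : lmodType A^c) (y : M) (f : rhom Q) :
  linear (fun x => (linmap_lin f x : A^c) *: y).
Proof. by move=> a x z; rewrite linearP scalerDl scalerA. Qed.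
(** The map x |-> y f(x). *)
Definition rank1 (M : lmodType A^c) (y : M) (f : rhom Q) : {linear Q -> M} :=
  mklin (rank1_linear y f).

Lemma from_stalk0 (h : {linear stalk Q (Posz 0) -> P (Posz 0)}) x : cdiff P 0 (h x) = 0.
Proof. by apply: two_term_d0; apply: P_tt.2. Qed.
Lemma from_stalk1 (h : {linear stalk Q (Posz 0) -> P (Posz 0)}) x :
  h (dm1 (stalk Q) x) = dm1 P ((\0 : {linear stalk Q (Negz 0) -> P (Negz 0)}) x).
Proof. by rewrite !linear0. Qed.
Definition from_stalk (h : {linear Q -> P (Posz 0)}) : chmap (stalk Q) P :=
  two_term_map (@stalk_two_term _ Q) (from_stalk0 h) (from_stalk1 h).

Definition rank1_map (y : P (Posz 0)) (f : rhom Q) : D (stalk Q) P :=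
  dloc D (from_stalk (rank1 y f)).

(** On rank-one maps the pairing is the evaluation of phi, by expansion of f in the
dual basis. *)
Lemma pairing_rank1 (phi : chmap P (stalk (nu Q))) y f :
  pairing (dloc D phi) (rank1_map y f) = linmap_lin (phi (Posz 0) y : nu Q) f.
Proof.
rewrite /pairing -dloc_comp hom_traceE /chain_trace [f in RHS]rhom_basis.
rewrite [RHS](linear_sum (linmap_lin (phi (Posz 0) y : nu Q))); apply: eq_bigr => i _.
by rewrite [X in linmap_lin X]linearZ.
Qed.

Lemma pairing_inj phi : (forall g, pairing phi g = 0) -> phi = 0.
Proof.
have [Phi ->] := dloc_full P_tt.1 P_tt.2 phi => phi0.
rewrite -(dloc0 D); congr (dloc D _); apply: two_term_map_ext => [|x|y].
- exact: P_tt.2.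
- by apply/rowP => -[].
by apply: linmapP => f; rewrite [LHS](esym (pairing_rank1 _ _ _)) phi0.
Qed.

(** The functional determines phi by its values on rank-one maps, and every map out
of Q is a sum of rank-one maps. *)
Lemma pairing_surj (lam : {linear D (stalk Q) P -> k^o}) :
  exists phi, forall g, pairing phi g = lam g.
Proof.
have dloc_fs (h h' : {linear Q -> P (Posz 0)}) : h =1 h' -> dloc D (from_stalk h) = dloc
    D (from_stalk h').
  move=> E; congr (dloc D _); apply: two_term_map_ext => //; exact: stalk_two_term.
have lin1 y : linear (fun f : restr (kfalg A) (rhom Q) => lam (rank1_map y f)).
  move=> c f f'; rewrite -linearP; congr (lam _).
  rewrite /rank1_map -dloc_lin; congr (dloc D _).
  apply: two_term_map_ext => [|x|x]; first exact: stalk_two_term.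
    have -> : x = 0 by apply/rowP => -[].
    by rewrite !linear0.
  change ((linmap_lin (c *: f + f') x : A^c) *: y =
    (kfalg A c : A^c) *: ((linmap_lin (f : rhom Q) x : A^c) *: y) +
    (linmap_lin (f' : rhom Q) x : A^c) *: y).
  by rewrite kcentral scalerA -scalerDl.
pose Phi_fun y : nu Q := mklin (lin1 y) : ldual (kfalg A) (rhom Q).
have lin0 : linear Phi_fun.
  move=> a y y'; apply: linmapP => f.
  change (lam (rank1_map (a *: y + y') f) =
    lam (rank1_map y ((a : A) *: (f : rhom Q))) + lam (rank1_map y' f)).
  rewrite -linearD dlocD; congr (lam (dloc D _)).
  apply: two_term_map_ext => [|x|x]; first exact: stalk_two_term.
    have -> : x = 0 by apply/rowP => -[].
    by rewrite !linear0.
  rewrite chlin1E.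
  change ((linmap_lin (f : rhom Q) x : A^c) *: (a *: y + y') =
    ((linmap_lin (f : rhom Q) x : A^c) * a) *: y + (linmap_lin (f : rhom Q) x : A^c) *: y').
  by rewrite scalerDr scalerA.
pose Phi0 : {linear P (Posz 0) -> stalk (nu Q) (Posz 0)} := mklin lin0.
have H0 y : cdiff (stalk (nu Q)) 0 (Phi0 y) = 0 by [].
have H1 z : Phi0 (dm1 P z) = dm1 (stalk (nu Q))
    ((\0 : {linear P (Negz 0) -> stalk (nu Q) (Negz 0)}) z).
  rewrite linear0; apply: linmapP => f.
  rewrite -[LHS]/(lam (rank1_map (dm1 P z) f)).
  have -> : rank1_map (dm1 P z) f = 0; last by rewrite linear0.
  apply/(dloc_eq0_two_termP D _ Q_tt P_tt.2); exists (rank1 z f); split=> x.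
    have -> : x = 0 by apply/rowP => -[].
    by rewrite !linear0.
  by rewrite [RHS]linearZ.
exists (dloc D (two_term_map P_tt.2 H0 H1)) => g.
have [G ->] := dloc_full Q_tt.1 Q_tt.2 g.
rewrite /pairing -dloc_comp hom_traceE /chain_trace.
transitivity (\sum_i lam (rank1_map (G (Posz 0) (p i)) (rhom_of (xi i)))).
  by apply: eq_bigr.
rewrite -linear_sum dloc_sum; congr (lam (dloc D _)).
apply: two_term_map_ext => [|x|x]; first exact: stalk_two_term.
  have -> : x = 0 by apply/rowP => -[].
  by rewrite !linear0.
rewrite chsumE; transitivity (G (Posz 0) (\sum_i (xi i x : A^c) *: p i)).
  by rewrite linear_sum; apply: eq_bigr => i _; rewrite linearZ.
by rewrite -pxi.
Qed.

Lemma pairing_perfect :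
  (forall Lam : {linear D P (stalk (nu Q)) -> k^o}, exists g, forall phi, pairing phi g =
      Lam phi) /\
  (forall g, (forall phi, pairing phi g = 0) -> g = 0).
Proof.
apply: dual_pairing.
- by apply: fingen_hom; [exact: Q_tt.1 | exact: Q_tt.2].
- exact: pairing_linl.
- exact: pairing_linr.
- exact: pairing_inj.
- exact: pairing_surj.
Qed.

End Serre.

(** * Hom(X, P) as a left module over End(P) *)

(** An alias of Hom(X, P), to carry the action of End(P) by postcomposition. *)
Definition corep (k : fieldType) (O : Type) (C : lin_category k O) (P X : O) :
  Type := C X P.

Section Corep.
Variables (k : fieldType) (O : Type) (C : lin_category k O) (P X : O).
Local Notation corep := (corep C P X).
Local Notation B := (endo C P).

HB.instance Definition _ := GRing.Zmodule.copy corep (C X P).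

Definition corep_scale (b : B) (f : corep) : corep := (b : C P P) ** (f : C X P).

Lemma corep_scaleA b c f : corep_scale b (corep_scale c f) = corep_scale (b * c) f.
Proof. exact: lcompA. Qed.
Lemma corep_scale1 : left_id 1 corep_scale.
Proof. by move=> f; apply: lcomp1l. Qed.
Lemma corep_scaleDr : right_distributive corep_scale +%R.
Proof. by move=> b f g; apply: lcompDr. Qed.
Lemma corep_scaleDl f : {morph corep_scale^~ f : b c / b + c}.
Proof. by move=> b c; apply: lcompDl. Qed.

HB.instance Definition _ := GRing.Zmodule_isLmodule.Build B corep
  corep_scaleA corep_scale1 corep_scaleDr corep_scaleDl.

Lemma precomp_linear (g : C P X) : linear (fun u : corep => (u : C X P) ** g : B^o).
Proof.
move=> b u v; rewrite -[LHS]/(((b : C P P) ** (u : C X P) + (v : C X P)) ** g).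
by rewrite lcompDl -lcompA.
Qed.
Definition precomp (g : C P X) : {linear corep -> B^o} := mklin (precomp_linear g).

Section DualBasis.
Variables (n : nat) (g : 'I_n -> C P X) (s : 'I_n -> C X P).
Hypothesis gs : \sum_i g i ** s i = lid C X.

Lemma corep_dual_basis (u : corep) :
  u = \sum_i (precomp (g i) u : B) *: (s i : corep).
Proof.
rewrite -{1}[u](lcomp1r (u : C X P)) -gs lcomp_sumr.
by apply: eq_bigr => i _; rewrite lcompA.
Qed.

Lemma corep_fingen_projective : fingen corep /\ projective_mod corep.
Proof. exact: dual_basis_projective corep_dual_basis. Qed.

(** If the s i are replaced by elements t i of a submodule and the resulting
endomorphism of X remains invertible, the t i still generate. *)
Lemma corep_in_submodule (T : corep -> Prop) (t : 'I_n -> C X P) (eps' : C X X) :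
  submodule T -> (forall i, T (t i)) -> eps' ** (\sum_i g i ** t i) = lid C X ->
  forall u : corep, T u.
Proof.
move=> T_sub Tt epsK u.
have -> : u = \sum_i (precomp (eps' ** g i) u : B) *: (t i : corep).
  rewrite -{1}[u](lcomp1r (u : C X P)) -epsK !lcomp_sumr.
  apply: eq_bigr => i _.
  by rewrite -[RHS]/((u : C X P) ** (eps' ** g i) ** t i) !lcompA.
elim/big_ind: _ => [|x y|i _]; first exact: submodule0.
  exact: submoduleD.
exact: submoduleZ.
Qed.

(** Hom_B(Hom(X, P), B) is Hom(P, X), acting by precomposition. *)
Lemma lhom_corep (G : lhom corep) (u : corep) :
  linmap_lin G u = (u : C X P) ** (\sum_i g i ** (linmap_lin G (s i) : endo C P)) :> C P P.
Proof.
rewrite lcomp_sumr {1}(corep_dual_basis u) linear_sum; apply: eq_bigr => i _.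
by rewrite linearZ lcompA.
Qed.
End DualBasis.
End Corep.

Lemma corep_precomp_linear (k : fieldType) (O : Type) (C : lin_category k O) (P X Y : O)
  (g : C X Y) : linear (fun u : corep C P Y => (u : C Y P) ** g : corep C P X).
Proof.
move=> b u v; rewrite -[LHS]/(((b : C P P) ** (u : C Y P) + (v : C Y P)) ** g).
by rewrite lcompDl -lcompA.
Qed.

Section EndoFitting.
Variables (k : fieldType) (A : falgType k) (D : derived_category A).

Lemma dloc_bijective (X : cpx A) (e : chmap X X) : two_term X ->
  bijective (e (Negz 0)) -> bijective (e (Posz 0)) ->
  exists v : endo D X, v * (dloc D e : endo D X) = 1.
Proof.
move=> X2 /linear_inverse[e1' [e1K Ke1]] /linear_inverse[e0' [e0K Ke0]].
have H0 x : cdiff X 0 (e0' x) = 0 by apply: two_term_d0.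
have H1 x : e0' (dm1 X x) = dm1 X (e1' x).
  by apply: (can_inj e0K); rewrite Ke0 chmap_dm1 Ke1.
exists (dloc D (two_term_map X2 H0 H1)); rewrite -[LHS]dloc_comp -[RHS]dloc_id.
by congr (dloc D _); apply: two_term_map_ext => // x /=; rewrite ?e1K ?e0K.
Qed.

Lemma dloc_nilpotent (X : cpx A) (e : chmap X X) N : two_term X ->
  (forall x, iter N (e (Negz 0)) x = 0) -> (forall x, iter N (e (Posz 0)) x = 0) ->
  (dloc D e : endo D X) ^+ N = 0.
Proof.
move=> X2 e1 e0.
have -> : (dloc D e : endo D X) ^+ N = dloc D (chiter e N).
  rewrite /chiter; elim: N {e1 e0} => [|N IH]; first by rewrite /= dloc_id.
  by rewrite exprS IH /= dloc_comp.
rewrite -[RHS](dloc0 D); congr (dloc D _).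
by apply: two_term_map_ext => // x; rewrite chiterE.
Qed.

Variable Q : fgmod A.
Hypotheses (Q_proj : projective_mod Q) (Q_indec : indecomposable_mod Q).

Lemma indec_endoP (phi : {linear Q -> Q}) :
  bijective phi \/ exists N, forall x, iter N phi x = 0.
Proof.
have [N N0 st] := fitting (mklin (restr_linear (e := kconv (kfalg A)) phi)) (fingen_restr
    (fgmP Q)).
have [|] := indec_fitting Q_indec N0 st; first by left.
by right; exists N.
Qed.

Lemma zero_bij (M : lmodType A^c) (phi : M -> M) : is_zero_mod M -> bijective phi.
Proof. by move=> M0; exists id => x; rewrite (M0 x); apply: M0. Qed.

Lemma endo_stalk (u : endo D (stalk Q)) :
  (exists v, v * u = 1) \/ exists N, u ^+ N = 0.
Proof.
have [Q_p Q2] := stalk_two_term_proj Q_proj; have [e ->] := dloc_full Q_p Q2 u.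
have z : is_zero_mod (stalk Q (Negz 0)) by move=> x; apply/rowP => -[].
have [e_bij|[N eN]] := indec_endoP (e (Posz 0)).
  by left; apply: dloc_bijective => //; apply: zero_bij.
by right; exists N; apply: dloc_nilpotent => // x; apply: z.
Qed.

(** The same in degree -1. *)
Lemma endo_shift_stalk (u : endo D (shift (stalk Q))) :
  (exists v, v * u = 1) \/ exists N, u ^+ N = 0.
Proof.
have [Q_p Q2] := shift_stalk_two_term_proj Q_proj; have [e ->] := dloc_full Q_p Q2 u.
have z : is_zero_mod (shift (stalk Q) (Posz 0)) by move=> x; apply/rowP => -[].
have [e_bij|[N eN]] := indec_endoP (e (Negz 0)).
  by left; apply: dloc_bijective => //; apply: zero_bij.
by right; exists N; apply: dloc_nilpotent => // x; apply: z.
Qed.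

End EndoFitting.

(** * The minimal presentation and injectivity *)

Section Presentation.
Variables (k : fieldType) (A : falgType k) (D : derived_category A).
Variables (P : cpx A) (Q : fgmod A).
Hypotheses (P_silting : two_term_silting P) (Q_proj : projective_mod Q).
Hypothesis Q_indec : indecomposable_mod Q.
Hypothesis Q_shift : ~ in_add P (shift (stalk Q)).

Let P_tt := silting_two_term_proj P_silting.
Let P_ext := silting_ext_vanish P_silting.
Let Q_tt := stalk_two_term_proj Q_proj.

Lemma shift_not_in_addD : ~ in_addD D P (shift (stalk Q)).
Proof.
move=> Q1; apply: Q_shift.
apply: (in_addD_in_add P_tt (shift_stalk_two_term_proj Q_proj) _ Q1).
by right=> x; apply/rowP => -[].
Qed.

Variables (m : nat) (p : 'I_m -> Q) (xi : 'I_m -> {linear Q -> (A^c)^o}).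
Hypothesis pxi : forall x, x = \sum_i (xi i x : A^c) *: p i.

Local Notation e := (endo_kstruct D P).
Local Notation B := (endo D P).
Local Notation M := (rep D P (stalk (nu Q))).
Local Notation pair := (pairing (D := D) (P := P) Q_proj p xi).

Lemma restr_rep (X : cpx A) (c : k) (phi : restr (kconv e) (rep D P X)) :
  c *: phi = c *: (phi : D P X) :> D P X.
Proof.
rewrite -[LHS]/((phi : D P X) ** (c *: lid D P : D P P)).
by rewrite lcompZr lcomp1r.
Qed.

Lemma functional_linear (g : D (stalk Q) P) :
  linear (fun phi : restr (kconv e) M => pair phi g : k^o).
Proof.
move=> c x y; rewrite -[RHS](pairing_linl Q_proj p xi g).
by congr (pair _ _); congr (_ + _); apply: restr_rep.
Qed.
(** The left B-module Hom(Q, P) maps onto the dual of M by this. *)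
Definition functional g : rdual e M := mklin (functional_linear g).

Lemma functional_inj g : functional g = 0 -> g = 0.
Proof.
move=> E; apply: (pairing_perfect D P_tt Q_proj pxi).2 => phi.
by rewrite -[LHS]/(linmap_lin (functional g) phi) E.
Qed.

Lemma functional_surj (Lam : rdual e M) : exists g, functional g = Lam.
Proof.
have lin : linear (fun phi : D P (stalk (nu Q)) => linmap_lin Lam phi).
  move=> c x y; rewrite -linearP; congr (linmap_lin Lam _).
  by congr (_ + _); apply/esym/restr_rep.
have [g gP] := (pairing_perfect D P_tt Q_proj pxi).1 (mklin lin).
by exists g; apply: linmapP.
Qed.

Lemma functional_lin (b : B) (g h : D (stalk Q) P) :
  functional ((b : D P P) ** g + h) = b *: functional g + functional h.
Proof.
apply: linmapP => phi.
rewrite -[LHS]/(pair phi ((b : D P P) ** g + h)).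
rewrite -[RHS]/(pair ((phi : D P (stalk (nu Q))) ** (b : D P P)) g + pair phi h).
by rewrite /pairing lcompDr lcompA hom_traceD.
Qed.

Lemma pair_ext (phi psi : D P (stalk (nu Q))) :
  (forall g, pair phi g = pair psi g) -> phi = psi.
Proof.
move=> E; apply/eqP; rewrite -subr_eq0; apply/eqP.
apply: (pairing_inj P_tt pxi) => g.
rewrite -[LHS]/(mklin (pairing_linl Q_proj p xi g) _) linearB /= E.
exact: subrr.
Qed.

Lemma kscale_rep (c : k) (b : B) (V : lmodType B^c) (v : restr (kconv e) V) :
  (((c *: (b : D P P) : B) : B^c) *: (v : V)) = c *: (((b : B^c) *: (v : V)) : restr
      (kconv e) V) :> V.
Proof.
rewrite -[RHS]/((kinjc e c : B^c) *: ((b : B^c) *: (v : V))) scalerA; congr (_ *: _).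
by rewrite -[RHS]/((b : D P P) ** (c *: lid D P)) lcompZr lcomp1r.
Qed.

(** With a dual basis g, s of Hom(Q, P), a map f to M is determined by the
functionals <f -, s j>.  They extend to V as linear functionals mu j, and the
extension of f is then given by <h v, n> = sum_j mu j (v (n g_j)). *)
Lemma injective_of_in_addD : in_addD D P (stalk Q) -> injective_mod M.
Proof.
move=> [n [g [s gs]]] U V i f i_inj.
pose ik := mklin (restr_linear (e := kconv e) i).
pose fk := mklin (restr_linear (e := kconv e) f).
have /choice[mu muP] : forall j, exists mu : {linear restr (kconv e) V -> k^o},
    forall u, mu (ik u) = (linmap_lin (functional (s j)) \o fk) u.
  by move=> j; apply: extend_functional.
have lin (v : V) : linear (fun n' : D (stalk Q) P =>
    \sum_j mu j (((n' ** g j : B) : B^c) *: v) : k^o).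
  move=> c x y; rewrite scaler_sumr -big_split; apply: eq_bigr => j _.
  rewrite lcompDl lcompZl scalerDl kscale_rep.
  by rewrite [LHS](linearP (mu j)).
have /choice[h hP] : forall v, exists phi, forall n', pair phi n' = mklin (lin v) n'.
  by move=> v; apply: (pairing_surj P_tt Q_proj pxi).
have h_lin : linear (h : V -> M).
  move=> b v v'; apply: pair_ext => n'.
  rewrite -[RHS]/(pair ((h v : D P (stalk (nu Q))) ** (b : D P P) + h v') n').
  rewrite /pairing lcompDl -lcompA hom_traceD -!/(pair _ _) !hP /= -big_split.
  apply: eq_bigr => j _; rewrite scalerDr [LHS](linearD (mu j)); congr (mu j _ + _).
  by rewrite scalerA -lcompA.
exists (mklin h_lin) => u; apply: pair_ext => n'; rewrite [LHS]hP /=.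
transitivity (\sum_j pair (f u : D P (stalk (nu Q))) (n' ** g j ** s j)).
  apply: eq_bigr => j _; rewrite -linearZ [LHS](muP j).
  rewrite -[LHS]/(pair (f (((n' ** g j : B) : B^c) *: u)) (s j)) linearZ.
  by rewrite /pairing -!lcompA.
rewrite -(linear_sum (mklin (pairing_linr Q_proj p xi _))) /=; congr (pair _ _).
under eq_bigr do rewrite -lcompA.
by rewrite -lcomp_sumr gs lcomp1r.
Qed.

Section Approximated.
Variables (P' : cpx A) (P'_tt : two_term_proj P') (f : {linear Q -> P' (Posz 0)}).
Hypothesis f_approx : approx D P P'_tt f.
Hypothesis f_min : forall eps : D P' P',
  eps ** dloc D (approx_map P'_tt f) = dloc D (approx_map P'_tt f) ->
  exists eps', eps' ** eps = lid D P' /\ eps ** eps' = lid D P'.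

Local Notation C := (approx_cone f).
Local Notation F := (dloc D (approx_map P'_tt f)).
Local Notation Io := (dloc D (approx_cone_in Q_proj P'_tt f)).
Local Notation Del := (dloc D (approx_cone_out Q_proj P'_tt f)).
Let C_tt : two_term_proj C := approx_cone_two_term_proj Q_proj P'_tt f.

Lemma ext_vanish_approx : ext_vanish P P'.
Proof. exact: (ext_vanish_addr P_tt P'_tt (approx_in_addD f_approx) P_ext). Qed.

(** By [silting_maximal], since the two vanishing conditions follow from the long
Hom sequences. *)
Lemma approx_cone_in_addD : in_addD D P C.
Proof.
apply: (silting_maximal D P_silting C_tt); last first.
  by apply: ext_vanish_cone_r => //; apply: ext_vanish_approx.
apply: (ext_vanish_cone_l (D := D) Q_proj P_tt _ (approx_factor f_approx)).
exact: (ext_vanish_addl P_tt P'_tt (approx_in_addD f_approx) P_ext).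
Qed.

Definition p0_fun (u : corep D P P') : rdual e M := functional ((u : D P' P) ** F).
Lemma p0_linear : linear p0_fun.
Proof.
move=> b u v; rewrite /p0_fun -functional_lin; congr functional.
rewrite -[LHS]/(((b : D P P) ** (u : D P' P) + (v : D P' P)) ** F).
by rewrite lcompDl lcompA.
Qed.
Definition p0_map : {linear corep D P P' -> rdual e M} := mklin p0_linear.
Definition p1_map : {linear corep D P C -> corep D P P'} :=
  mklin (@corep_precomp_linear _ _ D P _ _ Io).

Lemma p0_eq0 u : p0_map u = 0 <-> (u : D P' P) ** F = 0.
Proof.
split=> [/functional_inj //|E]; rewrite /= /p0_fun E.
by apply: linmapP => phi; apply: pairing0.
Qed.

Lemma p0_surj : surj_map p0_map.
Proof.
move=> Lam; have [g <-] := functional_surj Lam.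
by have [u ->] := approx_factor f_approx g; exists u.
Qed.

Lemma p0_p1_exact x : p0_map x = 0 <-> exists y, x = p1_map y.
Proof.
split=> [/p0_eq0 xF|[y ->]].
  by have [y yE] := factor_cone_in Q_proj P_tt.2 xF; exists y.
apply/p0_eq0; rewrite -[p1_map y]/((y : D C P) ** Io) -lcompA.
by rewrite cone_in_map lcomp0r.
Qed.

(** Modulo the kernel, the generators s i of Hom(P', P) can be moved into T.  The
endomorphism of P' that they define fixes F, so it is invertible by minimality. *)
Lemma p0_superfluous : superfluous (fun x => p0_map x = 0).
Proof.
move=> T T_sub cover; have [n [g [s gs]]] := approx_in_addD f_approx.
have /choice[t tP] : forall i, exists t, T t /\ (s i ** F = (t : D P' P) ** F).
  move=> i; have [x [t [/p0_eq0 xF Tt st]]] := cover (s i : corep D P P').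
  exists t; split=> //; rewrite [s i]st.
  by rewrite -[LHS]/(((x : D P' P) + (t : D P' P)) ** F) lcompDl xF add0r.
have [|eps' [epsK _]] := f_min (eps := \sum_i g i ** t i).
  rewrite lcomp_suml -[RHS]lcomp1l -gs lcomp_suml; apply: eq_bigr => i _.
  by rewrite -!lcompA (tP i).2.
by apply: (corep_in_submodule T_sub (fun i => (tP i).1) epsK).
Qed.

(** Moving the generators of Hom(C, P) into T modulo the kernel changes the identity
of C to 1 - th Del, for a map th : Q[1] -> C that factors through a power of P.
It is invertible as soon as 1 - Del th is, in End(Q[1]).  Otherwise 1 - Del th is
nilpotent, Del th is invertible, and Q[1] is a summand of a power of P. *)
Lemma p1_superfluous : superfluous (fun x => p1_map x = 0).
Proof.
move=> T T_sub cover; have [n [g [s gs]]] := approx_cone_in_addD.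
have /choice[t tP] : forall i, exists t, T t /\ exists m : D (shift (stalk Q)) P,
    s i = m ** Del + (t : D C P).
  move=> i; have [x [t [x0 Tt st]]] := cover (s i : corep D P C).
  exists t; split=> //.
  by have [m' mE] := factor_cone_out (y := x : D C P) P_tt.2 x0; exists m'; rewrite -mE.
have /choice[l lP] : forall i, exists m : D (shift (stalk Q)) P, s i = m ** Del + t i.
  by move=> i; apply: (tP i).2.
pose th := \sum_i g i ** l i.
have tE : \sum_i g i ** t i = lid D C - th ** Del.
  rewrite -gs lcomp_suml -sumrB; apply: eq_bigr => i _.
  by rewrite lP lcompDr lcompA addrC addKr.
pose al : endo D (shift (stalk Q)) := Del ** th.
have [[be beK]|[N alN]] := endo_shift_stalk Q_proj Q_indec (1 - al).
  suff epsK : (lid D C + th ** (be : D _ _) ** Del) ** (\sum_i g i ** t i) = lid D C.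
    by apply: (corep_in_submodule T_sub (fun i => (tP i).1) epsK).
  have {beK} : (be : D _ _) ** (lid D _ - Del ** th) = lid D _ := beK.
  rewrite lcompBr lcomp1r => beK.
  rewrite tE lcompBr lcomp1r lcompDl lcomp1l.
  have -> : th ** be ** Del ** (th ** Del) = th ** (be ** (Del ** th)) ** Del.
    by rewrite !lcompA.
  have -> : be ** (Del ** th) = be - lid D _ by rewrite -beK opprB addrC subrK.
  by rewrite lcompBr lcomp1r lcompBl [th ** Del + _]addrC subrK addrK.
case: shift_not_in_addD.
have := subrX1 (1 - al) N; rewrite alN sub0r addrAC subrr sub0r mulNr => /oppr_inj.
set ga := \sum_(i < N) _ => al_ga.
exists n, (fun i => Del ** g i), (fun i => l i ** (ga : D _ _)).
rewrite -[RHS]/(1 : endo D (shift (stalk Q))) al_ga.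
rewrite -[RHS]/(Del ** th ** (ga : D _ _)) /th lcomp_sumr lcomp_suml.
by apply: eq_bigr => i _; rewrite !lcompA.
Qed.

Lemma minimal_presentation : minimal_proj_pres p1_map p0_map.
Proof.
have [n [g [s gs]]] := approx_in_addD f_approx; have [n' [g' [s' gs']]] :=
    approx_cone_in_addD.
split.
- exact: corep_fingen_projective gs'.
- exact: corep_fingen_projective gs.
- exact: p0_surj.
- exact: p0_p1_exact.
- by split; [exact: p0_superfluous | exact: p1_superfluous].
Qed.

(** The map G |-> Del (w G), where w G : P -> C represents G, is the cokernel of the
transposed presentation: it is onto because Hom(P, P'[1]) = 0, and its kernel
consists of the maps that factor through P'. *)
Lemma tau_inv : is_tau_inv e M (rep D P (shift (stalk Q))).
Proof.
exists (corep D P C), (corep D P P'), p1_map, p0_map; split.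
  exact: minimal_presentation.
have [n [g [s gs]]] := approx_cone_in_addD; have [n' [g' [s' gs']]] := approx_in_addD
    f_approx.
(* w G is the morphism P -> C that represents G. *)
pose w (G : lhom (corep D P C)) : D P C := \sum_i g i ** (linmap_lin G (s i) : endo D P).
have wP (G : lhom (corep D P C)) (u : corep D P C) :
    (linmap_lin G u : endo D P) = (u : D C P) ** w G :> D P P.
  exact: lhom_corep.
have w_lin (b : B^c) (G H : lhom (corep D P C)) :
    w (b *: G + H) = w G ** (b : D P P) + w H.
  rewrite /w lcomp_suml -big_split; apply: eq_bigr => i _.
  by rewrite -lcompA; apply: (lcompDr (g i)).
have w_mul (v : D P C) : w (precomp v) = v.
  rewrite -[RHS]lcomp1l -gs lcomp_suml; apply: eq_bigr => i _.
  by rewrite -[LHS]/(g i ** (s i ** v)) lcompA.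
have q_lin : linear (fun G => Del ** w G : rep D P (shift (stalk Q))).
  by move=> b G H; rewrite w_lin lcompDr lcompA.
exists (mklin q_lin); split.
  move=> a; have [v aE] := lift_cone_out Q_proj P'_tt f (a : D P (shift (stalk Q))) P_tt
      ext_vanish_approx.
  by exists (precomp v); rewrite /= w_mul -aE.
move=> G; split=> [/= wG|[h hP]].
  have [v vE] := lift_cone_in P_tt wG.
  by exists (precomp v) => u; rewrite [LHS]wP vE lcompA.
pose v : D P P' := \sum_i g' i ** (linmap_lin h (s' i) : endo D P).
have hv (u : corep D P P') : (linmap_lin h u : endo D P) = (u : D P' P) ** v :> D P P.
  exact: lhom_corep.
have -> : mklin q_lin G = Del ** (Io ** v) :> D P (shift (stalk Q)).
  rewrite -[LHS]/(Del ** w G); congr (_ ** _).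
  rewrite -[RHS]lcomp1l -gs lcomp_suml; apply: eq_bigr => i _.
  by rewrite hP hv -!lcompA.
by rewrite lcompA cone_out_in lcomp0l.
Qed.

Local Notation Q0 := (corep D P P').

Lemma restr_corep (c : k) (u : restr e Q0) : c *: u = c *: (u : D P' P) :> D P' P.
Proof. by rewrite -[LHS]/((c *: lid D P) ** (u : D P' P)) lcompZl lcomp1l. Qed.

(** Hom(P', P) is finite-dimensional, hence reflexive. *)
Lemma evaluation_perfect :
  (forall Lam : {linear restr (kconv e) (ldual e Q0) -> k^o},
     exists u : Q0, forall l : ldual e Q0, linmap_lin l u = Lam l) /\
  (forall u : Q0, (forall l : ldual e Q0, linmap_lin l u = 0) -> u = 0).
Proof.
apply: (@dual_pairing k (restr (kconv e) (ldual e Q0)) (restr e Q0)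
  (fun l u => linmap_lin (l : ldual e Q0) u)).
- have lin : linear (fun u : D P' P => u : restr e Q0).
    by move=> c x y; congr (_ + _); apply/esym/restr_corep.
  apply: (fingen_img (p := mklin lin)) => [u|]; first by exists u.
  by apply: fingen_hom; [exact: P'_tt.1 | exact: P'_tt.2].
- move=> u c l l'; rewrite -[LHS]/(linmap_lin (l : ldual e Q0) (c *: (u : restr e Q0)) +
    linmap_lin (l' : ldual e Q0) u).
  by rewrite linearZ.
- by move=> l c u u'; rewrite linearP.
- by move=> l l0; apply: linmapP.
- by move=> lam; exists (lam : ldual e Q0).
Qed.

(** M embeds into the dual of Hom(P', P) by j, and injectivity gives a retraction r.
Dually, si is a section of Hom(P', P) -> Hom(Q, P). *)
Lemma in_addD_of_injective : injective_mod M -> in_addD D P (stalk Q).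
Proof.
move=> M_inj; have [n [g [s gs]]] := approx_in_addD f_approx.
have [n' [g' [s' gs']]] := approx_cone_in_addD.
have j_lin (phi : M) : linear (fun u : restr e Q0 => pair phi ((u : D P' P) ** F)).
  move=> c u u'; rewrite -[RHS]pairing_linr -lcompZl -lcompDl.
  have E : c *: u + u' = c *: (u : D P' P) + u' :> D P' P.
    exact: (congr1 (fun z : D P' P => z + (u' : D P' P)) (restr_corep c u)).
  exact: (congr1 (fun z : D P' P => pair phi (z ** F)) E).
pose j (phi : M) : ldual e Q0 := mklin (j_lin phi).
have jL : linear j.
  move=> b phi psi; apply: linmapP => u.
  rewrite -[LHS]/(pair ((phi : D P (stalk (nu Q))) ** (b : D P P) + psi) ((u : D P' P) **
      F)).
  rewrite -[RHS]/(pair phi ((b : D P P) ** (u : D P' P) ** F) + pair psi ((u : D P' P) **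
      F)).
  by rewrite /pairing lcompDl hom_traceD -!lcompA.
have j_inj : injective (mklin jL).
  apply: lin_inj0 => phi j0; apply: (pairing_inj P_tt pxi) => x.
  have [u ->] := approx_factor f_approx x.
  by rewrite -[LHS]/(linmap_lin (j phi) u) [j phi]j0.
have [r rj] := M_inj _ _ (mklin jL) idfun j_inj.
pose rk := mklin (restr_linear (e := kconv e) r).
have /choice[si siP] : forall x : D (stalk Q) P, exists u : Q0,
    forall l : ldual e Q0, linmap_lin l u = pair (r l) x.
  move=> x; have [u uP] := evaluation_perfect.1 (linmap_lin (functional x) \o rk :
      {linear _ -> _}).
  by exists u => l; rewrite uP.
have si_F x : (si x : D P' P) ** F = x.
  apply/eqP; rewrite -subr_eq0; apply/eqP/functional_inj/linmapP => phi.
  rewrite -[LHS]/(mklin (pairing_linr Q_proj p xi phi) _) linearB /=.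
  rewrite -[pair phi (_ ** F)]/(linmap_lin (j phi) (si x)) siP [r _]rj.
  exact: subrr.
have si_lin (b : B) x y : si ((b : D P P) ** x + y) = b *: (si x : Q0) + si y.
  apply/eqP; rewrite -subr_eq0; apply/eqP/evaluation_perfect.2 => l.
  have E : linmap_lin l (b *: (si x : Q0)) = pair (r l) ((b : D P P) ** x).
    rewrite -[LHS]/(linmap_lin ((b : B^c) *: l : ldual e Q0) (si x)) siP [r _]linearZ.
    rewrite -[LHS]/(pair ((r l : D P (stalk (nu Q))) ** (b : D P P)) x).
    by rewrite /pairing lcompA.
  rewrite linearB linearD E !siP /pairing lcompDr hom_traceD.
  exact: subrr.
have si0 : si 0 = 0.
  have := si_lin (- 1) 0 0; rewrite lcomp0r addr0 scaleN1r addNr //.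
(* So precomposition with eps = sum_i g i (si (s i F)) is the projection u |-> si (u F). *)
have si_uF (u : D P' P) : si (u ** F) = u ** (\sum_i g i ** (si (s i ** F) : D P' P)) :>
    D P' P.
  have -> : u ** F = \sum_i ((u ** g i) ** (s i ** F)).
    rewrite -{1}[u]lcomp1r -gs lcomp_sumr lcomp_suml.
    by apply: eq_bigr => i _; rewrite !lcompA.
  rewrite lcomp_sumr; under [RHS]eq_bigr do rewrite lcompA.
  elim/big_rec2: _ => [|i x y _ IH]; first exact: si0.
  by rewrite (si_lin (u ** g i)) -IH.
have [|eps' [_ epsK]] := f_min (eps := \sum_i g i ** (si (s i ** F) : D P' P)).
  rewrite lcomp_suml -[RHS]lcomp1l -gs lcomp_suml; apply: eq_bigr => i _.
  by rewrite -!lcompA si_F.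
have F_epi (u : D P' P) : u ** F = 0 -> u = 0.
  move=> uF; rewrite -[u]lcomp1r -epsK lcompA -si_uF uF si0.
  exact: lcomp0l.
(* The generators of Hom(C, P) vanish on P'. *)
have Io0 : Io = 0.
  rewrite -[Io]lcomp1l -gs' lcomp_suml big1 // => i _.
  rewrite -lcompA [s' i ** Io]F_epi ?lcomp0r // -lcompA.
  by rewrite cone_in_map lcomp0r.
have [rho Frho] : exists rho, lid D P' = F ** rho.
  have IoF : Io ** lid D P' = 0 by rewrite Io0 lcomp0l.
  exact: lift_approx_map P'_tt IoF.
have [[v vK]|[N rhoFN]] := endo_stalk Q_proj Q_indec (rho ** F : endo D (stalk Q)).
  exists n, (fun i => (v : D _ _) ** rho ** g i), (fun i => s i ** F).
  have {}vK : (v : D _ _) ** (rho ** F) = lid D _ := vK.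
  rewrite -vK -[in RHS](lcomp1l F) -gs lcomp_suml !lcomp_sumr.
  by apply: eq_bigr => i _; rewrite !lcompA.
have F0 : F = 0.
  (* F rho is the identity, so F absorbs the powers of rho F. *)
  have FN i : F ** ((rho ** F : endo D (stalk Q)) ^+ i : D _ _) = F.
    elim: i => [|i IH]; first by rewrite expr0 [LHS]lcomp1r.
    rewrite exprS -[LHS]/(F ** ((rho ** F) ** ((rho ** F : endo D (stalk Q)) ^+ i : D _
        _))).
    by rewrite lcompA (lcompA F) -Frho lcomp1l.
  by rewrite -(FN N) rhoFN [LHS]lcomp0r.
have [t tK] := split_cone_out Q_proj F0.
case: shift_not_in_addD; exists n', (fun i => Del ** g' i), (fun i => s' i ** t).
rewrite -tK -[in RHS](lcomp1r Del) -gs' lcomp_sumr lcomp_suml.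
by apply: eq_bigr => i _; rewrite !lcompA.
Qed.

End Approximated.
End Presentation.

Theorem lemma5p2 (k : fieldType) (A : falgType k) (D : derived_category A)
    (P : cpx A) (P_silting : two_term_silting P)
    (Pi : fgmod A) (Pi_proj : projective_mod Pi)
    (Pi_indec : indecomposable_mod Pi)
    (Pi_shift : ~ in_add P (shift (stalk Pi))) :
  is_tau_inv (endo_kstruct D P)
    (rep D P (stalk (nu Pi))) (rep D P (shift (stalk Pi))) /\
  (injective_mod (rep D P (stalk (nu Pi))) <-> in_add P (stalk Pi)).
Proof.
have P_tt := silting_two_term_proj P_silting.
have [m [p [xi pxi]]] := dual_basis Pi_proj (fgmP Pi).
have [P' [P'_tt [f [f_approx f_min]]]] := minimal_approx D P_tt Pi_proj.
split; first exact: (tau_inv P_silting Pi_proj Pi_indec Pi_shift pxi f_approx f_min).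
split=> [M_inj|/(in_add_in_addD D)].
  apply: (in_addD_in_add (D := D) P_tt (stalk_two_term_proj Pi_proj)).
    by left=> x; apply/rowP => -[].
  exact: (in_addD_of_injective P_silting Pi_proj Pi_indec Pi_shift pxi f_approx f_min).
exact: (injective_of_in_addD P_silting Pi_proj pxi).
Qed.
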